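(* Let $H$ be a separable complex Hilbert space. Let $B=B_0+B_1$, where $B_0$ is a self-adjoint and strictly positive definite operator on $H$. Assume $A$ to be bounded from $D(B_0^{\frac12})$ to $D(B_0^{-\frac12})$ and $B_1$ to be bounded from $D(B_0^{\frac12})$ to $H$. Then the problem $$\ddot u(t)+Au(t)+B\dot u(t)=0,\quad t\ge0,\qquad u(0)=u_{10},\quad \dot u(0)=u_{20},$$ is governed by an analytic semigroup of angle $\frac{\pi}{2}$ on $D(B_0^{\frac12})\times H$. In particular, this problem admits a unique mild solution for all initial data $u_{10}\in D(B_0^{\frac12})$ and $u_{20}\in H$. If $A=\rho B$ for $\rho\in\mathbb C$, then the problem admits a unique classical solution for all $u_{10},u_{20}\in D(B_0^{\frac12})$ such that $\rho u_{10}+u_{20}\in D(B)$.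
   Context: Put $V:=D(B_0^{1/2})$ with inner product $(u\mid v)_V=(B_0^{1/2}u\mid B_0^{1/2}v)_H$; $D(B_0^{-1/2})$ denotes the completion of $H$ with respect to $\|B_0^{-1/2}\cdot\|_H$, i.e. the antidual of $V$ with pivot space $H$, and $\langle\cdot,\cdot\rangle$ is the corresponding duality pairing extending $(\cdot\mid\cdot)_H$. $B=B_0+B_1$ has domain $D(B)=D(B_0)$; it is also identified with its bounded extension from $V$ to $D(B_0^{-1/2})$, and $A=\rho B$ is understood in the sense of bounded operators from $V$ to $D(B_0^{-1/2})$. Let $a(u,v):=\langle Au,v\rangle$ and $b(u,v):=(B_0^{1/2}u\mid B_0^{1/2}v)_H+(B_1u\mid v)_H$ for $u,v\in V$, and on $\mathbf V=V\times V$ let $\mathbf a(\mathbf u,\mathbf v):=-(u_2\mid v_1)_V+a(u_1,v_2)+b(u_2,v_2)$. Let $\mathbf A$ be the operator on $\mathbf H=V\times H$ associated with $\mathbf a$: $D(\mathbf A)=\{\mathbf u\in\mathbf V:\exists\,\mathbf z\in\mathbf H\text{ s.t. }\mathbf a(\mathbf u,\mathbf v)=(\mathbf z\mid\mathbf v)_{\mathbf H}\ \forall \mathbf v\in\mathbf V\}$, $\mathbf A\mathbf u=\mathbf z$. The second order problem is understood in the weak sense as the first order problem $\dot{\mathbf u}(t)+\mathbf A\mathbf u(t)=0$, $\mathbf u(0)=(u_{10},u_{20})^\top$, with $\mathbf u=(u,\dot u)^\top$; it is ''governed by'' a semigroup on $\mathbf H$ if $-\mathbf A$ generates that semigroup.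 Mild and classical solutions are meant in the usual sense for this first order abstract Cauchy problem on $\mathbf H$: a mild solution is a function $\mathbf u\in C(\mathbb R_+,\mathbf H)$ with $\int_0^t\mathbf u(s)\,ds\in D(\mathbf A)$ and $\mathbf u(t)=\mathbf u(0)-\mathbf A\int_0^t\mathbf u(s)\,ds$ for all $t\ge0$; a classical solution is a function $\mathbf u\in C^1(\mathbb R_+,\mathbf H)\cap C(\mathbb R_+,D(\mathbf A))$ satisfying the equation for all $t\ge 0$. *)

(* Defs.v *)
From HB Require Import structures.
From mathcomp Require Import all_boot all_order all_algebra.
From mathcomp Require Import complex.
From mathcomp Require Import all_classical all_reals all_analysis.

Set Implicit Arguments.
Unset Strict Implicit.
Unset Printing Implicit Defensive.

Import Order.TTheory GRing.Theory Num.Theory.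
Import numFieldNormedType.Exports.

Local Open Scope classical_set_scope.
Local Open Scope ring_scope.
Local Open Scope complex_scope.

(* The norm of a normed module over R[i] takes its values in R[i]; norms and
   inner products are therefore compared inside R[i], whose order restricts to
   the usual one on real numbers (0 <= z implies that z is real).
   Inner products are linear in the first argument. *)
HB.mixin Record NormedModule_hasInner (R : realType) H
    & NormedModule R[i] H := {
  inner : H -> H -> R[i];
  inner_linearl : forall (a : R[i]) (u v w : H),
    inner (a *: u + v) w = a * inner u w + inner v w;
  innerC : forall u v : H, inner u v = Num.conj (inner v u);
  inner_normE : forall u : H, inner u u = `|u| ^+ 2
}.

#[short(type="hilbertType")]
HB.structure Definition Hilbert (R : realType) :=
  {H of CompleteNormedModule R[i] H & NormedModule_hasInner R H}.

Definition separable (T : topologicalType) :=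
  exists2 D : set T, countable D & dense D.

Definition bounded_op (K : numFieldType) (U W : normedModType K)
    (f : U -> W) := exists M : K, forall u, `|f u| <= M * `|u|.

Section InnerTheory.
Context {R : realType} {H : hilbertType R}.
Implicit Types u v w : H.

Lemma inner_linearr (a : R[i]) u v w :
  inner w (a *: u + v) = Num.conj a * inner w u + inner w v.
Proof. by rewrite innerC inner_linearl rmorphD rmorphM /= -(innerC w u) -(innerC w v). Qed.

Fact inner_bilinear :
  bilinear_for *%R (Num.conj \; *%R) (inner : H -> H -> R[i]).
Proof. by split=> w a u v; [exact: inner_linearl|exact: inner_linearr]. Qed.

Fact inner_hermitian u v : inner u v = (-1) ^+ false * Num.conj (inner v u).
Proof. by rewrite mul1r innerC. Qed.

Fact inner_gt0 u : u != 0 -> 0 < inner u u.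
Proof. by move=> u0; rewrite inner_normE exprn_gt0// normr_gt0. Qed.

HB.instance Definition _ := bilinear_isBilinear.Build R[i] H H R[i]
  *%R (Num.conj \; *%R) (inner : H -> H -> R[i]) inner_bilinear.
HB.instance Definition _ := isHermitianSesquilinear.Build R[i] H
  false Num.conj (inner : H -> H -> R[i]) inner_hermitian.
HB.instance Definition _ :=
  isDotProduct.Build R[i] H (inner : H -> H -> R[i]) inner_gt0.

Definition inner_dot : {dot H for Num.conj} := @inner R H.

Lemma innerDl u v w : inner (u + v) w = inner u w + inner v w.
Proof. exact: linearDl. Qed.

End InnerTheory.

(* Unbounded linear operators: [opfun] is total, but only its values on the
   domain are meaningful. *)
Record unbounded_op (R : realType) (H : hilbertType R) := UnboundedOp {
  dom : set H;
  opfun :> H -> H;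
  dom0 : dom 0;
  domP : forall (a : R[i]) u v, dom u -> dom v -> dom (a *: u + v);
  op_linear : forall (a : R[i]) u v, dom u -> dom v ->
    opfun (a *: u + v) = a *: opfun u + opfun v
}.

Section Operators.
Context {R : realType} {H : hilbertType R}.
Implicit Types B S : unbounded_op H.

(* The second clause says that the graph of B equals the graph of its
   adjoint. *)
Definition self_adjoint B :=
  dense (dom B) /\
  forall u w, (dom B u /\ B u = w) <->
              (forall v, dom B v -> inner (B v) u = inner v w).

Definition nonneg_op B := forall u, dom B u -> 0 <= inner (B u) u.

Definition strictly_positive B :=
  exists2 c : R, 0 < c &
    forall u, dom B u -> c%:C * `|u| ^+ 2 <= inner (B u) u.

(* S is the square root of B, i.e., the nonnegative self-adjoint operator with
   S^2 = B, domains included. *)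
Definition is_sqrt B S :=
  [/\ self_adjoint S, nonneg_op S,
      (forall u, dom B u <-> (dom S u /\ dom S (S u))) &
      (forall u, dom B u -> B u = S (S u))].

Lemma op_at0 B : B 0 = 0.
Proof.
have := op_linear (-1) (dom0 B) (dom0 B).
by rewrite !scaleN1r !addNr.
Qed.

End Operators.

Section EnergySpace.
Context {R : realType} {H : hilbertType R} (B0 S : unbounded_op H).

Definition dom_pred : {pred H} := mem (dom S).

Fact dom_pred_submod : submod_closed dom_pred.
Proof.
split=> [|a u v]; rewrite !inE ?/dom_pred.
  exact: dom0.
by move=> Su Sv; exact: domP.
Qed.

HB.instance Definition _ :=
  GRing.isSubmodClosed.Build R[i] H dom_pred dom_pred_submod.

(* The space V = D(S), with |u|_V = |S u|_H, for S the square root of the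
   strictly positive operator B0. The two hypotheses are parameters of the type
   because they are what makes |S u|_H a norm. *)
Record energy_space (B0_pos : strictly_positive B0) (B0S : is_sqrt B0 S) :=
  EnergySpace { to_H :> H; to_H_dom : to_H \in dom_pred }.

Hypotheses (B0_pos : strictly_positive B0) (B0S : is_sqrt B0 S).
Local Notation V := (energy_space B0_pos B0S).

HB.instance Definition _ := [isSub for (@to_H B0_pos B0S)].
HB.instance Definition _ := [Choice of V by <:].
HB.instance Definition _ := [SubChoice_isSubLmodule of V by <:].

Lemma energy_dom (u : V) : dom S u.
Proof. by case: u => u /= uS; move: uS; rewrite inE. Qed.

Lemma to_HD (u v : V) : to_H (u + v) = to_H u + to_H v.
Proof. exact: (raddfD (\val : V -> H)). Qed.

Lemma to_HZ (a : R[i]) (u : V) : to_H (a *: u) = a *: to_H u.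
Proof. exact: (linearZ_LR (\val : V -> H)). Qed.

Lemma to_H0 : to_H (0 : V) = 0.
Proof. exact: (raddf0 (\val : V -> H)). Qed.

Definition energy_norm (u : V) : R[i] := `|S u|.

Fact energy_normD (u v : V) :
  energy_norm (u + v) <= energy_norm u + energy_norm v.
Proof.
rewrite /energy_norm to_HD -[X in S (X + _)]scale1r.
rewrite op_linear; [|exact: energy_dom|exact: energy_dom].
by rewrite scale1r ler_normD.
Qed.

Fact energy_normZ (a : R[i]) (u : V) :
  energy_norm (a *: u) = `|a| * energy_norm u.
Proof.
rewrite /energy_norm to_HZ -[a *: to_H u]addr0.
rewrite op_linear; [|exact: energy_dom|exact: dom0].
by rewrite op_at0 addr0 normrZ.
Qed.

Fact energy_norm0_eq0 (u : V) : energy_norm u = 0 -> u = 0.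
Proof.
move=> /normr0_eq0 Su0; apply/val_inj.
rewrite -[RHS]/(to_H (0 : V)) to_H0 -[LHS]/(to_H u).
have [[c c0 cB] [_ _ domB BE]] := (B0_pos, B0S).
have Bu : dom B0 u by apply/domB; rewrite Su0; split;
  [exact: energy_dom|exact: dom0].
have := cB _ Bu; rewrite BE// Su0 op_at0.
have -> : inner (0 : H) u = 0.
  by apply: (@addrI _ (inner (0 : H) u)); rewrite -innerDl !addr0.
rewrite pmulr_rle0 ?ltcR// => u0; apply/normr0_eq0/eqP.
by rewrite -sqrf_eq0 eq_le u0 exprn_ge0.
Qed.

HB.instance Definition _ := Lmodule_isNormed.Build R[i] V
  energy_normD energy_normZ energy_norm0_eq0.

Definition inner_V (u v : V) : R[i] := inner (S u) (S v).

Lemma inner_V_normE (u : V) : inner_V u u = `|u| ^+ 2.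
Proof. exact: inner_normE. Qed.

End EnergySpace.

Section Antidual.
Context {R : realType} (V : normedModType R[i]).

Definition antidual_pred : {pred (V -> R[i]^o)} :=
  [pred f : V -> R[i]^o | `[< (forall (a : R[i]) u v,
      f (a *: u + v) = Num.conj a * f u + f v) /\ bounded_op f >] ].

Fact antidual_submod : submod_closed antidual_pred.
Proof.
split=> [|a f g].
  apply/asboolP; split=> [a u v|]; first by rewrite /= mulr0 addr0.
  by exists 0 => v; rewrite /= normr0 mul0r.
move=> /asboolP[fL [M fM]] /asboolP[gL [N gN]]; apply/asboolP; split.
  move=> b u v; rewrite !fctE fL gL !scalerDr mulrDr addrACA.
  by congr (_ + _ + _); rewrite /GRing.scale/= mulrCA.
exists (`|a| * M + N) => v; rewrite !fctE (le_trans (ler_normD _ _))//.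
by rewrite normrZ mulrDl -mulrA lerD// ler_wpM2l.
Qed.

HB.instance Definition _ :=
  GRing.isSubmodClosed.Build R[i] _ antidual_pred antidual_submod.

Record antidual :=
  Antidual { antidual_fun :> V -> R[i]^o; _ : antidual_fun \in antidual_pred }.

HB.instance Definition _ := [isSub for antidual_fun].
HB.instance Definition _ := [Choice of antidual by <:].
HB.instance Definition _ := [SubChoice_isSubLmodule of antidual by <:].

(* The dual norm sup {|f v| : |v| <= 1}, as an element of R[i]. *)
Definition antidual_norm (f : antidual) : R[i] :=
  (sup [set complex.Re `|f v| | v in [set v : V | `|v| <= 1]])%:C.

Lemma antidual_linear (f : antidual) (a : R[i]) u v :
  f (a *: u + v) = Num.conj a * f u + f v.
Proof. by case: f => f /= /asboolP[]. Qed.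

Lemma antidual_bounded (f : antidual) : bounded_op f.
Proof. by case: f => f /= /asboolP[]. Qed.

Lemma antidualD (f g : antidual) v : (f + g) v = f v + g v.
Proof. by []. Qed.

Lemma antidualZ (a : R[i]) (f : antidual) v : (a *: f) v = a * f v.
Proof. by []. Qed.

Lemma antidual_at0 (f : antidual) : f 0 = 0.
Proof.
have := antidual_linear f 1 0 0.
by rewrite rmorph1 mul1r scaler0 addr0 => /(congr1 (+%R (- f 0))); rewrite addNr addKr.
Qed.

Let ReN (z : R[i]) : (complex.Re `|z|)%:C = `|z|.
Proof. exact/RRe_real/normr_real. Qed.

Let antidual_set (f : antidual) := [set complex.Re `|f v| | v in [set v : V | `|v| <= 1]].

Let has_sup_antidual (f : antidual) : has_sup (antidual_set f).
Proof.
split; first by exists (complex.Re `|f 0|), 0 => //=; rewrite normr0.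
have [M fM] := antidual_bounded f.
exists (complex.Re `|M|) => _ /= [v v1 <-].
rewrite -lecR !ReN (le_trans (fM v))// (le_trans (real_ler_norm _))//.
  by rewrite -[X in X \is Num.real]subr0 ger0_real// subr0 (le_trans _ (fM v)).
by rewrite normrM normr_id ler_piMr.
Qed.

Lemma antidual_norm_ub (f : antidual) (v : V) :
  `|v| <= 1 -> `|f v| <= antidual_norm f.
Proof.
move=> v1; rewrite -ReN lecR; apply: sup_upper_bound; first exact: has_sup_antidual.
by exists v.
Qed.

Lemma antidual_norm_le (f : antidual) (M : R) :
  (forall v : V, `|v| <= 1 -> `|f v| <= M%:C) -> antidual_norm f <= M%:C.
Proof.
move=> fM; rewrite lecR; apply: ge_sup.
  by exists (complex.Re `|f 0|), 0 => //=; rewrite normr0.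
by move=> _ [v v1 <-]; rewrite -lecR ReN fM.
Qed.

Lemma antidual_norm_ge0 (f : antidual) : 0 <= antidual_norm f.
Proof. by apply: le_trans (@antidual_norm_ub f 0 _); rewrite ?normr0. Qed.

Fact antidual_normD (f g : antidual) :
  antidual_norm (f + g) <= antidual_norm f + antidual_norm g.
Proof.
rewrite -rmorphD; apply: antidual_norm_le => v v1.
by rewrite rmorphD antidualD (le_trans (ler_normD _ _))// lerD// antidual_norm_ub.
Qed.

Let antidual_normZ_le (a : R[i]) (f : antidual) :
  antidual_norm (a *: f) <= `|a| * antidual_norm f.
Proof.
rewrite -[`|a|]ReN -rmorphM; apply: antidual_norm_le => v v1.
by rewrite antidualZ rmorphM/= ReN normrM ler_wpM2l// antidual_norm_ub.
Qed.

Fact antidual_normZ (a : R[i]) (f : antidual) :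
  antidual_norm (a *: f) = `|a| * antidual_norm f.
Proof.
apply/eqP; rewrite eq_le antidual_normZ_le/=.
have [->|a0] := eqVneq a 0; first by rewrite normr0 mul0r antidual_norm_ge0.
rewrite -ler_pdivlMl ?normr_gt0// -normfV.
by rewrite -[X in antidual_norm X <= _](scalerK a0) antidual_normZ_le.
Qed.

Lemma antidual_normP (f : antidual) (v : V) :
  `|f v| <= antidual_norm f * `|v|.
Proof.
have [->|v0] := eqVneq v 0; first by rewrite antidual_at0 !normr0 mulr0.
have v0' : 0 < `|v| by rewrite normr_gt0.
pose a := `|v|^-1; have a0 : 0 <= a by rewrite invr_ge0.
have fa : f (a *: v) = Num.conj a * f v.
  by have := antidual_linear f a v 0; rewrite !addr0 antidual_at0 addr0.
have : `|f (a *: v)| <= antidual_norm f.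
  by rewrite antidual_norm_ub// normrZ ger0_norm// mulVf ?gt_eqF.
by rewrite fa normrM norm_conjC (ger0_norm a0) mulrC ler_pdivrMr.
Qed.

Fact antidual_norm0_eq0 (f : antidual) : antidual_norm f = 0 -> f = 0.
Proof.
move=> f0; apply/val_inj/funext => v /=; apply/normr0_eq0/eqP.
by rewrite eq_le normr_ge0 (le_trans (antidual_normP f v))// f0 mul0r.
Qed.

HB.instance Definition _ := Lmodule_isNormed.Build R[i] antidual
  antidual_normD antidual_normZ antidual_norm0_eq0.

End Antidual.

Section Semigroups.
Context {R : realType} {E : normedModType R[i]}.

(* Operators are represented by their graphs: [A x z] means x \in D(A) and
   A x = z. *)
Implicit Types (A G : E -> E -> Prop) (T : R[i] -> {linear E -> E}).

Definition neg_op A : E -> E -> Prop := fun x z => A x (- z).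

(* The open sector {z != 0 : |arg z| < theta}, for theta <= pi. *)
Definition sector (theta : R) : set R[i] :=
  [set z | exists r phi : R,
     [/\ 0 < r, `|phi| < theta & z = (r * cos phi) +i* (r * sin phi)]].

(* Complex differentiability at z in operator norm. *)
Definition complex_differentiable T (z : R[i]) :=
  exists2 T' : {linear E -> E}, bounded_op T' &
    forall e : R, 0 < e -> \forall h \near (0 : R[i]^o)^', forall x,
      `|h^-1 *: (T (z + h) x - T z x) - T' x| <= e%:C * `|x|.

(* Values of T outside of sector theta and 0 are irrelevant. *)
Record analytic_semigroup (theta : R) T : Prop := AnalyticSemigroup {
  semigroup_bounded : forall z, sector theta z -> bounded_op (T z);
  semigroup0 : forall x, T 0 x = x;
  semigroupD : forall z w x, sector theta z -> sector theta w ->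
    T (z + w) x = T z (T w x);
  semigroup_analytic : forall z, sector theta z -> complex_differentiable T z;
  semigroup_continuous : forall theta' x, 0 < theta' < theta ->
    T z x @[z --> within (sector theta') (nbhs (0 : R[i]^o))] --> x
}.

Definition is_generator T G :=
  forall x z, G x z <->
    (t^-1)%:C *: (T t%:C x - x) @[t --> (0 : R)^'+] --> z.

Definition generates_analytic_semigroup theta G :=
  exists2 T, analytic_semigroup theta T & is_generator T G.

Definition Riemann_integral (u : R -> E) (a b : R) (w : E) :=
  forall e : R, 0 < e -> exists2 d : R, 0 < d &
    forall (n : nat) (x s : nat -> R),
      x 0%N = a -> x n = b ->
      (forall i, (i < n)%N -> x i <= s i <= x i.+1 /\ x i.+1 - x i < d) ->
      `|\sum_(i < n) (x i.+1 - x i)%:C *: u (s i) - w| < e%:C.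

Definition continuous_Rplus (u : R -> E) := {within `[0%R, +oo[, continuous u}.

(* Derivative at t within [0, +oo[, hence one-sided at 0. *)
Definition is_derive_Rplus (u : R -> E) (t : R) (w : E) :=
  (h^-1)%:C *: (u (t + h) - u t)
    @[h --> within [set h | 0 <= t + h] (0 : R)^'] --> w.

(* Solutions of u' + A u = 0, u 0 = u0 on [0, +oo[; the values of u at negative
   times are irrelevant. *)
Definition mild_solution A (u0 : E) (u : R -> E) :=
  [/\ u 0 = u0, continuous_Rplus u &
      forall t, 0 <= t -> exists I AI : E,
        [/\ Riemann_integral u 0 t I, A I AI & u t = u 0 - AI]].

Definition classical_solution A (u0 : E) (u : R -> E) :=
  u 0 = u0 /\ exists du Au : R -> E,
    [/\ continuous_Rplus u, continuous_Rplus du, continuous_Rplus Au &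
        forall t, 0 <= t ->
          [/\ is_derive_Rplus u t (du t), A (u t) (Au t) & du t + Au t = 0]].

Definition exists_unique_solution (sol : E -> (R -> E) -> Prop) (u0 : E) :=
  exists2 u, sol u0 u &
    forall u', sol u0 u' -> forall t, 0 <= t -> u' t = u t.

End Semigroups.

Section DampedWave.
Context {R : realType} {H : hilbertType R} {B0 S : unbounded_op H}.
Context {B0_pos : strictly_positive B0} {B0S : is_sqrt B0 S}.
Local Notation V := (energy_space B0_pos B0S).
Variables (A : {linear V -> antidual V}) (B1 : {linear V -> H}).

(* B0 + B1 with domain D(B0), which is contained in V. *)
Definition damping_fun (x : H) : H :=
  B0 x + (if insub x is Some u then B1 (u : V) else 0).

Let domS x : dom B0 x -> x \in dom_pred S.
Proof. by rewrite inE; have [_ _ domB _] := B0S; case/domB. Qed.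

Lemma damping_funE (u : V) : damping_fun u = B0 u + B1 u.
Proof. by rewrite /damping_fun valK. Qed.

Fact damping_linear (a : R[i]) x y : dom B0 x -> dom B0 y ->
  damping_fun (a *: x + y) = a *: damping_fun x + damping_fun y.
Proof.
move=> Bx By; pose u : V := Sub x (domS Bx); pose v : V := Sub y (domS By).
have -> : a *: x + y = to_H (a *: u + v) by rewrite to_HD to_HZ.
rewrite damping_funE (damping_funE u) (damping_funE v) to_HD to_HZ op_linear//.
by rewrite linearP scalerDr addrACA.
Qed.

Definition damping : unbounded_op H :=
  UnboundedOp (dom0 B0) (@domP _ _ B0) damping_linear.

(* The extension of B from V to its antidual, H being embedded in the antidual
   through x |-> (x | .)_H; it is unique since D(B0) is dense in V. *)
Definition bounded_extension (Bx : {linear V -> antidual V}) :=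
  bounded_op Bx /\
  forall u v : V, dom damping u -> Bx u v = inner (damping u) (v : H).

Definition form_a (u v : V) : R[i] := A u v.

Definition form_b (u v : V) : R[i] := inner (S u) (S v) + inner (B1 u) (v : H).

Definition wave_form (u v : V * V) : R[i] :=
  - inner_V u.2 v.1 + form_a u.1 v.2 + form_b u.2 v.2.

(* The library norm of V * H is the maximum of the norms, which is equivalent to
   the norm of this inner product. *)
Definition inner_VH (x y : V * H) : R[i] := inner_V x.1 y.1 + inner x.2 y.2.

Definition incl (u : V * V) : V * H := (u.1, u.2 : H).

(* Graph of the operator on V * H associated with the form: the image of V * V
   being dense in V * H, at most one z corresponds to a given x. *)
Definition wave_op (x z : V * H) : Prop :=
  exists2 u : V * V, x = incl u &
    forall v : V * V, wave_form u v = inner_VH z (incl v).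

Lemma form_bE (u v : V) : dom damping u ->
  form_b u v = inner (damping u) (v : H).
Proof.
move=> Bu; rewrite /= damping_funE innerDl; congr (_ + _).
have [[_ Ssa] _ domB BE] := B0S; rewrite BE//.
have [Su SSu] := (domB u).1 Bu.
by have /(_ _ SSu)-> := ((Ssa v (S v)).1 (conj (energy_dom v) erefl)).
Qed.

End DampedWave.

(* Main.v *)
(* The form of the operator A on V * H satisfies
   |(A x | x) - p^2| <= K p |x|  with  p = |x_2|_V,
   so its numerical range lies in a parabola and, for every angle below pi / 2,
   the rotated operators are quasi-accretive. By Lax-Milgram they are
   m-accretive. The semigroup is the limit of the Euler polynomials
   (1 - z Y_n / nu^3)^(nu^3), where Y_n = nu (1 - (1 + A / nu)^-1) is the Yosida
   approximation, nu = n + n_1 and |Y_n| <= 3 nu. These polynomials are bounded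
   uniformly in n on bounded parts of each sector {Re z >= d |z|}, and they
   converge there by telescoping, since the Y_n commute. As they are polynomials
   in z, Cauchy's estimates are finite Fourier sums over roots of unity; being
   uniform in n, they give the differentiability of the limit in operator norm.
   Mild solutions are unique because a primitive of the difference of two of them
   follows the implicit Euler scheme up to o(step). *)

Require Import Defs.
From HB Require Import structures.
From mathcomp Require Import all_boot all_order all_algebra.
From mathcomp Require Import complex.
From mathcomp Require Import all_classical all_reals all_analysis.
From mathcomp Require Import ring lra.
From mathcomp Require cyclic separable cyclotomic.

Import Order.TTheory GRing.Theory Num.Theory.
Import numFieldNormedType.Exports.

Local Open Scope classical_set_scope.
Local Open Scope ring_scope.
Local Open Scope complex_scope.

Set Implicit Arguments.
Unset Strict Implicit.

(* lra does not cope with let-bound variables in the context. *)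
Ltac lra_let := intros; repeat match goal with x := _ |- _ => clearbody x end; lra.

(** Resolvents at real points suffice because stability in complex directions is taken from the
    form, not from resolvent bounds off the real axis. Expanding |x - h Y x|^2 gives a growth factor
    1 + O(|h|) whenever Re h >= d |h|, up to a quadratic term which the smallness of the step
    controls. Here d is any positive number, whence the full angle pi / 2; the constants blow up as
    d tends to 0, which is harmless because analyticity is local and continuity at 0 is only
    required on smaller sectors. This expansion needs an inner product, whereas the norm of [V * H]
    is a maximum. Everything is therefore proved in the norm of an abstract form [ip], and the two
    norms are compared only when the results are translated into topological statements. The limits
    are strong limits. What must hold in operator norm is obtained from bounds that are linear in
    |x| with constants independent of n and x. *)

Notation normc := Normc.normc.
Notation Re := complex.Re.

(** * Modulus and real part of complex numbers *)

Section Modulus.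
Context {R : realType}.
Implicit Types z w : R[i].

Lemma normcE z : `|z| = (normc z)%:C.
Proof. by []. Qed.

Lemma normc_ge0 z : 0 <= normc z.
Proof. by rewrite -lecR -normcE normr_ge0. Qed.

Lemma normc_eq0 z : (normc z == 0) = (z == 0).
Proof. by rewrite -(inj_eq (@complexI R)) -normcE normr_eq0. Qed.

Lemma normc_real (x : R) : normc x%:C = `|x|.
Proof. by rewrite /= expr0n /= addr0 sqrtr_sqr. Qed.

Lemma normcJ z : normc (Num.conj z) = normc z.
Proof. by apply: complexI; rewrite -!normcE norm_conjC. Qed.

Lemma normcN z : normc (- z) = normc z.
Proof. by apply: complexI; rewrite -!normcE normrN. Qed.

Lemma abs_Re_normc z : `|Re z| <= normc z.
Proof. by rewrite -lecR -normcE normc_ge_Re. Qed.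

Lemma Re_normc z : Re z <= normc z.
Proof. exact: le_trans (ler_norm _) (abs_Re_normc z). Qed.

Lemma ReD z w : Re (z + w) = Re z + Re w. Proof. exact: raddfD. Qed.
Lemma ReN z : Re (- z) = - Re z. Proof. exact: raddfN. Qed.
Lemma ReB z w : Re (z - w) = Re z - Re w. Proof. exact: raddfB. Qed.
Lemma ReJ z : Re (Num.conj z) = Re z. Proof. by case: z. Qed.
Lemma ReZ (x : R) z : Re (x%:C * z) = x * Re z.
Proof. by case: z => a b /=; rewrite mul0r subr0. Qed.

End Modulus.

(** * Hilbert spaces *)

Section InnerProduct.
Context {R : realType} {E : lmodType R[i]} (ip : E -> E -> R[i]).

Definition ipnorm (x : E) : R := Num.sqrt (Re (ip x x)).

Definition ipcvg (u : nat -> E) (l : E) :=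
  forall e : R, 0 < e -> exists n0, forall n, (n0 <= n)%N -> ipnorm (u n - l) <= e.

Definition ipcauchy (u : nat -> E) :=
  forall e : R, 0 < e ->
    exists n0, forall n m, (n0 <= n)%N -> (n0 <= m)%N -> ipnorm (u n - u m) <= e.

(** A Hilbert space described by its form alone, with sequential completeness. [V * H] cannot be an
    instance of [hilbertType] with its given norm, since a maximum norm does not come from an inner
    product. *)
Record hilbert_ip : Prop := {
  hip_linear : forall (a : R[i]) u v w, ip (a *: u + v) w = a * ip u w + ip v w;
  hip_conj : forall u v, ip u v = Num.conj (ip v u);
  hip_pos : forall u, u != 0 -> 0 < ip u u;
  hip_complete : forall u, ipcauchy u -> exists l, ipcvg u l }.

Hypothesis hip : hilbert_ip.
Local Notation N := ipnorm.
Implicit Types (x y z : E) (a b : R[i]).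

Lemma ipDl x y z : ip (x + y) z = ip x z + ip y z.
Proof. by have := hip_linear hip 1 x y z; rewrite scale1r mul1r. Qed.

Lemma ip0l z : ip 0 z = 0.
Proof. by apply: (@addrI _ (ip 0 z)); rewrite -ipDl !addr0. Qed.

Lemma ipZl a x z : ip (a *: x) z = a * ip x z.
Proof. by rewrite -[a *: x]addr0 hip_linear// ip0l addr0. Qed.

Lemma ipNl x z : ip (- x) z = - ip x z.
Proof. by rewrite -scaleN1r ipZl mulN1r. Qed.

Lemma ipBl x y z : ip (x - y) z = ip x z - ip y z.
Proof. by rewrite ipDl ipNl. Qed.

Lemma ipDr x y z : ip z (x + y) = ip z x + ip z y.
Proof. by rewrite hip_conj// ipDl rmorphD /= -!hip_conj. Qed.

Lemma ipZr a x z : ip z (a *: x) = Num.conj a * ip z x.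
Proof. by rewrite hip_conj// ipZl rmorphM /= -hip_conj. Qed.

Lemma ipNr x z : ip z (- x) = - ip z x.
Proof. by rewrite -scaleN1r ipZr rmorphN1 mulN1r. Qed.

Lemma ipBr x y z : ip z (x - y) = ip z x - ip z y.
Proof. by rewrite ipDr ipNr. Qed.

Lemma ip0r z : ip z 0 = 0.
Proof. by rewrite -[0 : E](scale0r 0) ipZr rmorph0 mul0r. Qed.

Lemma ReipC x y : Re (ip x y) = Re (ip y x).
Proof. by rewrite hip_conj// ReJ. Qed.

Lemma Reip_ge0 x : 0 <= Re (ip x x).
Proof.
have [->|/(hip_pos hip)] := eqVneq x 0; first by rewrite ip0l.
by rewrite ltcE => /andP[_ /ltW].
Qed.

Lemma ipnorm_ge0 x : 0 <= N x. Proof. exact: sqrtr_ge0. Qed.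

Lemma ipnorm_sqr x : N x ^+ 2 = Re (ip x x).
Proof. by rewrite sqr_sqrtr ?Reip_ge0. Qed.

Lemma ipE x : ip x x = (N x ^+ 2)%:C.
Proof.
rewrite ipnorm_sqr; have [->|/(hip_pos hip)] := eqVneq x 0; first by rewrite ip0l.
by rewrite ltcE => /andP[/eqP + _]; case: (ip x x) => p q /= ->.
Qed.

Lemma ipnorm0 : N 0 = 0.
Proof. by rewrite /ipnorm ip0l sqrtr0. Qed.

Lemma ipnorm_eq0 x : N x = 0 -> x = 0.
Proof.
move=> x0; have [//|/(hip_pos hip)] := eqVneq x 0.
by rewrite ipE x0 expr0n /= ltxx.
Qed.

Lemma ipnorm_le0 x : N x <= 0 -> x = 0.
Proof. by move=> x0; apply: ipnorm_eq0; apply/eqP; rewrite eq_le x0 ipnorm_ge0. Qed.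

Lemma ipnormZ a x : N (a *: x) = normc a * N x.
Proof.
have aa : a * Num.conj a = ((normc a) ^+ 2)%:C.
  by rewrite -normCK normcE rmorphXn.
apply/eqP; rewrite -(@eqrXn2 _ 2%N)// ?mulr_ge0 ?ipnorm_ge0 ?normc_ge0//.
by rewrite ipnorm_sqr ipZl ipZr mulrA aa ReZ exprMn -ipnorm_sqr.
Qed.

Lemma ipnormN x : N (- x) = N x.
Proof. by rewrite -scaleN1r ipnormZ normcN Normc.normc1 mul1r. Qed.

Lemma ipnormC x y : N (x - y) = N (y - x).
Proof. by rewrite -opprB ipnormN. Qed.

Lemma ipnorm_sqrD x y : N (x + y) ^+ 2 = N x ^+ 2 + 2 * Re (ip x y) + N y ^+ 2.
Proof.
by rewrite !ipnorm_sqr ipDl !ipDr !ReD (ReipC y x); ring.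
Qed.

(** With s = |x|, t = |y| and p the real part, the squared norm of t x - s y equals 2 s t (s t -
    p). *)
Lemma Reip_le x y : Re (ip x y) <= N x * N y.
Proof.
have [->|y0] := eqVneq y 0; first by rewrite ip0r ipnorm0 mulr0.
have Ny : 0 < N y.
  by rewrite lt_neqAle ipnorm_ge0 eq_sym andbT; apply: contra y0 => /eqP/ipnorm_eq0->.
have [->|x0] := eqVneq x 0; first by rewrite ip0l ipnorm0 mul0r.
have Nx : 0 < N x.
  by rewrite lt_neqAle ipnorm_ge0 eq_sym andbT; apply: contra x0 => /eqP/ipnorm_eq0->.
have := sqr_ge0 (N ((N y)%:C *: x + (- N x)%:C *: y)).
rewrite ipnorm_sqrD !ipnormZ !normc_real ipZl ipZr ReZ.
have -> : Num.conj (- N x)%:C = (- N x)%:C by exact: conjc_real.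
rewrite ReZ normrN !gtr0_norm//.
move: (Re _) (N x) (N y) Nx Ny => p s t s0 t0 H.
have : 0 <= (s * t) * (s * t - p) by move: H; rewrite !exprMn; nra.
by rewrite pmulr_rge0 ?mulr_gt0// subr_ge0.
Qed.

Lemma ipnormD x y : N (x + y) <= N x + N y.
Proof.
rewrite -(@ler_pXn2r _ 2%N)// ?nnegrE ?addr_ge0 ?ipnorm_ge0//.
rewrite ipnorm_sqrD; have := Reip_le x y; move: (Re _) (N x) (N y) => p s t; nra.
Qed.

Lemma ipnormB x y : N (x - y) <= N x + N y.
Proof. by rewrite (le_trans (ipnormD _ _))// ipnormN. Qed.

Lemma ipnorm_dist x y z : N (x - z) <= N (x - y) + N (y - z).
Proof. by have := ipnormD (x - y) (y - z); rewrite addrA subrK. Qed.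

Lemma ipnorm_distr x y : N x <= N y + N (x - y).
Proof. by have := ipnormD y (x - y); rewrite subrKC. Qed.

(** Multiplying x by the conjugate of p = (x | y) turns the product into |p|^2, so the bound on real
    parts applies. *)
Lemma ip_le x y : normc (ip x y) <= N x * N y.
Proof.
set p := ip x y; have [p0|p0] := eqVneq p 0.
  by rewrite p0 Normc.normc0 mulr_ge0 ?ipnorm_ge0.
have np : 0 < normc p by rewrite lt_neqAle normc_ge0 eq_sym normc_eq0 p0.
have := Reip_le (Num.conj p *: x) y.
rewrite ipZl -/p mulrC -normCK normcE -rmorphXn /= ipnormZ normcJ -mulrA expr2.
by rewrite ler_pM2l.
Qed.

Lemma ipnorm_sum (I : Type) (r : seq I) (P : pred I) (F : I -> E) :
  N (\sum_(i <- r | P i) F i) <= \sum_(i <- r | P i) N (F i).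
Proof.
elim/big_rec2: _ => [|i y x _ IH]; first by rewrite ipnorm0.
by rewrite (le_trans (ipnormD _ _))// lerD2l.
Qed.

Lemma ipcvg_unique u l l' : ipcvg u l -> ipcvg u l' -> l = l'.
Proof.
move=> ul ul'; apply/subr0_eq/ipnorm_le0/ler_addgt0Pl => e e0; rewrite addr0.
have e2 : 0 < e / 2 by rewrite divr_gt0.
have [n Hn] := ul _ e2; have [m Hm] := ul' _ e2.
have := Hn (maxn n m) (leq_maxl _ _); have := Hm (maxn n m) (leq_maxr _ _).
have := ipnorm_dist l (u (maxn n m)) l'; rewrite (ipnormC l (u _)); lra.
Qed.

Lemma ipcvg_cauchy u l : ipcvg u l -> ipcauchy u.
Proof.
move=> ul e e0; have [n Hn] := ul (e / 2) (divr_gt0 e0 (ltr0Sn _ _)).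
exists n => p q /Hn Hp /Hn Hq; have := ipnorm_dist (u p) l (u q).
rewrite (ipnormC l (u _)); lra.
Qed.

Lemma ipcvg_le u l (v : E) (c : R) : ipcvg u l ->
  (exists n0, forall n, (n0 <= n)%N -> N (u n - v) <= c) -> N (l - v) <= c.
Proof.
move=> ul [n0 H]; apply/ler_addgt0Pr => e e0; have [n1 Hn] := ul _ e0.
have := Hn (maxn n0 n1) (leq_maxr _ _); have := H (maxn n0 n1) (leq_maxl _ _).
have := ipnorm_dist l (u (maxn n0 n1)) v; rewrite (ipnormC l (u _)); lra.
Qed.

Lemma ipcvg_le0 u l (c : R) : ipcvg u l ->
  (exists n0, forall n, (n0 <= n)%N -> N (u n) <= c) -> N l <= c.
Proof.
move=> ul [n0 H]; rewrite -(subr0 l); apply: (ipcvg_le ul).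
by exists n0 => n; rewrite subr0; exact: H.
Qed.

Lemma ipcvg_cst (l : E) : ipcvg (fun=> l) l.
Proof. by move=> e e0; exists 0%N => n _; rewrite subrr ipnorm0 ltW. Qed.

Lemma ipcvg_linear u l v m (a : R[i]) : ipcvg u l -> ipcvg v m ->
  ipcvg (fun n => a *: u n + v n) (a *: l + m).
Proof.
move=> ul vm e e0.
have c0 : 0 < normc a + 1 by rewrite ltr_wpDl ?normc_ge0.
have [n Hn] := ul (e / 2 / (normc a + 1)) (divr_gt0 (divr_gt0 e0 (ltr0Sn _ _)) c0).
have [p Hp] := vm (e / 2) (divr_gt0 e0 (ltr0Sn _ _)).
exists (maxn n p) => q; rewrite geq_max => /andP[/Hn Hq /Hp Hq'].
rewrite opprD addrACA -scalerBr (le_trans (ipnormD _ _))// ipnormZ.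
have : normc a * N (u q - l) <= e / 2.
  rewrite (le_trans (ler_wpM2l (normc_ge0 a) Hq))// mulrA ler_pdivrMr// [leLHS]mulrC.
  by rewrite ler_wpM2l ?divr_ge0 ?ltW// ltrDl.
lra.
Qed.

End InnerProduct.

(** * Orthogonal projection, Riesz representation and the Lax-Milgram theorem *)

Section Projection.
Context {R : realType} {E : lmodType R[i]} (ip : E -> E -> R[i]).
Hypothesis hip : hilbert_ip ip.
Local Notation N := (ipnorm ip).
Implicit Types (x y z : E) (a b : R[i]).

Lemma invS_le (e : R) : 0 < e ->
  exists n0, forall n, (n0 <= n)%N -> n.+1%:R^-1 <= e.
Proof.
move=> e0; have [n0 _ H] := near_infty_natSinv_lt (PosNum e0).
by exists n0 => n /H /ltW.
Qed.

Definition closed_submod (M : set E) :=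
  [/\ M 0, (forall a u v, M u -> M v -> M (a *: u + v)) &
      forall u l, (forall n, M (u n)) -> ipcvg ip u l -> M l].

Lemma projection (M : set E) (f : E) : closed_submod M ->
  exists2 p, M p & forall m, M m -> ip (f - p) m = 0.
Proof.
move=> [M0 ML Mcl].
pose D := [set N (f - m) | m in M]; pose d := inf D.
have hD : has_inf D.
  split; first by exists (N (f - 0)), 0.
  by exists 0 => _ [m _ <-]; exact: ipnorm_ge0.
have dle m : M m -> d <= N (f - m) by move=> Mm; apply: ge_inf; [exact: hD.2|exists m].
have d0 : 0 <= d by apply: lb_le_inf; [exact: hD.1|move=> _ [m _ <-]; exact: ipnorm_ge0].
have /choice[u uP] : forall n : nat, exists m, M m /\ N (f - m) < d + n.+1%:R^-1.
  move=> n.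
  have [_ [m Mm <-] H] := @inf_adherent R D n.+1%:R^-1 (ltac:(by rewrite invr_gt0)) hD.
  by exists m.
have ucau : ipcauchy ip u.
  (* By the parallelogram law |u n - u m|^2 <= 4 (d + t)^2 - 4 d^2 = 8 d t + 4 t^2, which is at most
     t (8 d + 4) for t <= 1. *)
  move=> e e0; have D0 : 0 < 8 * d + 4 by lra.
  have [n0 H] := @invS_le (Num.min 1 (e ^+ 2 / (8 * d + 4)))
    (ltac:(by rewrite lt_min ltr01 divr_gt0 ?exprn_gt0)).
  exists n0 => n m nn nm; rewrite -(@ler_pXn2r _ 2%N) ?nnegrE ?ipnorm_ge0 ?(ltW e0)//.
  pose t : R := n0.+1%:R^-1; have t0 : 0 <= t by rewrite invr_ge0.
  have /andP[t1 t2] : (t <= 1) && (t <= e ^+ 2 / (8 * d + 4)).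
    by have := H n0 (leqnn _); rewrite le_min.
  have le_t k : (n0 <= k)%N -> N (f - u k) <= d + t.
    move=> nk; have [_ /ltW] := uP k; move=> /le_trans; apply; rewrite lerD2l.
    by rewrite lef_pV2 ?posrE// ler_nat ltnS.
  have mid : M ((2^-1 : R)%:C *: (u n + u m)).
    rewrite -[_ *: _]addr0; apply: (ML) => //.
    by rewrite -[u n]scale1r; apply: (ML); [exact: (uP n).1|exact: (uP m).1].
  have := dle _ mid.
  have -> : f - (2^-1 : R)%:C *: (u n + u m) = (2^-1 : R)%:C *: ((f - u n) + (f - u m)).
    rewrite -[in LHS](scale1r f) [in LHS](_ : 1 = (2^-1 : R)%:C + (2^-1 : R)%:C); last first.
      by rewrite -rmorphD /= -[LHS]/(1%:C); congr (_%:C); field.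
    by rewrite scalerDl !scalerDr !scalerN opprD addrACA.
  rewrite ipnormZ// normc_real ger0_norm ?invr_ge0// => mide.
  have -> : u n - u m = (f - u m) - (f - u n).
    by rewrite opprB [RHS]addrC subrKA.
  have := ipnorm_sqrD hip (f - u m) (- (f - u n)).
  have := ipnorm_sqrD hip (f - u m) (f - u n); rewrite ipNr// ReN ipnormN// [f - u m + _]addrC.
  move: mide (le_t _ nn) (le_t _ nm) (ipnorm_ge0 ip (f - u n)) (ipnorm_ge0 ip (f - u m)).
  move: (ipnorm_ge0 ip (f - u n + (f - u m))).
  have {t2} : t * (8 * d + 4) <= e ^+ 2 by rewrite -ler_pdivlMr.
  move: (N _) (N (f - u n)) (N (f - u m)) (N _) (Re _) (e ^+ 2) => s p q w r e2.
  move=> t2 s0 sd pt qt p0 q0 sq ->.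
  have : p ^+ 2 <= (d + t) ^+ 2 by rewrite ler_pXn2r ?nnegrE ?addr_ge0.
  have : q ^+ 2 <= (d + t) ^+ 2 by rewrite ler_pXn2r ?nnegrE ?addr_ge0.
  have : (2 * d) ^+ 2 <= w ^+ 2 by rewrite ler_pXn2r ?nnegrE ?mulr_ge0//; lra.
  have : t ^+ 2 <= t by rewrite expr2 ler_piMl.
  nra.
have [p up] := hip_complete hip ucau.
have Mp : M p by apply: Mcl up => n; exact: (uP n).1.
have fp : N (f - p) <= d.
  apply/ler_addgt0Pr => e e0; have e2 : 0 < e / 2 by rewrite divr_gt0.
  have [n1 H1] := up _ e2; have [n2 H2] := invS_le e2.
  have := H1 _ (leq_maxl n1 n2); have := H2 _ (leq_maxr n1 n2).
  have [_] := uP (maxn n1 n2); have := ipnorm_dist hip f (u (maxn n1 n2)) p.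
  move: (_.+1%:R^-1) (N _) (N _) (N _) => q a b c h1 h2 h3 h4.
  by clear -h1 h2 h3 h4; lra.
exists p => // m Mm; set g := f - p; set c := ip g m.
apply/eqP; rewrite -normc_eq0; apply/negPn/negP => c0.
have c1 : 0 < normc c by rewrite lt_neqAle eq_sym c0 normc_ge0.
(* Moving p by t c m changes the squared distance by t |c|^2 (t |m|^2 - 2). This t makes t |m|^2 <=
   1, so the distance would drop below the infimum. *)
pose t : R := (N m ^+ 2 + 1)^-1.
have := dle (p + (t%:C * c) *: m) (ltac:(by rewrite addrC; exact: (ML))).
rewrite opprD addrA -/g => /(le_trans fp).
rewrite -/g -(@ler_pXn2r _ 2%N) ?nnegrE ?ipnorm_ge0// (ipnorm_sqrD hip g) ipNr// ipZr// -/c.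
rewrite ipnormN// ipnormZ// Normc.normcM normc_real rmorphM /=.
have -> : Num.conj (t%:C : R[i]) = t%:C by exact: conjc_real.
rewrite -mulrA [Num.conj c * c]mulrC -normCK normcE -rmorphXn ReN ReZ /=.
have t0 : 0 < t by rewrite invr_gt0 ltr_wpDl ?exprn_ge0 ?ipnorm_ge0.
rewrite ger0_norm ?(ltW t0)// => H.
have : 0 <= normc c ^+ 2 * (t * (t * N m ^+ 2 - 2)) by move: H; rewrite !exprMn; nra.
rewrite pmulr_rge0 ?exprn_gt0// pmulr_rge0// subr_ge0.
have : t * (N m ^+ 2 + 1) = 1 by rewrite mulVf// gt_eqF// ltr_wpDl ?exprn_ge0 ?ipnorm_ge0.
nra.
Qed.

(** The residual f - p is orthogonal to M, hence zero. Density, surjectivity and uniqueness of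
    extensions are all derived from this criterion below. *)
Lemma closed_submod_full (M : set E) : closed_submod M ->
  (forall g, (forall m, M m -> ip g m = 0) -> g = 0) -> forall f, M f.
Proof.
move=> McS M0 f; have [p Mp /M0 fp] := projection f McS.
by rewrite (subr0_eq fp).
Qed.

Definition antilinear (phi : E -> R[i]) :=
  forall a u v, phi (a *: u + v) = Num.conj a * phi u + phi v.

Lemma antilinear0 phi : antilinear phi -> phi 0 = 0.
Proof.
move=> /(_ 1 0 0); rewrite rmorph1 mul1r scaler0 addr0 => h.
by apply: (@addrI _ (phi 0)); rewrite -h addr0.
Qed.

Lemma riesz (phi : E -> R[i]) (C : R) : antilinear phi ->
  (forall v, normc (phi v) <= C * N v) -> exists y, forall v, phi v = ip y v.
Proof.
move=> phiL phiC; have phi0 := antilinear0 phiL.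
have [phiZ|] := pselect (forall v, phi v = 0).
  by exists 0 => v; rewrite phiZ ip0l.
move=> /existsNP[f phif].
have [|p Mp gM] := @projection [set v | phi v = 0] f.
  split=> [//|a u v /= u0 v0|u l uM ul /=]; first by rewrite phiL u0 v0 mulr0 addr0.
  apply/eqP; rewrite -normc_eq0 eq_le normc_ge0 andbT.
  apply/ler_addgt0Pr => e e0; rewrite add0r.
  have C1 : 0 < `|C| + 1 by rewrite ltr_wpDl.
  have [n0 /(_ n0 (leqnn _)) H] := ul (e / (`|C| + 1)) (divr_gt0 e0 C1).
  have -> : phi l = phi (- 1 *: (u n0 - l) + u n0).
    by congr phi; rewrite scaleN1r opprB subrK.
  rewrite phiL uM addr0 rmorphN1 mulN1r normcN (le_trans (phiC _))//.
  rewrite (@le_trans _ _ ((`|C| + 1) * N (u n0 - l)))//.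
    by rewrite ler_wpM2r ?ipnorm_ge0// (le_trans (ler_norm _))// lerDl.
  by rewrite mulrC -ler_pdivlMr.
pose g := f - p.
have phig : phi g = phi f.
  by rewrite /g addrC -scaleN1r phiL Mp mulr0 add0r.
have g0 : ip g g != 0.
  rewrite (ipE hip) -[_ == 0]/(_ == 0%:C) (inj_eq (@complexI R)) sqrf_eq0.
  apply/negP => /eqP/(ipnorm_eq0 hip) gz; apply: phif; rewrite -phig gz.
  exact: phi0.
have phig0 : phi g != 0 by rewrite phig; apply/eqP.
have conjNK (q : R[i]) : Num.conj (- Num.conj q) = - q by rewrite rmorphN /= conjCK.
(* g is orthogonal to the kernel, and v minus the conjugate of phi v / phi g times g lies in the
   kernel; the conjugate appears because phi is antilinear. *)
exists ((phi g / ip g g) *: g) => v; rewrite ipZl//.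
have : ip g (- Num.conj (phi v / phi g) *: g + v) = 0.
  apply: gM; have := phiL (- Num.conj (phi v / phi g)) g v.
  by rewrite conjNK mulNr divfK// addNr.
rewrite ipDr// ipZr// conjNK mulNr => /eqP.
rewrite addrC subr_eq0 => /eqP ->.
by field; rewrite phig0 g0.
Qed.

(** M is the range of the operator that represents l. Coercivity makes preimages of Cauchy sequences
    Cauchy, so M is closed, and it excludes nonzero vectors orthogonal to M. *)
Theorem lax_milgram (l : E -> E -> R[i]) (C alpha : R) (phi : E -> R[i]) (C' : R) :
  (forall a u v w, l (a *: u + v) w = a * l u w + l v w) ->
  (forall u, antilinear (l u)) ->
  (forall u v, normc (l u v) <= C * N u * N v) ->
  0 < alpha -> (forall u, alpha * N u ^+ 2 <= Re (l u u)) ->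
  antilinear phi -> (forall v, normc (phi v) <= C' * N v) ->
  exists x, forall v, l x v = phi v.
Proof.
move=> lL lR lC alpha0 lco phiL phiC.
have l0 v : l 0 v = 0.
  apply: (@addrI _ (l 0 v)); rewrite addr0.
  by have := lL 1 0 0 v; rewrite scale1r mul1r addr0.
have lB u v w : l (u - v) w = l u w - l v w.
  by rewrite addrC -scaleN1r lL mulN1r addrC.
pose M := [set y | exists x, forall v, ip y v = l x v].
have [y0 y0P] := riesz phiL phiC.
suff : M y0 by case=> x xP; exists x => v; rewrite y0P xP.
apply: closed_submod_full => [|g gM].
  split=> [|a u v [x xP] [y yP]|u y uM uy].
  - by exists 0 => v; rewrite ip0l// l0.
  - by exists (a *: x + y) => w; rewrite ipDl// ipZl// lL xP yP.
  have [x xP] := choice uM.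
  have xle n m : alpha * N (x n - x m) <= N (u n - u m).
    have [->|/eqP xn] := eqVneq (N (x n - x m)) 0; first by rewrite mulr0 ipnorm_ge0.
    have Nx : 0 < N (x n - x m) by rewrite lt_neqAle eq_sym ipnorm_ge0 andbT; apply/eqP.
    rewrite -(ler_pM2r Nx) -mulrA -expr2 (le_trans (lco _))// lB -!xP -ipBl//.
    exact: Reip_le.
  have xcau : ipcauchy ip x.
    move=> e e0; have [n0 H] := ipcvg_cauchy hip uy (mulr_gt0 alpha0 e0).
    by exists n0 => n m nn nm; rewrite -(ler_pM2l alpha0) (le_trans (xle n m))// H.
  have [z xz] := hip_complete hip xcau; exists z => v.
  apply/subr0_eq/eqP; rewrite -normc_eq0 eq_le normc_ge0 andbT.
  apply/ler_addgt0Pr => e e0; rewrite add0r.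
  have K0 : 0 < (`|C| + 1) * (N v + 1) by rewrite mulr_gt0 ?ltr_wpDl ?ipnorm_ge0.
  have e1 : 0 < e / 2 / ((`|C| + 1) * (N v + 1)) by rewrite !divr_gt0.
  have [n1 H1] := uy _ e1; have [n2 H2] := xz _ e1.
  have := H1 _ (leq_maxl n1 n2); have := H2 _ (leq_maxr n1 n2).
  set n := maxn n1 n2; rewrite !ler_pdivlMr// => Hx Hu.
  have -> : ip y v - l z v = ip (y - u n) v + l (x n - z) v.
    by rewrite ipBl// lB -xP subrKA.
  rewrite (le_trans (le_normcD _ _))//.
  have := ip_le hip (y - u n) v; have := lC (x n - z) v; rewrite (ipnormC hip y).
  move: Hx Hu; move: (ipnorm_ge0 ip (x n - z)) (ipnorm_ge0 ip (u n - y)) (ipnorm_ge0 ip v).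
  move: (N _) (N _) (N _) (normc _) (normc _) (ler_norm C) (normr_ge0 C).
  move=> p q s t r C1 C0 p0 q0 s0 Hp Hq Ht Hr.
  have : C * p * s <= `|C| * p * s by rewrite !ler_wpM2r.
  have := mulr_ge0 p0 s0; have := mulr_ge0 q0 s0; nra.
(* The vector y that represents l g belongs to M, so it is orthogonal to g, that is l g g = 0. *)
have [C2 C2P] : exists C2, forall v, normc (l g v) <= C2 * N v by exists (C * N g).
have [y yP] := riesz (lR g) C2P.
have := gM y (ex_intro _ g (fun v => esym (yP v))).
rewrite hip_conj// -yP => /(congr1 Num.conj); rewrite conjCK rmorph0 => lgg.
have := lco g; rewrite lgg /= pmulr_rle0// => gg.
apply: (ipnorm_eq0 hip); apply/eqP; rewrite -sqrf_eq0.
by rewrite eq_le gg sqr_ge0.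
Qed.

End Projection.

(** * Resolvents and Yosida approximations *)

(* [par_form] confines the numerical range of A to a parabola; only the resolvents
   at the real points -(n + n1) are needed. *)
Record parabolic (R : realType) (E : lmodType R[i]) (ip : E -> E -> R[i])
    (K : R) (n1 : nat) (A : E -> E -> Prop) : Prop := Parabolic {
  par_K0 : 0 <= K;
  par_n0 : (0 < n1)%N;
  par_nK : K ^+ 2 <= n1%:R;
  par_linear : forall (a : R[i]) x z x' z',
    A x z -> A x' z' -> A (a *: x + x') (a *: z + z');
  par_fun : forall z, A 0 z -> z = 0;
  par_form : forall x z, A x z -> exists2 p : R, 0 <= p &
    normc (ip z x - (p ^+ 2)%:C) <= K * p * ipnorm ip x;
  par_range : forall n f, exists x, A x (((n + n1)%:R : R)%:C *: (f - x)) }.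

Section Resolvent.
Context {R : realType} {E : lmodType R[i]} {ip : E -> E -> R[i]}.
Context {K : R} {n1 : nat} {A : E -> E -> Prop}.
Hypotheses (hip : hilbert_ip ip) (hA : parabolic ip K n1 A).
Local Notation N := (ipnorm ip).
Implicit Types (x y z f : E) (a b h : R[i]) (n m k : nat).

Definition rate n : R := (n + n1)%:R.
Local Notation nu := rate.

Lemma rate_gt0 n : 0 < nu n.
Proof. by rewrite ltr0n addn_gt0 (par_n0 hA) orbT. Qed.

Lemma rate_ge1 n : 1 <= nu n.
Proof. by rewrite ler1n addn_gt0 (par_n0 hA) orbT. Qed.

Lemma rate_ge_sqr n : K ^+ 2 <= nu n.
Proof. by rewrite (le_trans (par_nK hA))// ler_nat leq_addl. Qed.

Lemma rate_inv_le (e : R) : 0 < e ->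
  exists n0, forall n, (n0 <= n)%N -> (nu n)^-1 <= e.
Proof.
move=> e0; have [n0 H] := invS_le e0; exists n0 => n /H; apply: le_trans.
by rewrite lef_pV2 ?posrE ?rate_gt0// ler_nat -addn1 leq_add2l (par_n0 hA).
Qed.

Lemma parabolic00 : A 0 0.
Proof.
have [x Ax] := par_range hA 0 0.
by have := par_linear hA (-1) Ax Ax; rewrite !scaleN1r !addNr.
Qed.

Lemma parabolic_scale a x z : A x z -> A (a *: x) (a *: z).
Proof. by move=> Ax; have := par_linear hA a Ax parabolic00; rewrite !addr0. Qed.

Lemma parabolic_sub x z x' z' : A x z -> A x' z' -> A (x - x') (z - z').
Proof.
by move=> Ax Ax'; have := par_linear hA (-1) Ax' Ax; rewrite !scaleN1r ![- _ + _]addrC.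
Qed.

(** The least om for which d p^2 - K p s + om s^2 has nonpositive discriminant. It is finite for
    every d > 0: a parabola fits, after a shift, into any sector around the positive axis. *)
Definition sector_shift (d : R) : R := K ^+ 2 / (4 * d).
Local Notation om := sector_shift.

Lemma sector_shift_ge0 d : 0 < d -> 0 <= om d.
Proof. by move=> d0; rewrite divr_ge0 ?sqr_ge0// mulr_ge0// ltW. Qed.

(* Completing the square in the form parameter [p] of the parabola. *)
Lemma parabolic_sector (d : R) x z a : A x z -> 0 < d -> d * normc a <= Re a ->
  - (normc a * om d * N x ^+ 2) <= Re (a * ip z x).
Proof.
move=> /(par_form hA)[p p0 Hp] d0 ad.
have -> : a * ip z x = (p ^+ 2)%:C * a + a * (ip z x - (p ^+ 2)%:C) by ring.
rewrite ReD ReZ; move: Hp; set r := ip z x - _ => Hp.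
have : - (normc a * (K * p * N x)) <= Re (a * r).
  rewrite lerNl -ReN (le_trans (Re_normc _))// normcN Normc.normcM.
  by rewrite ler_wpM2l ?normc_ge0.
have dV : d * om d = K ^+ 2 / 4 by rewrite /om; field; rewrite gt_eqF.
have a0 := normc_ge0 a.
have : p ^+ 2 * (d * normc a) <= p ^+ 2 * Re a by rewrite ler_wpM2l ?sqr_ge0.
have : 0 <= normc a * (d * p ^+ 2 - K * p * N x + om d * N x ^+ 2).
  apply: mulr_ge0 => //; rewrite -(pmulr_rge0 _ d0).
  have := sqr_ge0 (d * p - K / 2 * N x); move: (om d) dV (N x) => o oE s H.
  by rewrite [leRHS](_ : _ = (d * p - K / 2 * s) ^+ 2 + (d * o - K ^+ 2 / 4) * s ^+ 2);
    [rewrite oE subrr mul0r addr0|field].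
lra.
Qed.

Lemma parabolic_Re x z : A x z -> - (om 1 * N x ^+ 2) <= Re (ip z x).
Proof.
move=> Ax; have := parabolic_sector Ax ltr01 (a := 1).
by rewrite Normc.normc1 !mul1r; apply.
Qed.

Lemma sector_shift1 : om 1 = K ^+ 2 / 4. Proof. by rewrite /om mulr1. Qed.

(** The operator (1 + A / nu)^-1, since A x = nu (f - x) means (1 + A / nu) x = f. The choice is
    determined by [resolvent_unique]. *)
Definition resolvent n f : E := sval (cid (par_range hA n f)).

Local Notation J := resolvent.

Lemma resolventP n f : A (J n f) ((nu n)%:C *: (f - J n f)).
Proof. exact: svalP (cid (par_range hA n f)). Qed.

(** Pairing the equation with x and using K^2 / 4 <= nu / 4 gives (3 / 4) |x|^2 <= |f| |x|; the
    factor 4 / 3 is rounded up to 2. *)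
Lemma parabolic_le n x f : A x ((nu n)%:C *: (f - x)) -> N x <= 2 * N f.
Proof.
move=> /parabolic_Re; rewrite ipZl// ReZ ipBl// ReB -ipnorm_sqr// sector_shift1.
have := Reip_le hip f x; have := rate_ge_sqr n; have := rate_gt0 n.
have := ipnorm_ge0 ip x; have := ipnorm_ge0 ip f.
move: (N f) (N x) (nu n) (Re _) => s t v q s0 t0 v0 vK qst H.
have : v * (3 * t ^+ 2) <= v * (4 * (s * t)) by nra.
rewrite ler_pM2l// => st.
have [->|t1] := eqVneq t 0; first by rewrite mulr_ge0.
have : t * (3 * t) <= t * (4 * s) by lra.
by rewrite ler_pM2l; [lra|rewrite lt_neqAle eq_sym t1].
Qed.

Lemma resolvent_unique n x f : A x ((nu n)%:C *: (f - x)) -> x = J n f.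
Proof.
move=> Ax; apply/subr0_eq/(ipnorm_le0 hip).
have := @parabolic_le n (x - J n f) 0; rewrite ipnorm0// mulr0; apply.
have := parabolic_sub Ax (resolventP n f); rewrite -scalerBr opprB [f - x + _]addrC subrKA.
by rewrite sub0r opprB.
Qed.

Lemma resolvent_linear n : linear (J n).
Proof.
move=> a x y; symmetry; apply: resolvent_unique.
have := par_linear hA a (resolventP n x) (resolventP n y).
by rewrite scalerA mulrC -scalerA -scalerDr scalerBr opprD addrACA.
Qed.

HB.instance Definition _ n := GRing.isLinear.Build R[i] E E *:%R (J n) (resolvent_linear n).

Lemma resolvent_le n f : N (J n f) <= 2 * N f. Proof. exact: parabolic_le (resolventP n f). Qed.

(** Put q = nu (y - J y) = A (J y). Then A q = nu A (y - J y) = nu (w - q), which is the resolvent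
    equation for w, so q = J w. *)
Lemma resolvent_graph n y w : A y w -> A (J n y) (J n w).
Proof.
move=> Ay; set x := J n y; set q := (nu n)%:C *: (y - x).
have Ax : A x q := resolventP n y.
have := parabolic_scale (nu n)%:C (parabolic_sub Ay Ax); rewrite -/q => /(@resolvent_unique n q w) <-.
exact: Ax.
Qed.

Lemma resolvent_comm n m f : J n (J m f) = J m (J n f).
Proof.
by apply: resolvent_unique; have := resolvent_graph n (resolventP m f); rewrite linearZ_LR /= (linearB (J n)).
Qed.

Definition yosida n x : E := (nu n)%:C *: (x - J n x).
Local Notation Y := yosida.

Lemma yosida_linear n : linear (Y n).
Proof.
move=> a x y; rewrite /Y linearP opprD addrACA -scalerBr scalerDr.
by rewrite !scalerA [_ * a]mulrC.
Qed.

HB.instance Definition _ n := GRing.isLinear.Build R[i] E E *:%R (Y n) (yosida_linear n).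

Lemma yosidaP n x : A (J n x) (Y n x). Proof. exact: resolventP. Qed.

Lemma parabolic_unique x w w' : A x w -> A x w' -> w = w'.
Proof.
move=> Aw Aw'; apply/subr0_eq/(par_fun hA).
by have := parabolic_sub Aw Aw'; rewrite subrr.
Qed.

(** On the domain Y n = J n A, so there |Y n x| <= 2 |A x| uniformly in n, although the general
    bound on Y n grows like nu. *)
Lemma yosida_graph n x w : A x w -> Y n x = J n w.
Proof. by move=> /(resolvent_graph n) Aw; exact: parabolic_unique (yosidaP n x) Aw. Qed.

Lemma yosida_resolvent n m x : Y n (J m x) = J m (Y n x).
Proof. by rewrite /Y linearZ_LR /= (linearB (J m)) /= resolvent_comm. Qed.

Lemma yosida_comm n m x : Y n (Y m x) = Y m (Y n x).
Proof. by rewrite [in LHS]/Y -yosida_resolvent -(linearB (Y m)) -linearZ_LR. Qed.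

Lemma yosida_le n x : N (Y n x) <= 3 * nu n * N x.
Proof.
rewrite ipnormZ// normc_real gtr0_norm ?rate_gt0// -mulrA mulrCA ler_pM2l ?rate_gt0//.
rewrite (le_trans (ipnormB hip _ _))//; have := resolvent_le n x; lra.
Qed.

(** If g is orthogonal to the domain, pair A x = nu (g - x) with x = J 0 g: the term in g vanishes,
    and -nu |x|^2 >= -(K^2 / 4) |x|^2 forces x = 0. Then nu g = A 0 = 0. *)
Lemma parabolic_dense f (e : R) : 0 < e -> exists x w, A x w /\ N (f - x) <= e.
Proof.
move=> e0; pose M := [set f | forall e : R, 0 < e -> exists x w, A x w /\ N (f - x) <= e].
suff: M f by apply.
apply: (closed_submod_full hip) => [|g gM].
  split=> [d d0|a u v Mu Mv d d0|u l uM ul d d0].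
  - by exists 0, 0; rewrite subrr ipnorm0// (ltW d0); split=> //; exact: parabolic00.
  - have c0 : 0 < normc a + 1 by rewrite ltr_wpDl ?normc_ge0.
    have [x [w [Ax Hx]]] := Mu _ (divr_gt0 (divr_gt0 d0 (ltr0Sn _ 1)) c0).
    have [x' [w' [Ax' Hx']]] := Mv _ (divr_gt0 d0 (ltr0Sn _ 1)).
    exists (a *: x + x'), (a *: w + w'); split; first exact: (par_linear hA).
    rewrite opprD addrACA -scalerBr (le_trans (ipnormD hip _ _))// ipnormZ//.
    move: Hx; rewrite ler_pdivlMr//; have := ipnorm_ge0 ip (u - x).
    move: Hx' (normc_ge0 a); move: (N _) (N _) (normc _) => p q r; nra.
  - have d2 : 0 < d / 2 by rewrite divr_gt0.
    have [n0 /(_ n0 (leqnn _)) H] := ul _ d2.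
    have [x [w [Ax Hx]]] := uM n0 _ d2; exists x, w; split=> //.
    by have := ipnorm_dist hip l (u n0) x; rewrite (ipnormC hip l (u n0)); lra.
have Mx : M (J 0 g).
  by move=> d d0; exists (J 0 g), (Y 0 g); rewrite subrr ipnorm0// ltW//; split=> //; exact: yosidaP.
have gJ := gM _ Mx.
have J0 : J 0 g = 0.
  have := parabolic_Re (yosidaP 0 g); rewrite ipZl// ReZ ipBl// ReB gJ /= -ipnorm_sqr// sector_shift1 => H.
  have := rate_ge_sqr 0; have := rate_gt0 0; move: H; have := ipnorm_ge0 ip (J 0 g).
  move=> p0 H v0 vK; apply: (ipnorm_eq0 hip); apply/eqP; rewrite -sqrf_eq0 eq_le sqr_ge0 andbT.
  move: (N _) H v0 vK => p H v0 vK.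
  rewrite -(pmulr_rle0 _ v0); nra.
have := yosidaP 0 g; rewrite /Y J0 subr0 => /(par_fun hA) /eqP.
rewrite scaler_eq0 => /orP[|/eqP//].
by rewrite -[_ == 0]/(_ == 0%:C) (inj_eq (@complexI R)) gt_eqF// rate_gt0.
Qed.

(** On the domain J x - x = - J (A x) / nu tends to 0; density and the uniform bound 2 do the
    rest. *)
Lemma resolvent_cvg w : ipcvg ip (fun n => J n w) w.
Proof.
move=> e e0; have e4 : 0 < e / 4 by rewrite divr_gt0.
have [x [q [Ax Hx]]] := parabolic_dense w e4.
have q1 : 0 < 2 * N q + 1 by rewrite ltr_wpDl ?mulr_ge0 ?ipnorm_ge0.
have [n0 H] := rate_inv_le (divr_gt0 e4 q1); exists n0 => n /H {}H.
have Jx : N (J n x - x) <= e / 4.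
  have -> : J n x - x = - ((nu n)^-1%:C *: J n q).
    rewrite -(yosida_graph n Ax) /Y scalerA -rmorphM /= mulVf ?gt_eqF ?rate_gt0//.
    by rewrite scale1r opprB.
  rewrite ipnormN// ipnormZ// normc_real ger0_norm ?invr_ge0 ?ltW ?rate_gt0//.
  move: H; rewrite ler_pdivlMr//; have := resolvent_le n q; have := rate_gt0 n.
  rewrite -(invr_gt0 (nu n)); move: (N _) (N _) (_^-1) => a b c; nra.
have -> : J n w - w = J n (w - x) + (J n x - x) + (x - w).
  by rewrite (linearB (J n)) subrKA subrKA.
have := ipnormD hip (J n (w - x) + (J n x - x)) (x - w).
have := ipnormD hip (J n (w - x)) (J n x - x).
have := resolvent_le n (w - x); rewrite (ipnormC hip x w); lra.
Qed.

Lemma yosida_cvg x w : A x w -> ipcvg ip (fun n => Y n x) w.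
Proof. by move=> Ax e e0; have [n0 H] := resolvent_cvg w e0; exists n0 => n /H; rewrite (yosida_graph n Ax). Qed.

End Resolvent.

(** * Euler polynomials and their limit *)

Section Iterates.
Context {R : realType} {E : lmodType R[i]}.
Implicit Types (f g : {linear E -> E}).

Lemma iter_is_linear f k : linear (iter k f).
Proof. by move=> a x y; elim: k => //= k ->; rewrite linearP. Qed.

Lemma iter_linearB f k x y : iter k f (x - y) = iter k f x - iter k f y.
Proof. by elim: k => //= k ->; rewrite linearB. Qed.

Lemma iter_comm (f g : E -> E) k x :
  (forall y, f (g y) = g (f y)) -> iter k f (g x) = g (iter k f x).
Proof. by move=> fg; elim: k => //= k ->; rewrite fg. Qed.

(** The expansion of f^L - g^L as a sum of terms f^k g^j (f - g). By commutation f - g acts first,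
    directly on x, so only the size of f x - g x at this x matters and no operator bound on f - g is
    required. *)
Lemma telescoping (ip : E -> E -> R[i]) (hip : hilbert_ip ip) f g (L : nat) (M M' : R) x :
  (forall y, f (g y) = g (f y)) -> 0 <= M ->
  (forall j y, (j <= L)%N -> ipnorm ip (iter j f y) <= M * ipnorm ip y) ->
  (forall j y, (j <= L)%N -> ipnorm ip (iter j g y) <= M' * ipnorm ip y) ->
  ipnorm ip (iter L f x - iter L g x) <= L%:R * (M * M' * ipnorm ip (f x - g x)).
Proof.
move=> fg M0 Mf Mg.
suff H k j : (k + j <= L)%N ->
    ipnorm ip (iter k f (iter j g x) - iter (k + j) g x)
      <= k%:R * (M * M' * ipnorm ip (f x - g x)).
  by have := H L 0%N; rewrite addn0 => /(_ (leqnn _)).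
elim: k j => [|k IH] j kL; first by rewrite subrr ipnorm0// mul0r.
have kL' : (k + j.+1 <= L)%N by rewrite addnS -addSn.
rewrite iterSr -(iter_comm _ _ (fun y => esym (fg y))).
rewrite (le_trans (ipnorm_dist hip _ (iter k f (iter j.+1 g x)) _))//.
rewrite mulrS mulrDl mul1r lerD//; last first.
  by rewrite addSn -addnS; exact: IH.
rewrite -iter_linearB [iter j.+1 g x]iterSr -iter_linearB.
rewrite (le_trans (Mf _ _ _))//; first by rewrite (leq_trans _ kL')// leq_addr.
rewrite -mulrA ler_wpM2l// Mg//.
by rewrite (leq_trans _ kL')// addnS ltnW// ltnS leq_addl.
Qed.

End Iterates.

(** * Stability of Euler steps and refinement of the step size *)

Section Approximation.
Context {R : realType} {E : lmodType R[i]} {ip : E -> E -> R[i]}.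
Context {K : R} {n1 : nat} {A : E -> E -> Prop}.
Hypotheses (hip : hilbert_ip ip) (hA : parabolic ip K n1 A).
Local Notation N := (ipnorm ip).
Local Notation nu n := (@rate R n1 n).
Local Notation om := (@sector_shift R K).
Local Notation J := (resolvent hA).
Local Notation Y := (yosida hA).
Implicit Types (x y w : E) (a b h z : R[i]) (n m k j : nat).

Definition euler_step n h x : E := x - h *: Y n x.
Local Notation Sh := euler_step.

Lemma euler_step_linear n h : linear (Sh n h).
Proof.
move=> a x y; rewrite /Sh linearP /= scalerDr opprD addrACA scalerBr.
by rewrite !scalerA [h * a]mulrC.
Qed.

HB.instance Definition _ n h :=
  GRing.isLinear.Build R[i] E E *:%R (Sh n h) (euler_step_linear n h).

Let JB n x y : J n (x - y) = J n x - J n y. Proof. exact: linearB. Qed.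
Let JZ n a x : J n (a *: x) = a *: J n x. Proof. exact: linearZ_LR. Qed.
Let YB n x y : Y n (x - y) = Y n x - Y n y. Proof. exact: linearB. Qed.
Let YZ n a x : Y n (a *: x) = a *: Y n x. Proof. exact: linearZ_LR. Qed.

Lemma euler_step_comm n h m a x : Sh n h (Sh m a x) = Sh m a (Sh n h x).
Proof.
rewrite /Sh !(YB _ x) (YZ n a) (YZ m h) (yosida_comm hip hA n m) !scalerBr !opprB !scalerA [a * h]mulrC.
by rewrite addrACA [RHS]addrACA; congr (_ + _); rewrite addrC.
Qed.

Lemma euler_step_yosida n h m x : Sh n h (Y m x) = Y m (Sh n h x).
Proof. by rewrite /Sh (YB _ x) (YZ m h) (yosida_comm hip hA n m). Qed.

Lemma euler_step_resolvent n h m x : Sh n h (J m x) = J m (Sh n h x).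
Proof. by rewrite /Sh (JB _ x) (JZ m h) (yosida_resolvent hip hA n m). Qed.

(** The accumulated growth of all the steps. The 4 comes from |J x|^2 <= 4 |x|^2; the 5 is half of
    the 9 in |Y x|^2 <= 9 nu^2 |x|^2, rounded up. *)
Definition stab_const (d rho : R) : R := expR (4 * om d * rho + 5 * rho ^+ 2).

Local Notation Mc := stab_const.

Lemma stab_const_gt0 d rho : 0 < Mc d rho. Proof. exact: expR_gt0. Qed.

(** Since x = J x + Y x / nu and Y x = A (J x), (Y x | x) = (A J x | J x) + |Y x|^2 / nu. Rotated by
    h, the first term is bounded below by [parabolic_sector] and the second has nonnegative real
    part. Then |x - h Y x|^2 <= (1 + 2 c) |x|^2 <= (1 + c)^2 |x|^2, and 1 + c <= exp c. *)
Lemma euler_step_le n d h x : 0 < d -> d * normc h <= Re h ->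
  N (Sh n h x) <= expR (4 * om d * normc h + 5 * (nu n ^+ 2 * normc h) * normc h) * N x.
Proof.
move=> d0 dh.
have xE : x = J n x + ((nu n)^-1)%:C *: Y n x.
  rewrite /Y scalerA -rmorphM /= mulVf ?gt_eqF ?(rate_gt0 hA)//.
  by rewrite scale1r addrC subrK.
have h0 := normc_ge0 h.
have Rh : 0 <= Re h by rewrite (le_trans _ dh)// mulr_ge0// ltW.
have H1 : - (4 * om d * normc h * N x ^+ 2) <= Re (h * ip (Y n x) x).
  rewrite [X in ip _ X]xE ipDr// ipZr//.
  have -> : Num.conj ((nu n)^-1%:C : R[i]) = (nu n)^-1%:C by exact: conjc_real.
  rewrite mulrDr ReD (mulrCA h) ReZ (ipE hip (Y n x)) [h * _%:C]mulrC ReZ.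
  have := parabolic_sector hA (yosidaP hA n x) d0 dh.
  have J2 : N (J n x) ^+ 2 <= 4 * N x ^+ 2.
    have := resolvent_le hip hA n x; have := ipnorm_ge0 ip (J n x); nra.
  have : normc h * om d * N (J n x) ^+ 2 <= normc h * om d * (4 * N x ^+ 2).
    by rewrite ler_wpM2l// mulr_ge0// sector_shift_ge0.
  have : 0 <= (nu n)^-1 * (N (Y n x) ^+ 2 * Re h).
    by rewrite mulr_ge0 ?invr_ge0 ?(ltW (rate_gt0 hA n))// mulr_ge0 ?sqr_ge0.
  lra.
have om0 := @sector_shift_ge0 _ K _ d0.
set c := _ + _.
have c0 : 0 <= c.
  have nn : 0 <= nu n ^+ 2 := sqr_ge0 _.
  by apply: addr_ge0; apply: mulr_ge0 => //; apply: mulr_ge0 => //; apply: mulr_ge0.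
apply: (@le_trans _ _ ((1 + c) * N x)); last first.
  by rewrite ler_wpM2r ?ipnorm_ge0// expR_ge1Dx.
have c1 : 0 <= 1 + c by rewrite addrC; apply: addr_ge0.
rewrite -(@ler_pXn2r _ 2%N) ?nnegrE ?(mulr_ge0 c1) ?ipnorm_ge0//.
rewrite /Sh ipnorm_sqrD// ipNr// ReN ReipC// ipZl// ipnormN// ipnormZ//.
have Y2 : N (Y n x) ^+ 2 <= 9 * nu n ^+ 2 * N x ^+ 2.
  have := yosida_le hip hA n x; have := ipnorm_ge0 ip (Y n x); nra.
have : normc h ^+ 2 * N (Y n x) ^+ 2 <= normc h ^+ 2 * (9 * nu n ^+ 2 * N x ^+ 2).
  by rewrite ler_wpM2l ?sqr_ge0.
have : 0 <= c ^+ 2 * N x ^+ 2 by rewrite mulr_ge0 ?sqr_ge0.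
have : 0 <= nu n ^+ 2 * normc h ^+ 2 * N x ^+ 2 by rewrite -!exprMn sqr_ge0.
have : c * N x ^+ 2 = 4 * om d * normc h * N x ^+ 2
    + 5 * nu n ^+ 2 * normc h ^+ 2 * N x ^+ 2 by rewrite /c; ring.
move: H1; rewrite !exprMn; move: (Re _) (om d) c {c0 c1} => r o c.
have -> : (1 + c) ^+ 2 * N x ^+ 2 = N x ^+ 2 + 2 * (c * N x ^+ 2) + c ^+ 2 * N x ^+ 2 by ring.
move: (normc h ^+ 2 * _) (c * _) (c ^+ 2 * _) => p q s; lra.
Qed.

(** k steps of size h in the sector. The last condition bounds the total quadratic growth 5 nu^2 |h|
    (k |h|) by 5 rho^2, uniformly in n. *)
Definition admissible n (d rho : R) h k :=
  [/\ d * normc h <= Re h, k%:R * normc h <= rho & nu n ^+ 2 * normc h <= rho].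

Lemma admissible_ge0 n d rho h k : admissible n d rho h k -> 0 <= rho.
Proof. by case=> _ + _; apply: le_trans; rewrite mulr_ge0// normc_ge0. Qed.

Lemma admissible_le n d rho h k j : (j <= k)%N -> admissible n d rho h k -> admissible n d rho h j.
Proof.
move=> jk [H1 H2 H3]; split=> //; rewrite (le_trans _ H2)//.
by rewrite ler_wpM2r ?normc_ge0// ler_nat.
Qed.

Lemma euler_stable n d rho h k x : 0 < d -> admissible n d rho h k ->
  N (iter k (Sh n h) x) <= Mc d rho * N x.
Proof.
move=> d0 ok; have rho0 := admissible_ge0 ok; case: ok => dh kh nh.
set c := 4 * om d * normc h + 5 * (nu n ^+ 2 * normc h) * normc h.
have : N (iter k (Sh n h) x) <= expR (k%:R * c) * N x.
  elim: k kh => [|k IH] kh /=; first by rewrite mul0r expR0 mul1r.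
  rewrite (le_trans (euler_step_le _ _ d0 dh))// -/c mulrS mulrDl mul1r (expRD c).
  rewrite -mulrA ler_wpM2l ?expR_ge0// IH// (le_trans _ kh)//.
  by rewrite ler_wpM2r ?normc_ge0// ler_nat.
move=> /le_trans; apply; rewrite ler_wpM2r ?ipnorm_ge0// ler_expR /c.
have om0 := @sector_shift_ge0 _ K _ d0; have h0 := normc_ge0 h.
have : om d * (k%:R * normc h) <= om d * rho by rewrite ler_wpM2l.
have : (nu n ^+ 2 * normc h) * (k%:R * normc h) <= rho * rho.
  by rewrite ler_pM// ?mulr_ge0// sqr_ge0.
move: (k%:R) (nu n) (om d) (normc h) => q v o r; lra.
Qed.

Lemma iter_euler_yosida n h j m x : iter j (Sh n h) (Y m x) = Y m (iter j (Sh n h) x).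
Proof. by apply: iter_comm => y; exact: euler_step_yosida. Qed.

Lemma euler_drift n d rho h k x : 0 < d -> admissible n d rho h k ->
  N (iter k (Sh n h) x - x) <= k%:R * normc h * (Mc d rho * N (Y n x)).
Proof.
move=> d0; elim: k => [|k IH] ok /=; first by rewrite subrr ipnorm0// !mul0r.
have ok' := admissible_le (leqnSn k) ok.
rewrite (le_trans (ipnorm_dist hip _ (iter k (Sh n h) x) _))//.
rewrite mulrS !mulrDl !mul1r lerD// ?IH//.
rewrite {1}/Sh addrC addrA addNr add0r ipnormN// ipnormZ// ler_wpM2l ?normc_ge0//.
by rewrite -iter_euler_yosida; exact: euler_stable.
Qed.

(** Once the linear term is removed, what remains is -h times the sum over j < k of S^j (Y x) - Y x.
    It therefore suffices to know how far the trajectory of Y x moves. *)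
Lemma euler_drift2 n h k x (e : R) :
  (forall j, (j <= k)%N -> N (iter j (Sh n h) (Y n x) - Y n x) <= e) ->
  N (iter k (Sh n h) x - x + (k%:R * h) *: Y n x) <= k%:R * normc h * e.
Proof.
elim: k => [|k IH] H /=; first by rewrite subrr add0r !mul0r scale0r ipnorm0.
have -> : Sh n h (iter k (Sh n h) x) - x + (k.+1%:R * h) *: Y n x =
   (iter k (Sh n h) x - x + (k%:R * h) *: Y n x)
   - h *: (iter k (Sh n h) (Y n x) - Y n x).
  rewrite {1}/Sh iter_euler_yosida mulrS mulrDl mul1r scalerDl scalerBr.
  rewrite opprB (addrAC (iter k _ x)) [h *: Y n x + (k%:R * h) *: _]addrC.
  by rewrite addrACA [- _ + _]addrC.
rewrite (le_trans (ipnormB hip _ _))// ipnormZ// mulrS !mulrDl mul1r [leRHS]addrC.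
rewrite lerD ?IH//; first by move=> j jk; rewrite H// ltnW.
by rewrite ler_wpM2l ?normc_ge0 ?H.
Qed.

Lemma normc_nat k : normc (k%:R : R[i]) = k%:R.
Proof.
rewrite (_ : k%:R = (k%:R : R)%:C); last by rewrite rmorph_nat.
by rewrite normc_real normr_nat.
Qed.

Lemma Re_natM k h : Re (k%:R * h) = k%:R * Re h.
Proof. by rewrite (_ : k%:R = (k%:R : R)%:C) ?ReZ// rmorph_nat. Qed.

(* Used to compare Euler polynomials with different step numbers through a common
   refinement. *)
Lemma euler_refine n d rho h L m x : 0 < d -> admissible n d rho h (L * m) ->
  nu n ^+ 2 * (m%:R * normc h) <= rho ->
  N (iter L (Sh n (m%:R * h)) x - iter (L * m) (Sh n h) x)
    <= 9 * Mc d rho ^+ 3 * rho * (nu n ^+ 2 * (m%:R * normc h)) * N x.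
Proof.
move=> d0 ok mh; have M0 := stab_const_gt0 d rho; have h0 := normc_ge0 h.
have [dh Lh nh] := ok.
have [->|m0] := posnP m.
  rewrite muln0 !mul0r mulr0 mulr0 mul0r.
  have -> : iter L (Sh n 0) x = x.
    by elim: L {ok Lh} => //= L ->; rewrite /Sh scale0r subr0.
  by rewrite /= subrr ipnorm0.
(* For L = 0 the hypothesis [ok] says nothing about m steps; for L > 0 it does, because m <= L *
   m. *)
have [->|L0] := posnP L.
  rewrite mul0n /= subrr ipnorm0//; apply: mulr_ge0 (ipnorm_ge0 _ _).
  apply: mulr_ge0; last by rewrite mulr_ge0 ?sqr_ge0// mulr_ge0.
  by apply: mulr_ge0 (admissible_ge0 ok); rewrite mulr_ge0// exprn_ge0// ltW.
pose Sm : {linear E -> E} :=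
  HB.pack (iter m (Sh n h)) (GRing.isLinear.Build R[i] E E *:%R _ (@iter_is_linear _ _ (Sh n h) m)).
rewrite iterM.
have SmE j y : iter j Sm y = iter (j * m) (Sh n h) y by rewrite iterM.
have H1 j y : (j <= L)%N -> N (iter j Sm y) <= Mc d rho * N y.
  by move=> jL; rewrite SmE; apply: euler_stable => //; apply: admissible_le ok; rewrite leq_mul2r jL orbT.
have H2 j y : (j <= L)%N -> N (iter j (Sh n (m%:R * h)) y) <= Mc d rho * N y.
  move=> jL; apply: euler_stable => //; split.
  - by rewrite Normc.normcM normc_nat Re_natM mulrCA ler_wpM2l.
  - rewrite Normc.normcM normc_nat mulrA -natrM (le_trans _ Lh)// ler_wpM2r//.
    by rewrite ler_nat leq_mul2r jL orbT.
  - by rewrite Normc.normcM normc_nat.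
have comm y : Sh n (m%:R * h) (Sm y) = Sm (Sh n (m%:R * h) y).
  by rewrite /= iter_comm// => q; exact: euler_step_comm.
rewrite (le_trans (telescoping hip x comm (ltW M0) H2 H1))//.
have okm : admissible n d rho h m by apply: admissible_le ok; rewrite leq_pmull.
(* One coarse step and m fine steps agree to first order. They differ by at most |m h|^2 M |Y^2 x|,
   with |Y^2 x| <= 9 nu^2 |x|, and L such errors add up to a multiple of rho nu^2 |m h|. *)
have step : N (Sh n (m%:R * h) x - Sm x) <=
    m%:R * normc h * (m%:R * normc h * (Mc d rho * (9 * nu n ^+ 2 * N x))).
  rewrite ipnormC// /= {2}/Sh opprB [X in N (_ + X)]addrC addrA.
  apply: euler_drift2 => j jm; rewrite (le_trans (euler_drift _ d0 (admissible_le jm okm)))//.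
  have YY : N (Y n (Y n x)) <= 9 * nu n ^+ 2 * N x.
    have := yosida_le hip hA n (Y n x); have := yosida_le hip hA n x; have := rate_gt0 hA n; nra.
  rewrite ler_pM ?mulr_ge0 ?ipnorm_ge0 ?(ltW M0)//.
  - by rewrite ler_wpM2r// ler_nat.
  - by rewrite ler_wpM2l ?(ltW M0).
rewrite (le_trans (ler_wpM2l (ler0n _ _) (ler_wpM2l (mulr_ge0 (ltW M0) (ltW M0)) step)))//.
move: Lh; rewrite natrM.
have : 0 <= Mc d rho ^+ 3 * (9 * nu n ^+ 2 * N x) * (m%:R * normc h).
  by rewrite !mulr_ge0 ?exprn_ge0 ?ipnorm_ge0 ?(ltW M0) ?(ltW (rate_gt0 hA n)).
move: (L%:R) (m%:R) (normc h) (nu n) (N x) (Mc _ _) => l q r v s M P Q.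
have := ler_wpM2l P Q; lra.
Qed.

(** The exponent 3 makes nu^2 |h| = |z| / nu tend to 0, so that refining the step no longer matters
    in the limit. With nu^2 steps this quantity would stay bounded, which gives stability but not
    convergence. *)
Definition euler_iter n z x : E := iter ((n + n1) ^ 3) (Sh n ((nu n ^- 3)%:C * z)) x.

Local Notation F := euler_iter.

Definition in_sector (d rho : R) z := d * normc z <= Re z /\ normc z <= rho.

Lemma natr_cube n : ((n + n1) ^ 3)%:R = nu n ^+ 3.
Proof. by rewrite natrX. Qed.

Lemma normc_euler_step n z : normc ((nu n ^- 3)%:C * z) = nu n ^- 3 * normc z.
Proof. by rewrite Normc.normcM normc_real ger0_norm// invr_ge0 exprn_ge0// ltW// (rate_gt0 hA). Qed.

Lemma euler_iter_admissible n d rho z : in_sector d rho z ->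
  admissible n d rho ((nu n ^- 3)%:C * z) ((n + n1) ^ 3).
Proof.
move=> [dz zr]; have v0 := rate_gt0 hA n; split.
- by rewrite normc_euler_step ReZ mulrCA ler_wpM2l// invr_ge0 exprn_ge0// ltW.
- by rewrite normc_euler_step natr_cube mulrA mulfV ?mul1r// expf_neq0// gt_eqF.
- rewrite normc_euler_step mulrA (le_trans _ zr)// ler_piMl ?normc_ge0//.
  by rewrite ler_pdivrMr ?exprn_gt0// mul1r ler_weXn2l ?(rate_ge1 hA).
Qed.

Lemma euler_iter_le n d rho z x : 0 < d -> in_sector d rho z -> N (F n z x) <= Mc d rho * N x.
Proof. by move=> d0 H; apply: euler_stable => //; exact: euler_iter_admissible. Qed.

Lemma euler_iter_linear n z : linear (F n z).
Proof. exact: iter_is_linear. Qed.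

HB.instance Definition _ n z := GRing.isLinear.Build R[i] E E *:%R (F n z) (euler_iter_linear n z).

Lemma euler_iter_resolvent n z m x : F n z (J m x) = J m (F n z x).
Proof. by apply: iter_comm => y; exact: euler_step_resolvent. Qed.

End Approximation.

Section Limit.
Context {R : realType} {E : lmodType R[i]} (ip : E -> E -> R[i]).
Hypothesis hip : hilbert_ip ip.

Definition iplim (u : nat -> E) : E := xget 0 [set l | ipcvg ip u l].

Lemma iplimP u : ipcauchy ip u -> ipcvg ip u (iplim u).
Proof.
by move=> /(hip_complete hip)[l ul]; exact: (@xgetPex _ 0 [set l | ipcvg ip u l] (ex_intro _ l ul)).
Qed.

Lemma ipcvgD u l v m : ipcvg ip u l -> ipcvg ip v m ->
  ipcvg ip (fun n => u n + v n) (l + m).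
Proof.
move=> ul vm; have := ipcvg_linear hip 1 ul vm.
by rewrite scale1r => H e /H[n0 {}H]; exists n0 => n /H; rewrite scale1r.
Qed.

Lemma ipcvgZ a u l : ipcvg ip u l -> ipcvg ip (fun n => a *: u n) (a *: l).
Proof.
move=> ul; have := ipcvg_linear hip a ul (ipcvg_cst hip 0).
by rewrite addr0 => H e /H[n0 {}H]; exists n0 => n /H; rewrite addr0.
Qed.

Lemma ipcvg_lin (L : E -> E) (C : R) u l : (forall x y, L (x - y) = L x - L y) ->
  (forall x, ipnorm ip (L x) <= C * ipnorm ip x) ->
  ipcvg ip u l -> ipcvg ip (fun n => L (u n)) (L l).
Proof.
move=> LB LC ul e e0; have C1 : 0 < `|C| + 1 by rewrite ltr_wpDl.
have [n0 H] := ul _ (divr_gt0 e0 C1); exists n0 => n /H.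
rewrite ler_pdivlMr// -LB; have := LC (u n - l); have := ipnorm_ge0 ip (u n - l).
move: (ler_norm C); move: (ipnorm ip (u n - l)) (ipnorm ip (L (u n - l))) => p q; nra.
Qed.

End Limit.

(** * Convergence of the Euler polynomials *)

Section Semigroup.
Context {R : realType} {E : lmodType R[i]} {ip : E -> E -> R[i]}.
Context {K : R} {n1 : nat} {A : E -> E -> Prop}.
Hypotheses (hip : hilbert_ip ip) (hA : parabolic ip K n1 A).
Local Notation N := (ipnorm ip).
Local Notation nu n := (@rate R n1 n).
Local Notation om := (@sector_shift R K).
Local Notation Mc := (@stab_const R K).
Local Notation J := (resolvent hA).
Local Notation Y := (yosida hA).
Local Notation Sh := (euler_step hA).
Local Notation admissible := (@admissible R n1).
Local Notation F := (euler_iter hA).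
Implicit Types (x y w : E) (a b h z : R[i]) (n m k j : nat) (d rho e t : R).

Lemma natrC k : k%:R = (k%:R : R)%:C :> R[i].
Proof. by rewrite rmorph_nat. Qed.

Lemma stab_const_ge1 d rho : 0 < d -> 0 <= rho -> 1 <= Mc d rho.
Proof.
move=> d0 r0; rewrite -[leLHS]expR0 ler_expR; have o0 := @sector_shift_ge0 _ K _ d0.
by apply: addr_ge0; apply: mulr_ge0 => //; [exact: mulr_ge0|exact: sqr_ge0].
Qed.

Lemma in_sector_ge0 d rho z : in_sector d rho z -> 0 <= rho.
Proof. by case=> _; apply: le_trans; exact: normc_ge0. Qed.

Lemma normc_rscale t z : 0 <= t -> normc (t%:C * z) = t * normc z.
Proof. by move=> t0; rewrite Normc.normcM normc_real ger0_norm. Qed.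

(** The error is governed by the coarse step alone, hence does not depend on m: nu^2 |z| / nu^3 =
    |z| / nu. *)
Lemma euler_iter_refine n d rho z m x : 0 < d -> in_sector d rho z -> (0 < m)%N ->
  N (F n z x - iter ((n + n1) ^ 3 * m) (Sh n ((nu n ^- 3 * m%:R^-1)%:C * z)) x)
   <= 9 * Mc d rho ^+ 3 * rho ^+ 2 * (nu n)^-1 * N x.
Proof.
move=> d0 zd m0; have v0 := rate_gt0 hA n; have r0 := in_sector_ge0 zd.
have [dz zr] := zd; have mR : 0 < m%:R :> R by rewrite ltr0n.
have c0 : 0 <= nu n ^- 3 * m%:R^-1 by rewrite mulr_ge0 ?invr_ge0 ?exprn_ge0// ltW.
have E1 : m%:R * ((nu n ^- 3 * m%:R^-1)%:C * z) = (nu n ^- 3)%:C * z.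
  rewrite natrC mulrA -rmorphM /=.
  by rewrite mulrCA mulfV ?mulr1// gt_eqF.
have E2 : m%:R * normc ((nu n ^- 3 * m%:R^-1)%:C * z) = nu n ^- 3 * normc z.
  by rewrite normc_rscale// mulrA mulrCA mulfV ?mulr1// gt_eqF.
have E3 : nu n ^+ 2 * (nu n ^- 3 * normc z) = (nu n)^-1 * normc z.
  by move: (nu n) v0 => v v0; field; rewrite gt_eqF.
have nz : (nu n)^-1 * normc z <= rho.
  rewrite (le_trans _ zr)// ler_piMl ?normc_ge0// invf_le1//; exact: rate_ge1 hA n.
have ok : admissible n d rho ((nu n ^- 3 * m%:R^-1)%:C * z) ((n + n1) ^ 3 * m).
  split.
  - by rewrite normc_rscale// ReZ mulrCA ler_wpM2l.
  - rewrite natrM natr_cube -mulrA E2 mulrA mulfV ?mul1r//.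
    by rewrite expf_neq0// gt_eqF.
  - rewrite (le_trans _ nz)// -E3 -E2 ler_wpM2l ?sqr_ge0//.
    by rewrite ler_peMl ?normc_ge0// ler1n.
have := euler_refine hip hA x d0 ok; rewrite E1 E2 E3 => /(_ nz).
move=> /le_trans; apply; rewrite ler_wpM2r ?ipnorm_ge0//.
rewrite expr2 mulrA -[leRHS]mulrA ler_wpM2l//; last first.
  by rewrite mulrC ler_wpM2r// invr_ge0 ltW.
by apply: mulr_ge0 => //; rewrite mulr_ge0// exprn_ge0// ltW// stab_const_gt0.
Qed.

(** Both polynomials are first refined to nu_n^3 nu_m^3 steps of the same size h. Then they are
    compared by telescoping, where one step differs by h (Y_n - Y_m) x. *)
Lemma euler_iter_dist n m d rho z x : 0 < d -> in_sector d rho z ->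
  N (F n z x - F m z x) <=
    9 * Mc d rho ^+ 3 * rho ^+ 2 * ((nu n)^-1 + (nu m)^-1) * N x +
    Mc d rho ^+ 2 * rho * N (Y n x - Y m x).
Proof.
move=> d0 zd.
have pos k : (0 < (k + n1) ^ 3)%N by rewrite expn_gt0 addn_gt0 (par_n0 hA) orbT.
have H1 := euler_iter_refine n x d0 zd (pos m).
have H2 := euler_iter_refine m x d0 zd (pos n).
have M0 := ltW (@stab_const_gt0 R K d rho).
move: H1 H2; rewrite !natr_cube [(_ ^ 3 * (n + n1) ^ 3)%N]mulnC [nu m ^- 3 * _]mulrC.
set h := (_ * _)%:C * z; set L := (_ * _)%N => H1 H2.
have ok k : (k = n \/ k = m) -> admissible k d rho h L.
  have [dz zr] := zd; have v0 k' := rate_gt0 hA k'.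
  have c0 : 0 <= nu n ^- 3 * nu m ^- 3 by rewrite mulr_ge0 ?invr_ge0 ?exprn_ge0// ltW.
  have Lh : L%:R * normc h = normc z.
    rewrite normc_rscale// natrM !natr_cube; move: (nu n) (nu m) (v0 n) (v0 m) => v u v1 u1.
    by field; rewrite !gt_eqF.
  move=> kP; split; rewrite ?Lh//; first by rewrite normc_rscale// ReZ mulrCA ler_wpM2l.
  rewrite (le_trans _ zr)// -Lh ler_wpM2r ?normc_ge0// natrM !natr_cube.
  have := rate_ge1 hA n; have := rate_ge1 hA m => m1' n1'.
  case: kP => ->.
    rewrite -[leLHS]mulr1 ler_pM ?exprn_ege1 ?sqr_ge0//.
    by rewrite ler_weXn2l.
  rewrite -[leLHS]mul1r ler_pM ?exprn_ege1 ?sqr_ge0//.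
  by rewrite ler_weXn2l.
have H3 : N (iter L (Sh n h) x - iter L (Sh m h) x) <=
    Mc d rho ^+ 2 * rho * N (Y n x - Y m x).
  have Hn j y : (j <= L)%N -> N (iter j (Sh n h) y) <= Mc d rho * N y.
    by move=> jL; apply: euler_stable => //; exact: admissible_le jL (ok _ (or_introl erefl)).
  have Hm j y : (j <= L)%N -> N (iter j (Sh m h) y) <= Mc d rho * N y.
    by move=> jL; apply: euler_stable => //; exact: admissible_le jL (ok _ (or_intror erefl)).
  have comm y : Sh n h (Sh m h y) = Sh m h (Sh n h y) by exact: euler_step_comm.
  rewrite (le_trans (telescoping hip x comm M0 Hn Hm))//.
  have -> : Sh n h x - Sh m h x = - (h *: (Y n x - Y m x)).
    by rewrite /euler_step scalerBr !opprB [x - _ + _]addrC subrKA.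
  rewrite ipnormN// ipnormZ// mulrCA -expr2 -mulrA ler_wpM2l ?sqr_ge0//.
  rewrite mulrA ler_wpM2r ?ipnorm_ge0//.
  by have [] := ok n (or_introl erefl).
have := ipnorm_dist hip (F n z x) (iter L (Sh n h) x) (F m z x).
have := ipnorm_dist hip (iter L (Sh n h) x) (iter L (Sh m h) x) (F m z x).
rewrite [N (iter L (Sh m h) x - _)]ipnormC//; lra.
Qed.

Lemma in_sector_self z : 0 < Re z -> 0 < Re z / normc z /\ in_sector (Re z / normc z) (normc z) z.
Proof.
move=> z0; have nz : 0 < normc z := lt_le_trans z0 (Re_normc z).
by split; [rewrite divr_gt0|split; rewrite ?divfK ?gt_eqF].
Qed.

(** On the domain both terms of [euler_iter_dist] tend to 0, the second by [yosida_cvg]. Uniform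
    stability carries this over to all x by density. *)
Lemma euler_iter_cauchy z x : 0 < Re z -> ipcauchy ip (fun n => F n z x).
Proof.
move=> /in_sector_self[]; set d := _ / _; set rho := normc z => d0 zd e e0.
have r0 : 0 <= rho := normc_ge0 z.
have M0 := @stab_const_gt0 R K d rho; set M := Mc d rho in M0.
have e8 : 0 < e / 8 by rewrite divr_gt0.
have [x' [w' [Ax' Hx']]] := parabolic_dense hip hA x (divr_gt0 e8 M0).
have c0 : 0 < 9 * M ^+ 3 * rho ^+ 2 * N x' + 1.
  by rewrite ltr_wpDl// !mulr_ge0 ?exprn_ge0 ?ipnorm_ge0// ltW.
have [n2 H2] := rate_inv_le hA (divr_gt0 e8 c0).
have c1 : 0 < M ^+ 2 * rho + 1 by rewrite ltr_wpDl// mulr_ge0 ?exprn_ge0// ltW.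
have [n3 H3] := ipcvg_cauchy hip (yosida_cvg hip hA Ax') (divr_gt0 e8 c1).
exists (maxn n2 n3) => n m; rewrite !geq_max => /andP[n2n n3n] /andP[n2m n3m].
have FB k : F k z x - F k z x' = F k z (x - x') by rewrite linearB.
have Fle k : N (F k z x - F k z x') <= e / 8.
  rewrite FB (le_trans (euler_iter_le hip hA k (x - x') d0 zd))// -/M mulrC.
  by rewrite -ler_pdivlMr.
have := ipnorm_dist hip (F n z x) (F n z x') (F m z x).
have := ipnorm_dist hip (F n z x') (F m z x') (F m z x).
have := Fle m; have := Fle n; rewrite (ipnormC hip (F m z x') (F m z x)).
have := euler_iter_dist n m x' d0 zd; rewrite -/M.
have : 9 * M ^+ 3 * rho ^+ 2 * ((nu n)^-1 + (nu m)^-1) * N x' <= e / 4.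
  move: (H2 _ n2n) (H2 _ n2m); rewrite !ler_pdivlMr//.
  have vn : 0 <= (nu n)^-1 by rewrite invr_ge0 ltW// (rate_gt0 hA).
  have vm : 0 <= (nu m)^-1 by rewrite invr_ge0 ltW// (rate_gt0 hA).
  move: vn vm; move: ((nu n)^-1) ((nu m)^-1) => p q.
  move: (M ^+ 3) (rho ^+ 2) (N x') => r s t h1 h2 h3 h4.
  by clear -h1 h2 h3 h4; lra.
have : M ^+ 2 * rho * N (Y n x' - Y m x') <= e / 8.
  have := H3 _ _ n3n n3m; rewrite ler_pdivlMr//; have := ipnorm_ge0 ip (Y n x' - Y m x').
  move: (M ^+ 2) (N _) => p q; lra.
lra.
Qed.

(* Outside the half-plane Re z > 0 the value is the identity; only z = 0 matters. *)
Definition orbit z x : E := if 0 < Re z then iplim ip (fun n => F n z x) else x.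
Local Notation T := orbit.

Lemma orbit0 x : T 0 x = x. Proof. by rewrite /T ltxx. Qed.

Lemma orbit_cvg z x : 0 < Re z -> ipcvg ip (fun n => F n z x) (T z x).
Proof. by move=> z0; rewrite /T z0; apply: iplimP => //; exact: euler_iter_cauchy. Qed.

Lemma orbit_linear z : linear (T z).
Proof.
move=> a x y; have [z0|z0] := boolP (0 < Re z); last by rewrite /T (negbTE z0).
apply: (ipcvg_unique hip (orbit_cvg _ z0)).
have := ipcvg_linear hip a (orbit_cvg x z0) (orbit_cvg y z0).
by move=> H e /H[n0 {}H]; exists n0 => n /H /=; rewrite (euler_iter_linear hip hA n z a x y).
Qed.

HB.instance Definition _ z := GRing.isLinear.Build R[i] E E *:%R (T z) (orbit_linear z).

Definition semigroup_op z : {linear E -> E} := T z.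

Lemma orbit_le d rho z x : 0 < d -> in_sector d rho z -> N (T z x) <= Mc d rho * N x.
Proof.
move=> d0 zd; have [z0|z0] := boolP (0 < Re z).
  by apply: (ipcvg_le0 hip (orbit_cvg x z0)); exists 0%N => n _; exact: euler_iter_le.
(* Here the orbit is the identity by convention, and the constant is at least 1. *)
rewrite /T (negbTE z0) ler_peMl ?ipnorm_ge0// stab_const_ge1//; exact: in_sector_ge0 zd.
Qed.

Lemma orbit_resolvent z m x : T z (J m x) = J m (T z x).
Proof.
have [z0|z0] := boolP (0 < Re z); last by rewrite /T (negbTE z0).
apply: (ipcvg_unique hip (orbit_cvg _ z0)).
have JB y y' : J m (y - y') = J m y - J m y' by rewrite linearB.
have := ipcvg_lin JB (resolvent_le hip hA m) (orbit_cvg x z0).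
by move=> H e /H[n0 {}H]; exists n0 => n /H; rewrite (euler_iter_resolvent hip).
Qed.

(** The graph becomes an equation in the bounded operator J n, so it is preserved by whatever
    commutes with J n, and graph membership can be checked without any closedness argument. *)
Lemma parabolic_resolventP n x w : x = J n (x + (nu n)^-1%:C *: w) <-> A x w.
Proof.
have v0 : nu n != 0 by rewrite gt_eqF// (rate_gt0 hA).
have E1 : (nu n)%:C *: (x + (nu n)^-1%:C *: w - x) = w.
  by rewrite addrC addKr scalerA -rmorphM /= mulfV// scale1r.
split=> [xE|Ax]; last by apply: resolvent_unique => //; rewrite E1.
by have := resolventP hA n (x + (nu n)^-1%:C *: w); rewrite -xE E1.
Qed.

Lemma orbit_graph z x w : A x w -> A (T z x) (T z w).
Proof.
move=> /(parabolic_resolventP 0) xE; apply/(parabolic_resolventP 0).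
by rewrite {1}xE orbit_resolvent linearD /= linearZ_LR.
Qed.

(** With c = nu^-3, the product of the steps for z and z' differs from the step for z + z' by c^2 z
    z' Y^2, of norm at most 9 nu^-4 rho^2. Over nu^3 steps this leaves 9 rho^2 / nu. *)
Lemma euler_iter_mul n d rho z z' x : 0 < d -> in_sector d rho z -> in_sector d rho z' ->
  in_sector d rho (z + z') ->
  N (F n z (F n z' x) - F n (z + z') x) <= 9 * Mc d rho ^+ 3 * rho ^+ 2 * (nu n)^-1 * N x.
Proof.
move=> d0 zd zd' zzd'; have v0 := rate_gt0 hA n.
have M0 := @stab_const_gt0 R K d rho; set M := Mc d rho in M0 *.
set L := ((n + n1) ^ 3)%N.
set c : R[i] := (nu n ^- 3)%:C.
pose f := Sh n (c * z) \o Sh n (c * z').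
have fE j y : iter j f y = iter j (Sh n (c * z)) (iter j (Sh n (c * z')) y).
  elim: j y => //= j IH y; rewrite IH /f /= -[X in Sh _ _ X]iter_comm// => u.
  exact: euler_step_comm.
have -> : F n z (F n z' x) = iter L f x by rewrite fE.
have Hf j y : (j <= L)%N -> N (iter j f y) <= M ^+ 2 * N y.
  move=> jL; rewrite fE (le_trans (euler_stable hip hA _ d0 (admissible_le jL (euler_iter_admissible hA n zd))))//.
  rewrite expr2 -mulrA ler_wpM2l ?(ltW M0)//.
  by have := euler_stable hip hA y d0 (admissible_le jL (euler_iter_admissible hA n zd')).
have Hg j y : (j <= L)%N -> N (iter j (Sh n (c * (z + z'))) y) <= M * N y.
  by move=> jL; have := euler_stable hip hA y d0 (admissible_le jL (euler_iter_admissible hA n zzd')).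
have comm y : f (Sh n (c * (z + z')) y) = Sh n (c * (z + z')) (f y).
  by rewrite /f /= (euler_step_comm hip hA n (c * z')) (euler_step_comm hip hA n (c * z)).
rewrite (le_trans (telescoping hip x comm (exprn_ge0 2 (ltW M0)) Hf Hg))//.
have -> : f x - Sh n (c * (z + z')) x = (c * z * (c * z')) *: Y n (Y n x).
  rewrite /f /= /euler_step (linearB (Y n)) /= (linearZ_LR (Y n)) /= mulrDr scalerDl.
  by rewrite scalerBr !opprB addrC addrA subrKA addrK subrKC scalerA.
rewrite ipnormZ// Normc.normcM !normc_rscale ?invr_ge0 ?exprn_ge0 ?(ltW v0)//.
have YY : N (Y n (Y n x)) <= 9 * nu n ^+ 2 * N x.
  have := yosida_le hip hA n (Y n x); have := yosida_le hip hA n x; have := rate_gt0 hA n; nra.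
have [_ zr] := zd; have [_ zr'] := zd'; rewrite natr_cube.
have zz' : normc z * normc z' <= rho ^+ 2 by rewrite expr2 ler_pM// normc_ge0.
have c0 : 0 <= nu n ^- 3 by rewrite invr_ge0 exprn_ge0// ltW.
apply: (@le_trans _ _ (nu n ^+ 3 * (M ^+ 2 * M *
   (nu n ^- 3 * (nu n ^- 3 * rho ^+ 2) * (9 * nu n ^+ 2 * N x))))).
  rewrite ler_wpM2l ?exprn_ge0 ?(ltW v0)// ler_wpM2l ?mulr_ge0 ?exprn_ge0 ?(ltW M0)//.
  rewrite ler_pM ?ipnorm_ge0 ?mulr_ge0 ?normc_ge0//.
  by rewrite -mulrA ler_wpM2l// mulrCA ler_wpM2l.
rewrite le_eqVlt; apply/orP; left; apply/eqP.
by move: (nu n) v0 => v v1; field; rewrite gt_eqF.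
Qed.

End Semigroup.

(** * Cauchy estimates *)

Section CauchyEstimates.
Context {R : realType}.

(** X^d - 1 splits over the algebraically closed field R[i] and is separable, so it has d distinct
    roots, and the group they form is cyclic. *)
Lemma prim_root_exists (d : nat) : (0 < d)%N -> exists zeta : R[i], d.-primitive_root zeta.
Proof.
move=> d0; have [rs prs] := closed_field_poly_normal ('X^d - 1 : {poly R[i]}).
rewrite (monicP (monicXnsubC _ d0)) scale1r in prs.
have sep : uniq rs.
  by rewrite -separable.separable_prod_XsubC -prs cyclotomic.separable_Xn_sub_1// pnatr_eq0 -lt0n.
have size_rs : (d <= size rs)%N.
  by rewrite -ltnS -(size_prod_XsubC rs id) -prs size_XnsubC.
have unity : all d.-unity_root rs.
  by apply/allP => z; rewrite -root_prod_XsubC -prs.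
by have /hasP[zeta _ ?] := cyclic.has_prim_root d0 unity sep size_rs; exists zeta.
Qed.

Lemma sum_prim_root d (zeta : R[i]) m : d.-primitive_root zeta ->
  \sum_(j < d) (zeta ^+ m) ^+ j = if (d %| m)%N then d%:R else 0.
Proof.
move=> zp; rewrite (prim_order_dvd zp); case: eqP => [->|/eqP m1].
  by under eq_bigr do rewrite expr1n; rewrite sumr_const card_ord.
have := subrX1 (zeta ^+ m) d.
rewrite -exprM mulnC exprM (prim_expr_order zp) expr1n subrr => /esym/eqP.
by rewrite mulf_eq0 subr_eq0 (negbTE m1) => /eqP.
Qed.

Lemma normc_prim_root d (zeta : R[i]) m : (0 < d)%N -> d.-primitive_root zeta ->
  normc (zeta ^+ m) = 1.
Proof.
move=> d0 zp; apply: complexI; rewrite -normcE normrX.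
suff -> : `|zeta| = 1 by rewrite expr1n.
apply/eqP; rewrite -(@pexpr_eq1 _ _ d)// -?lt0n//.
by rewrite -normrX (prim_expr_order zp) normr1.
Qed.

Context {E : lmodType R[i]} {ip : E -> E -> R[i]}.
Hypothesis hip : hilbert_ip ip.
Local Notation N := (ipnorm ip).

Lemma cauchy_coef d (a : nat -> E) (r M : R) k : (k < d)%N -> 0 <= r ->
  (forall h : R[i], normc h = r -> N (\sum_(l < d) h ^+ l *: a l) <= M) ->
  r ^+ k * N (a k) <= M.
Proof.
move=> kd r0 aM; have d0 : (0 < d)%N by rewrite (leq_ltn_trans _ kd).
have [zeta zp] := prim_root_exists d0.
pose p (h : R[i]) := \sum_(l < d) h ^+ l *: a l.
(* The exponent d - k stands for -k. The sum over j vanishes unless d divides d - k + l; as k and l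
   are below d, this means l = k, so no other coefficient is aliased onto a k. *)
have E1 : \sum_(j < d) zeta ^+ ((d - k) * j) *: p (r%:C * zeta ^+ j)
    = (d%:R * r%:C ^+ k) *: a k.
  under eq_bigr => j _ do rewrite /p scaler_sumr.
  rewrite exchange_big /= (bigD1 (Ordinal kd)) //= [X in _ + X]big1 ?addr0.
    rewrite -(scalerA d%:R) -[d%:R]/(d%:R : R[i]).
    rewrite (eq_bigr (fun=> r%:C ^+ k *: a k)) ?sumr_const ?card_ord ?scaler_nat//.
    move=> j _; rewrite scalerA exprMn mulrCA -exprM -exprD (mulnC j k) -mulnDl.
    by rewrite subnK ?(ltnW kd)// exprM (prim_expr_order zp) expr1n mulr1.
  move=> l /eqP lk.
  rewrite (eq_bigr (fun j : 'I_d => (zeta ^+ (d - k + l)) ^+ j *: (r%:C ^+ l *: a l))).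
    rewrite -scaler_suml sum_prim_root//; case: ifP; rewrite ?scale0r// => dkl.
    exfalso; apply: lk; apply: val_inj => /=.
    have : (l == k %[mod d])%N.
      rewrite -(eqn_modDl (d - k)) subnK ?(ltnW kd)// modnn.
      exact: dkl.
    by rewrite !modn_small// => /eqP.
  move=> j _; rewrite !scalerA; congr (_ *: _).
  by rewrite exprMn mulrCA mulrC -!exprM -exprD mulnDl [(j * l)%N]mulnC.
have : N ((d%:R * r%:C ^+ k) *: a k) <= d%:R * M.
  rewrite -E1 (le_trans (ipnorm_sum hip _ _ _))//.
  rewrite (@le_trans _ _ (\sum_(j < d) M))//; last by rewrite sumr_const card_ord mulr_natl.
  apply: ler_sum => j _; rewrite ipnormZ// (normc_prim_root _ d0 zp) mul1r aM//.
  by rewrite Normc.normcM (normc_prim_root _ d0 zp) normc_real ger0_norm// mulr1.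
rewrite ipnormZ// Normc.normcM normc_nat -rmorphXn normc_real ger0_norm ?exprn_ge0//.
by rewrite -mulrA ler_pM2l// ltr0n.
Qed.

Lemma sum_geometric_le2 (q : R) n : 0 <= q -> q <= 2^-1 -> \sum_(i < n) q ^+ i <= 2.
Proof.
move=> q0 q2; have := subrX1 q n; have : 0 <= q ^+ n by rewrite exprn_ge0.
have : 0 <= \sum_(i < n) q ^+ i by apply: sumr_ge0 => i _; rewrite exprn_ge0.
move: (q ^+ n) (\sum_(i < n) _) => s S S0 s0 H; nra.
Qed.

Definition polyfun d (p : R[i] -> E) :=
  exists a : nat -> E, forall h, p h = \sum_(l < d) h ^+ l *: a l.

Lemma polyfunS d p : polyfun d p -> polyfun d.+1 p.
Proof.
move=> [a pE]; exists (fun l => if (l < d)%N then a l else 0) => h.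
rewrite big_ord_recr /= ltnn scaler0 addr0 pE.
by apply: eq_bigr => l _; rewrite ltn_ord.
Qed.

Lemma polyfunD d p q : polyfun d p -> polyfun d q -> polyfun d (fun h => p h + q h).
Proof.
move=> [a pE] [b qE]; exists (fun l => a l + b l) => h; rewrite pE qE -big_split /=.
by apply: eq_bigr => l _; rewrite scalerDr.
Qed.

Lemma polyfun_lin d p (L : {linear E -> E}) : polyfun d p -> polyfun d (fun h => L (p h)).
Proof.
move=> [a pE]; exists (fun l => L (a l)) => h; rewrite pE linear_sum.
by apply: eq_bigr => l _; rewrite linearZ_LR.
Qed.

Lemma polyfunZ d p (c : R[i]) : polyfun d p -> polyfun d (fun h => c *: p h).
Proof.
move=> [a pE]; exists (fun l => c *: a l) => h; rewrite pE scaler_sumr.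
by apply: eq_bigr => l _; rewrite !scalerA mulrC.
Qed.

Lemma polyfunX d p : polyfun d p -> polyfun d.+1 (fun h => h *: p h).
Proof.
move=> [a pE]; exists (fun l => if l is k.+1 then a k else 0) => h; rewrite pE scaler_sumr.
by rewrite big_ord_recl /= scaler0 add0r; apply: eq_bigr => l _; rewrite scalerA exprS.
Qed.

(** [a1] is the linear coefficient. The later ones are at most M / r^k, so for |h| <= r / 2 the
    remainder is a geometric sum of ratio at most 1 / 2. The bound does not involve the degree,
    which is what lets it pass to a limit of polynomials of growing degree. *)
Lemma polyfun_quotient d p (r M : R) : polyfun d p -> 0 < r ->
  (forall h, normc h = r -> N (p h) <= M) ->
  exists a1, forall h, h != 0 -> normc h <= r / 2 ->
    N (h^-1 *: (p h - p 0) - a1) <= 2 * M / r ^+ 2 * normc h.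
Proof.
(* Padding twice provides a constant and a linear coefficient even when d < 2. *)
move=> /polyfunS/polyfunS [a pE] r0 pM.
have aM k : (k < d.+2)%N -> N (a k) <= M / r ^+ k.
  move=> kd; rewrite ler_pdivlMr ?exprn_gt0// mulrC.
  by apply: cauchy_coef kd (ltW r0) _ => h /pM; rewrite pE.
exists (a 1%N) => h h0 hr.
have nh : 0 < normc h by rewrite lt_neqAle eq_sym normc_eq0 h0 normc_ge0.
have -> : p 0 = a 0%N.
  rewrite pE big_ord_recl /= expr0 scale1r big1 ?addr0// => l _.
  by rewrite expr0n /= scale0r.
rewrite pE !big_ord_recl /= expr0 scale1r [a 0%N + _]addrC addrK scalerDr scalerA expr1.
rewrite mulVf// scale1r addrAC subrr add0r ipnormZ// Normc.normcV.
rewrite mulrC ler_pdivrMr// (le_trans (ipnorm_sum hip _ _ _))//.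
pose q := normc h / r; have q0 : 0 <= q by rewrite divr_ge0// ltW.
have q2 : q <= 2^-1 by rewrite ler_pdivrMr// mulrC.
rewrite (@le_trans _ _ (\sum_(i < d) M * q ^+ 2 * q ^+ i))//.
  apply: ler_sum => i _; rewrite ipnormZ//.
  have -> : normc (h ^+ i.+2) = normc h ^+ i.+2.
    by apply: complexI; rewrite -normcE normrX normcE rmorphXn.
  rewrite (le_trans (ler_wpM2l (exprn_ge0 _ (ltW nh)) (aM i.+2 _)))// ?ltnS//.
  by rewrite -mulrA -exprD add2n /q expr_div_n mulrCA.
rewrite -mulr_sumr (_ : 2 * M / r ^+ 2 * normc h * normc h = M * q ^+ 2 * 2).
  rewrite ler_wpM2l ?sum_geometric_le2// mulr_ge0 ?sqr_ge0//.
  by rewrite (le_trans (ipnorm_ge0 ip (p r%:C)))// pM// normc_real gtr0_norm.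
by rewrite /q; field; rewrite gt_eqF.
Qed.

End CauchyEstimates.

(** * Semigroup law, behaviour at 0 and complex differentiability *)

Section SemigroupLaws.
Context {R : realType} {E : lmodType R[i]} {ip : E -> E -> R[i]}.
Context {K : R} {n1 : nat} {A : E -> E -> Prop}.
Hypotheses (hip : hilbert_ip ip) (hA : parabolic ip K n1 A).
Local Notation N := (ipnorm ip).
Local Notation nu n := (@rate R n1 n).
Local Notation Mc := (@stab_const R K).
Local Notation J := (resolvent hA).
Local Notation Y := (yosida hA).
Local Notation Sh := (euler_step hA).
Local Notation F := (euler_iter hA).
Local Notation T := (orbit hA).
Local Notation admissible := (@admissible R n1).
Implicit Types (x y w : E) (a b h z : R[i]) (n m k j : nat) (d rho e t : R).

(** With d the smaller of the two apertures and rho = |z| + |z'|, the points z, z' and z + z' share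
    one region, so the constants in [euler_iter_mul] are fixed while n grows. *)
Lemma orbitD z z' x : 0 < Re z -> 0 < Re z' -> T (z + z') x = T z (T z' x).
Proof.
move=> z0 z0'; have [d0 [dz _]] := in_sector_self z0; have [d0' [dz' _]] := in_sector_self z0'.
set d1 := _ / _ in d0 dz; set d2 := _ / _ in d0' dz'.
pose d := Num.min d1 d2; pose rho := normc z + normc z'.
have dd : 0 < d by rewrite lt_min d0.
have dz1 : d * normc z <= Re z.
  by rewrite (le_trans _ dz)// ler_wpM2r ?normc_ge0// ge_min lexx.
have dz2 : d * normc z' <= Re z'.
  by rewrite (le_trans _ dz')// ler_wpM2r ?normc_ge0// ge_min lexx orbT.
have r1 : in_sector d rho z by split=> //; rewrite lerDl normc_ge0.
have r2 : in_sector d rho z' by split=> //; rewrite lerDr normc_ge0.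
have r3 : in_sector d rho (z + z').
  split; last exact: le_normcD.
  rewrite ReD (le_trans (ler_wpM2l (ltW dd) (le_normcD _ _)))// mulrDr.
  exact: lerD.
have M0 := @stab_const_gt0 R K d rho.
have zz0 : 0 < Re (z + z') by rewrite ReD addr_gt0.
apply: (ipcvg_unique hip (orbit_cvg hip hA x zz0)) => e e0.
have e4 : 0 < e / 4 by rewrite divr_gt0.
have [k1 H1] := orbit_cvg hip hA (T z' x) z0 e4.
have [k2 H2] := orbit_cvg hip hA x z0' (divr_gt0 e4 M0).
have c0 : 0 < 9 * Mc d rho ^+ 3 * rho ^+ 2 * N x + 1.
  by rewrite ltr_wpDl// mulr_ge0 ?ipnorm_ge0// mulr_ge0 ?sqr_ge0// mulr_ge0// exprn_ge0// ltW.
have [k3 H3] := rate_inv_le hA (divr_gt0 e4 c0).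
exists (maxn k1 (maxn k2 k3)) => n; rewrite !geq_max => /andP[nk1 /andP[nk2 nk3]].
have L1 : N (F n z (F n z' x) - F n z (T z' x)) <= e / 4.
  have -> : F n z (F n z' x) - F n z (T z' x) = F n z (F n z' x - T z' x) by rewrite linearB.
  rewrite (le_trans (euler_iter_le hip hA n _ dd r1))// mulrC -ler_pdivlMr//; exact: H2.
have L2 : N (F n z (F n z' x) - F n (z + z') x) <= e / 4.
  rewrite (le_trans (euler_iter_mul hip hA n x dd r1 r2 r3))//.
  have := H3 _ nk3; rewrite ler_pdivlMr//.
  have : 0 <= (nu n)^-1 by rewrite invr_ge0 ltW// (rate_gt0 hA).
  move: ((nu n)^-1) (9 * _ * _) => v c v0 H; clear -v0 H; lra_let.
have := ipnorm_dist hip (F n (z + z') x) (F n z (F n z' x)) (T z (T z' x)).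
have := ipnorm_dist hip (F n z (F n z' x)) (F n z (T z' x)) (T z (T z' x)).
have := H1 _ nk1; rewrite (ipnormC hip (F n (z + z') x) (F n z _)).
move: L1 L2; move: (N _) (N _) (N _) (N _) (N _) => *; lra_let.
Qed.

(* Uniform in the approximation parameter, whence the continuity at 0 and,
   through [euler_drift2], the right derivative at 0 of the limit semigroup. *)
Lemma euler_small d x e : 0 < d -> 0 < e -> exists2 tau : R, 0 < tau &
  forall n h k, admissible n d 1 h k -> k%:R * normc h <= tau ->
    N (iter k (Sh n h) x - x) <= e.
Proof.
move=> d0 e0; have M1 := stab_const_ge1 (K := K) d0 ler01; set M := Mc d 1 in M1.
have M0 : 0 < M := lt_le_trans ltr01 M1.
have c0 : 0 < 2 * (M + 1) by lra_let.
have [x' [w [Ax Hx]]] := parabolic_dense hip hA x (divr_gt0 e0 c0).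
have c1 : 0 < 4 * (M * N w) + 1 by rewrite ltr_wpDl// mulr_ge0// mulr_ge0 ?ipnorm_ge0// ltW.
exists (e / (4 * (M * N w) + 1)); first by rewrite divr_gt0.
move=> n h k ok kh; set f := iter k (Sh n h).
have H1 := euler_drift hip hA x' d0 ok; rewrite -/f -/M (yosida_graph hip hA n Ax) in H1.
have H2 : N (f (x - x')) <= M * N (x - x') by exact: euler_stable.
have fB : f (x - x') = f x - f x' by exact: iter_linearB.
have := ipnorm_dist hip (f x) (f x') x; rewrite -fB.
have := ipnorm_dist hip (f x') x' x; rewrite (ipnormC hip x' x).
have := resolvent_le hip hA n w; move: Hx kh; rewrite !ler_pdivlMr// => Hx kh HJ.
have : k%:R * normc h * (M * N (J n w)) <= k%:R * normc h * (M * (2 * N w)).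
  by rewrite ler_wpM2l ?mulr_ge0 ?normc_ge0// ler_wpM2l// ltW.
have kh0 : 0 <= k%:R * normc h by rewrite mulr_ge0 ?normc_ge0.
have : 0 <= N (x - x') by exact: ipnorm_ge0.
move: H1 H2 Hx kh HJ kh0 e0 {c0 c1 ok}; move: (k%:R * normc h) (N w) (N (J n w)).
move: (N _) (N _) (N _) (N _) (N _) M {M0 M1 fB} => *; lra_let.
Qed.

Lemma natr_cubeK n z : ((n + n1) ^ 3)%:R * normc ((nu n ^- 3)%:C * z) = normc z.
Proof.
by rewrite normc_euler_step natr_cube mulrA mulfV ?mul1r// expf_neq0// gt_eqF// (rate_gt0 hA).
Qed.

Lemma orbit_small d x e : 0 < d -> 0 < e -> exists2 tau : R, 0 < tau &
  forall z, d * normc z <= Re z -> normc z <= tau -> N (T z x - x) <= e.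
Proof.
move=> d0 e0; have [tau tau0 H] := euler_small x d0 e0.
exists (Num.min 1 tau) => [|z dz]; first by rewrite lt_min ltr01.
rewrite le_min => /andP[z1 zt]; have [z0|z0] := boolP (0 < Re z); last first.
  by rewrite /orbit (negbTE z0) subrr ipnorm0// ltW.
apply: (ipcvg_le hip (orbit_cvg hip hA x z0)); exists 0%N => n _.
by have /H := euler_iter_admissible hA n (conj dz z1); rewrite natr_cubeK; exact.
Qed.

Lemma orbit_deriv0 x w e : A x w -> 0 < e -> exists2 tau : R, 0 < tau &
  forall t, 0 < t -> t <= tau -> N (T t%:C x - x + t%:C *: w) <= t * e.
Proof.
move=> Ax e0; have e4 : 0 < e / 4 by rewrite divr_gt0.
have [tau tau0 H] := euler_small w ltr01 e4.
have M1 := stab_const_ge1 (K := K) ltr01 ler01; set M := Mc 1 1 in M1.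
have c0 : 0 < 2 * (M + 1) by lra_let.
(* The drift of Y n x is compared with that of the fixed vector w, controlled uniformly in n; the
   exchange costs (M + 1) |Y n x - w|. *)
have [n0 Hn0] := yosida_cvg hip hA Ax (divr_gt0 e4 c0).
exists (Num.min 1 tau) => [|t t0]; first by rewrite lt_min ltr01.
rewrite le_min => /andP[t1 tt]; have Rt : 0 < Re t%:C by [].
have cvg : ipcvg ip (fun n => F n t%:C x + (-1 *: x + t%:C *: Y n x))
    (T t%:C x + (-1 *: x + t%:C *: w)).
  apply: (ipcvgD hip (orbit_cvg hip hA x Rt)).
  apply: (ipcvgD hip (ipcvg_cst hip _)).
  exact: ipcvgZ hip _ _ _ (yosida_cvg hip hA Ax).
rewrite -addrA -[- x]scaleN1r; apply: (ipcvg_le0 hip cvg).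
exists n0 => n nn; rewrite scaleN1r addrA.
have reg : in_sector 1 1 t%:C by split; rewrite normc_real gtr0_norm// mul1r.
have ok := euler_iter_admissible hA n reg.
have -> : t%:C *: Y n x = (((n + n1) ^ 3)%:R * ((nu n ^- 3)%:C * t%:C)) *: Y n x.
  rewrite natrC natr_cube mulrA -rmorphM /= mulfV ?mul1r//.
  by rewrite expf_neq0// gt_eqF// (rate_gt0 hA).
have tE : t = normc t%:C by rewrite normc_real gtr0_norm.
rewrite [X in _ <= X * _]tE -(natr_cubeK n t%:C); apply: (euler_drift2 hip) => j jk; set f := iter j _.
have okj := admissible_le jk ok.
have fw : N (f w - w) <= e / 4.
  apply: H okj _; rewrite (le_trans _ tt)// [leRHS]tE -(natr_cubeK n t%:C).
  by rewrite ler_wpM2r ?normc_ge0// ler_nat.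
have fY : N (f (Y n x - w)) <= M * N (Y n x - w) by exact: euler_stable.
have fB : f (Y n x - w) = f (Y n x) - f w by exact: iter_linearB.
have := ipnorm_dist hip (f (Y n x)) (f w) (Y n x); rewrite -fB.
have := ipnorm_dist hip (f w) w (Y n x); rewrite (ipnormC hip w (Y n x)).
have := Hn0 _ nn; rewrite ler_pdivlMr//.
have := ipnorm_ge0 ip (Y n x - w).
move: fw fY e0 M1; move: (N _) (N _) (N _) (N _) (N _) => *; lra_let.
Qed.

(** J 0 maps the difference quotients of x to those of J 0 x, which is in the domain, so they tend
    to - Y 0 x as well as to J 0 w. The identity J 0 w = - Y 0 x is the fixed point form of the
    claim. *)
Lemma orbit_deriv0_domain x w :
  (forall e, 0 < e -> exists2 tau : R, 0 < tau & forall t, 0 < t -> t <= tau ->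
     N ((t^-1)%:C *: (T t%:C x - x) - w) <= e) -> A x (- w).
Proof.
move=> H; apply/(parabolic_resolventP hip hA 0).
have TB t y y' : T t%:C (y - y') = T t%:C y - T t%:C y' by rewrite linearB.
have JB y y' : J 0 (y - y') = J 0 y - J 0 y' by rewrite linearB.
have JZ a y : J 0 (a *: y) = a *: J 0 y by rewrite linearZ_LR.
suff JY : J 0 w = - Y 0 x.
  have -> : x + (nu 0)^-1%:C *: - w = x - (nu 0)^-1%:C *: w by rewrite scalerN.
  rewrite JB JZ JY /yosida scalerN opprK scalerA -rmorphM /= mulVf ?scale1r ?subrKC//.
  by rewrite gt_eqF// (rate_gt0 hA).
apply/subr0_eq/(ipnorm_le0 hip)/ler_addgt0Pr => e e0; rewrite add0r opprK.
have e4 : 0 < e / 4 by rewrite divr_gt0.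
have [t1 t10 H1] := H _ e4; have [t2 t20 H2] := orbit_deriv0 (yosidaP hA 0 x) e4.
pose t := Num.min t1 t2; have t0 : 0 < t by rewrite lt_min t10.
have {}H1 := H1 t t0 (ltac:(by rewrite ge_min lexx)).
have {}H2 := H2 t t0 (ltac:(by rewrite ge_min lexx orbT)).
pose q := (t^-1)%:C *: (T t%:C x - x).
have Jq : J 0 q = (t^-1)%:C *: (T t%:C (J 0 x) - J 0 x) by rewrite /q JZ JB orbit_resolvent.
have L1 : N (J 0 w - J 0 q) <= e / 2.
  have := resolvent_le hip hA 0 (q - w); rewrite -JB (_ : J 0 (w - q) = - J 0 (q - w)) ?ipnormN//.
    by move: H1; rewrite -/q; move: (N _) (N _) => *; lra_let.
  by rewrite !JB opprB.
have L2 : N (J 0 q + Y 0 x) <= e / 4.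
  have -> : J 0 q + Y 0 x = (t^-1)%:C *: (T t%:C (J 0 x) - J 0 x + t%:C *: Y 0 x).
    have tt1 : (t^-1)%:C * t%:C = 1 :> R[i] by rewrite -rmorphM /= mulVf ?gt_eqF.
    by rewrite Jq [RHS]scalerDr (scalerA (t^-1)%:C t%:C) tt1 scale1r.
  by rewrite ipnormZ// normc_real gtr0_norm ?invr_gt0// mulrC ler_pdivrMr// mulrC.
have := ipnormD hip (J 0 w - J 0 q) (J 0 q + Y 0 x); rewrite subrKA.
move: (N _) (N _) (N _) L1 L2 => *; lra_let.
Qed.

Lemma polyfun_euler_iter n z x : polyfun ((n + n1) ^ 3).+1 (fun h => F n (z + h) x).
Proof.
rewrite /euler_iter; set c := (nu n ^- 3)%:C; elim: (_ ^ 3)%N => [|k IH] /=.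
  by exists (fun=> x) => h; rewrite big_ord_recl big_ord0 addr0 expr0 scale1r.
set p := fun h : R[i] => iter k (Sh n (c * (z + h))) x in IH.
have H : polyfun k.+2 (fun h => p h + (- (c * z) *: Y n (p h) + - c *: (h *: Y n (p h)))).
  apply: polyfunD (polyfunS IH) (polyfunD _ _).
    exact: polyfunZ (polyfun_lin (Y n) (polyfunS IH)).
  exact: polyfunZ (polyfunX (polyfun_lin (Y n) IH)).
have [a aP] := H; exists a => h; rewrite -aP /euler_step -/(p h); congr (_ + _).
by rewrite (scalerA (- c) h) -scalerDl -scaleNr mulrDr opprD mulNr.
Qed.

(** The linear coefficients of the polynomials h |-> F n (z + h) x are not known to converge in n.
    Two difference quotients are therefore compared at the same n, where [a1] drops out. In the
    limit the quotients of T are Cauchy as h tends to 0, and T' is their limit along the sequence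
    [s]. *)
Lemma orbit_differentiable z : 0 < Re z -> exists (T' : {linear E -> E}) (C C' r : R),
  [/\ 0 < r, 0 <= C, (forall x, N (T' x) <= C' * N x) &
      forall h, h != 0 -> normc h <= r ->
        0 < Re (z + h) /\
        forall x, N (h^-1 *: (T (z + h) x - T z x) - T' x) <= C * normc h * N x].
Proof.
move=> z0; have nz : 0 < normc z := lt_le_trans z0 (Re_normc z).
(* For |h| <= r one has Re (z + h) >= Re z / 2 and |z + h| <= 2 |z|, so d = Re z / (4 |z|) serves
   the whole disc. *)
pose r := Re z / 2; have r0 : 0 < r by rewrite divr_gt0.
pose d := Re z / (4 * normc z); have d0 : 0 < d by rewrite divr_gt0// mulr_gt0.
have reg h : normc h <= r -> in_sector d (2 * normc z) (z + h).
  move=> hr; have zh := le_normcD z h; have zR := Re_normc z.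
  have hR : - normc h <= Re h by have := abs_Re_normc h; rewrite ler_norml => /andP[].
  have rE : r = Re z / 2 by []; split; last by lra_let.
  rewrite ReD /d mulrAC ler_pdivrMr ?mulr_gt0//.
  have H1 : normc (z + h) <= 2 * normc z by lra_let.
  have : Re z * normc (z + h) <= Re z * (2 * normc z) by rewrite ler_wpM2l// ltW.
  have : 0 <= (Re h + r) * normc z by rewrite mulr_ge0 ?(ltW nz)//; lra_let.
  rewrite rE; lra_let.
have Rzh h : normc h <= r -> 0 < Re (z + h).
  move=> hr; rewrite ReD.
  have hR : - normc h <= Re h by have := abs_Re_normc h; rewrite ler_norml => /andP[].
  have rE : r = Re z / 2 by []; lra_let.
pose M := Mc d (2 * normc z); have M0 : 0 < M by exact: stab_const_gt0.
pose q h x := h^-1 *: (T (z + h) x - T z x).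
pose C := 2 * M / r ^+ 2; have C0 : 0 < C by rewrite divr_gt0 ?exprn_gt0// mulr_gt0.
have r2 : r / 2 <= r by lra_let.
have qq h h' x : h != 0 -> h' != 0 -> normc h <= r / 2 -> normc h' <= r / 2 ->
    N (q h x - q h' x) <= C * (normc h + normc h') * N x.
  move=> h0 h0' hr hr'.
  have cv (k : R[i]) : normc k <= r / 2 ->
      ipcvg ip (fun n => k^-1 *: (F n (z + k) x + -1 *: F n z x)) (q k x).
    move=> kr; rewrite /q -[- T z x]scaleN1r; apply: (ipcvgZ hip).
    apply: (ipcvgD hip); first by apply: (orbit_cvg hip hA); apply: Rzh; exact: le_trans kr r2.
    by apply: (ipcvgZ hip); exact: (orbit_cvg hip hA).
  have cvh := ipcvgD hip (cv _ hr) (ipcvgZ hip (-1) (cv _ hr')).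
  rewrite -[- q h' x]scaleN1r; apply: (ipcvg_le0 hip cvh); exists 0%N => n _.
  have [|a1 Ha] := polyfun_quotient hip (polyfun_euler_iter n z x) r0 (M := M * N x).
    by move=> k kr; apply: euler_iter_le => //; apply: reg; rewrite kr.
  rewrite !scaleN1r; have := Ha h h0 hr; have := Ha h' h0' hr'; rewrite addr0.
  have := ipnorm_dist hip (h^-1 *: (F n (z + h) x - F n z x)) a1
    (h'^-1 *: (F n (z + h') x - F n z x)).
  rewrite (ipnormC hip a1).
  rewrite (_ : 2 * (M * N x) / r ^+ 2 = C * N x); last by rewrite /C; ring.
  lra_let.
pose s (j : nat) : R[i] := (r / 2 * j.+1%:R^-1)%:C.
have ns j : normc (s j) = r / 2 * j.+1%:R^-1.
  by rewrite normc_real ger0_norm// mulr_ge0 ?invr_ge0// ltW// divr_gt0.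
have s0 j : s j != 0.
  by rewrite -normc_eq0 ns mulf_neq0// ?gt_eqF ?divr_gt0.
have sr j : normc (s j) <= r / 2.
  by rewrite ns ler_piMr ?invf_le1 ?ler1n// ltW// divr_gt0.
have s_small e : 0 < e -> exists n0, forall j, (n0 <= j)%N -> normc (s j) <= e.
  move=> e0; have [n0 H] := invS_le (divr_gt0 e0 r0); exists n0 => j /H.
  rewrite ler_pdivlMr// ns => Hj; rewrite (le_trans _ Hj)// mulrC.
  by rewrite ler_wpM2l// invr_ge0.
have scau x : ipcauchy ip (fun j => q (s j) x).
  move=> e e0; have c0 : 0 < 2 * C * N x + 1.
    by rewrite ltr_wpDl// mulr_ge0 ?ipnorm_ge0// mulr_ge0// ltW.
  have [n0 H] := s_small _ (divr_gt0 e0 c0); exists n0 => j k /H jn /H kn.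
  rewrite (le_trans (qq _ _ x (s0 j) (s0 k) (sr j) (sr k)))//.
  move: jn kn; rewrite !ler_pdivlMr//; have := normc_ge0 (s j); have := normc_ge0 (s k).
  move: (normc _) (normc _) => p p' p0 p0' H1 H2; lra_let.
pose T' x := iplim ip (fun j => q (s j) x).
have T'cvg x : ipcvg ip (fun j => q (s j) x) (T' x) by exact: iplimP.
have T'lin : linear T'.
  move=> a x y; apply: (ipcvg_unique hip (T'cvg _)).
  have := ipcvg_linear hip a (T'cvg x) (T'cvg y).
  move=> H e /H[n0 {}H]; exists n0 => j /H.
  suff -> : q (s j) (a *: x + y) = a *: q (s j) x + q (s j) y by [].
  rewrite /q (orbit_linear hip hA (z + s j) a x y) (orbit_linear hip hA z a x y).
  by rewrite opprD addrACA -scalerBr scalerDr !scalerA [a * _]mulrC.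
have qT' h x : h != 0 -> normc h <= r / 2 -> N (q h x - T' x) <= C * normc h * N x.
  move=> h0 hr; rewrite ipnormC//; apply/ler_addgt0Pr => e e0.
  apply: (ipcvg_le hip (T'cvg x)).
  have c0 : 0 < C * N x + 1 by rewrite ltr_wpDl// mulr_ge0 ?ipnorm_ge0// ltW.
  have [n0 H] := s_small _ (divr_gt0 e0 c0); exists n0 => j /H.
  rewrite ipnormC// ler_pdivlMr// => Hj.
  rewrite (le_trans (qq _ _ x h0 (s0 j) hr (sr j)))// mulrDr mulrDl lerD2l.
  by have := normc_ge0 (s j); lra_let.
pose T'l : {linear E -> E} := HB.pack T' (GRing.isLinear.Build R[i] E E *:%R T' T'lin).
exists T'l, C, (normc (s 0%N)^-1 * (2 * M) + C * normc (s 0%N)), (r / 2).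
split=> [||x|h h0 hr].
- by rewrite divr_gt0.
- exact: ltW.
- have -> : T'l x = T' x by [].
  have := qT' _ x (s0 0%N) (sr 0%N).
  have : N (q (s 0%N) x) <= normc (s 0%N)^-1 * (2 * M * N x).
    rewrite /q ipnormZ// ler_wpM2l ?normc_ge0//.
    have := ipnormB hip (T (z + s 0%N) x) (T z x).
    have := orbit_le hip hA x d0 (reg _ (le_trans (sr 0%N) r2)).
    have := orbit_le hip hA x d0 (reg 0 (ltac:(by rewrite Normc.normc0 ltW))).
    rewrite addr0 -/M; move: (N _) (N _) (N _) => *; lra_let.
  have := ipnorm_distr hip (T' x) (q (s 0%N) x); rewrite (ipnormC hip (T' x)) mulrDl.
  move: (N (T' x)) (N (q _ x)) (N _) => *; lra_let.
- split=> [|x]; first by apply: Rzh; rewrite (le_trans hr).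
  exact: qT'.
Qed.

End SemigroupLaws.

(** * Primitives of vector-valued functions *)

Lemma subrACA (V : zmodType) (a b c d : V) : a - b - (c - d) = a - c - (b - d).
Proof. by rewrite !opprB addrACA [RHS]addrACA [- b + _]addrC [- c + _]addrC. Qed.

Section Primitives.
Context {R : realType} {E : lmodType R[i]} {ip : E -> E -> R[i]}.
Hypothesis hip : hilbert_ip ip.
Local Notation N := (ipnorm ip).
Implicit Types (u U : R -> E) (a b s t e d : R).

Definition continuous_ge0 u := forall t e, 0 <= t -> 0 < e ->
  exists2 d, 0 < d & forall s, 0 <= s -> `|s - t| < d -> N (u s - u t) <= e.

Definition ucontinuous_ge0 u := forall t e, 0 <= t -> 0 < e ->
  exists2 d, 0 < d & forall a s, 0 <= a <= t -> 0 <= s <= t -> `|a - s| < d ->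
    N (u a - u s) <= e.

(* U' = u, uniformly on bounded intervals. *)
Definition primitive u U := forall t e, 0 <= t -> 0 < e ->
  exists2 d, 0 < d & forall a s b, 0 <= a -> a <= s -> s <= b -> b <= t -> b - a < d ->
    N (U b - U a - (b - a)%:C *: u s) <= e * (b - a).

Definition deriv_within u t (w : E) := forall e, 0 < e ->
  exists2 d, 0 < d & forall h, h != 0 -> 0 <= t + h -> `|h| < d ->
    N (u (t + h) - u t - h%:C *: w) <= e * `|h|.

Lemma heine u : continuous_ge0 u -> ucontinuous_ge0 u.
Proof.
move=> uc t e t0 e0.
have cpt : near_covering_within `[(0 : R), t]%classic.
  by apply/near_covering_withinP/compact_near_coveringP; exact: segment_compact.
(* The covering filter is that of positive radii tending to 0: near each x all small d are moduli,
   and compactness yields one d for the whole segment. *)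
have := cpt R (0 : R)^'+ (fun d a => forall s, 0 <= s <= t -> `|a - s| < d -> N (u a - u s) <= e).
case=> [x /=|d0 /= d0P H].
  rewrite in_itv /= => /andP[x0 xt].
  have [d d0 ud] := uc x (e / 2) x0 (divr_gt0 e0 (ltr0Sn _ 1)).
  exists (ball x (d / 2), [set r | r < d / 2]) => /=.
    split; first by apply: nbhsx_ballx; rewrite divr_gt0.
    by apply: nbhs_right_lt; rewrite divr_gt0.
  move=> [a r] /= [ax rd]; rewrite in_itv /= => /andP[a0 at_] s /andP[s0 st] sr.
  have ax' : `|a - x| < d / 2 by rewrite distrC.
  have H1 := ud a a0 (ltac:(lra)).
  have sx : `|s - x| < d.
    rewrite -(subrK a s) -addrA (le_lt_trans (ler_normD _ _))// distrC; lra.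
  have H2 := ud s s0 sx.
  by have := ipnorm_dist hip (u a) (u x) (u s); rewrite (ipnormC hip (u x)); lra.
exists (d0 / 2); first by rewrite divr_gt0.
move=> a s a0t s0t as_; apply: (H (d0 / 2)) => //=.
- by rewrite sub0r normrN gtr0_norm ?divr_gt0//; lra.
- by rewrite divr_gt0.
Qed.

Lemma mesh_exists t d : 0 <= t -> 0 < d -> exists n : nat, t / n.+1%:R < d.
Proof.
move=> t0 d0; have t1 : 0 < t + 1 by rewrite ltr_wpDl.
have [n0 /(_ n0 (leqnn _)) H] := invS_le (divr_gt0 d0 t1); exists n0.
rewrite ltr_pdivrMr// -[ltLHS]mulr1; move: H; rewrite -[_^-1]mul1r ler_pdivrMr ?ltr0n//.
rewrite mulrAC ler_pdivlMr// mul1r; lra.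
Qed.

Definition gridpt t n i : R := i%:R * (t / n.+1%:R).

Lemma gridpt_end t n : gridpt t n n.+1 = t.
Proof. by rewrite /gridpt mulrC divfK// pnatr_eq0. Qed.

Lemma gridpt0 t n : gridpt t n 0 = 0. Proof. exact: mul0r. Qed.

Lemma gridptS t n i : gridpt t n i.+1 - gridpt t n i = t / n.+1%:R.
Proof. by rewrite /gridpt -mulrBl mulrS addrK mul1r. Qed.

Lemma gridpt_ge0 t n i : 0 <= t -> 0 <= gridpt t n i.
Proof. by move=> t0; rewrite mulr_ge0// divr_ge0. Qed.

Lemma gridpt_le t n i : 0 <= t -> (i <= n.+1)%N -> gridpt t n i <= t.
Proof.
move=> t0 ni; rewrite -[leRHS](gridpt_end t n) ler_wpM2r ?divr_ge0//.
by rewrite ler_nat.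
Qed.

(** The increments are summed over a uniform grid of mesh below d. This takes the place of a mean
    value inequality. *)
Lemma small_increments (G : R -> E) t e : 0 <= t ->
  (exists2 d, 0 < d & forall a b, 0 <= a -> a <= b -> b <= t -> b - a < d ->
     N (G b - G a) <= e * (b - a)) -> N (G t - G 0) <= e * t.
Proof.
move=> t0 [d d0 H]; have [n tn] := mesh_exists t0 d0.
have Hi i : (i <= n.+1)%N -> N (G (gridpt t n i) - G 0) <= e * gridpt t n i.
  elim: i => [|i IH] ni; first by rewrite gridpt0 subrr ipnorm0// mulr0.
  have {}IH := IH (ltnW ni); have gE := gridptS t n i.
  have tn0 : 0 <= t / n.+1%:R by rewrite divr_ge0.
  have gi : gridpt t n i <= gridpt t n i.+1 by rewrite -subr_ge0 gridptS.
  have := H _ _ (gridpt_ge0 n i t0) gi (gridpt_le t0 ni).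
  rewrite gridptS => /(_ tn) H1.
  have := ipnorm_dist hip (G (gridpt t n i.+1)) (G (gridpt t n i)) (G 0).
  have gE2 : gridpt t n i.+1 = t / n.+1%:R + gridpt t n i by rewrite -gE subrK.
  rewrite [X in _ -> _ <= e * X]gE2 mulrDr.
  move: (e * (t / _)) (e * gridpt t n i) H1 IH => *; lra_let.
by have := Hi n.+1 (leqnn _); rewrite gridpt_end.
Qed.

Lemma primitive_unique u U U' t : primitive u U -> primitive u U' -> 0 <= t ->
  U t - U 0 = U' t - U' 0.
Proof.
move=> uU uU' t0; apply/subr0_eq/(ipnorm_le0 hip)/ler_addgt0Pr => e e0; rewrite add0r.
(* There are two defects per unit length over [0, t]; t + 1 keeps the denominator positive at t =
   0. *)
have e1 : 0 < e / (2 * (t + 1)) by rewrite divr_gt0// mulr_gt0// ltr_wpDl.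
have [d1 d10 H1] := uU _ _ t0 e1; have [d2 d20 H2] := uU' _ _ t0 e1.
have := @small_increments (fun s => U s - U' s) t (2 * (e / (2 * (t + 1)))) t0.
have -> : U t - U' t - (U 0 - U' 0) = U t - U 0 - (U' t - U' 0).
  by rewrite !opprD opprK addrACA.
move=> H; apply: (le_trans (H _)).
  exists (Num.min d1 d2) => [|a b a0 ab bt]; first by rewrite lt_min d10.
  rewrite lt_min => /andP[ab1 ab2].
  have := H1 a a b a0 (lexx _) ab bt ab1; have := H2 a a b a0 (lexx _) ab bt ab2.
  have -> : U b - U' b - (U a - U' a) =
     (U b - U a - (b - a)%:C *: u a) - (U' b - U' a - (b - a)%:C *: u a).
    by rewrite (opprB (U' b - U' a)) subrKA subrACA.
  have := ipnormB hip (U b - U a - (b - a)%:C *: u a) (U' b - U' a - (b - a)%:C *: u a).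
  move: (e / _) (N _) (N _) (N _) => *; lra.
have t1 : t + 1 != 0 by rewrite gt_eqF// ltr_wpDl.
have -> : 2 * (e / (2 * (t + 1))) * t = e * (t / (t + 1)) by field.
by rewrite ler_piMr ?(ltW e0)// ler_pdivrMr ?mul1r ?lerDl// ltr_wpDl.
Qed.

Lemma primitive_eq u U U' : (forall t, 0 <= t -> U t - U 0 = U' t - U' 0) ->
  primitive u U -> primitive u U'.
Proof.
move=> UU' uU t e t0 e0; have [d d0 H] := uU t e t0 e0.
exists d => // a s b a0 as_ sb bt bd.
have b0 : 0 <= b by lra.
have -> : U' b - U' a = U b - U a.
  by rewrite -[LHS](subrKA (U' 0)) -[U' 0 - _]opprB -!UU'// opprB subrKA.
exact: H.
Qed.

Lemma primitive_lin u U (L : E -> E) (C : R) :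
  (forall (a : R[i]) x y, L (a *: x + y) = a *: L x + L y) ->
  (forall x, N (L x) <= C * N x) ->
  primitive u U -> primitive (fun s => L (u s)) (fun s => L (U s)).
Proof.
move=> LL LC uU t e t0 e0.
have LB x y : L (x - y) = L x - L y by rewrite addrC -scaleN1r LL scaleN1r addrC.
have L0 : L 0 = 0 by have := LB 0 0; rewrite !subrr.
have LZ (a : R[i]) x : L (a *: x) = a *: L x by rewrite -[a *: x]addr0 LL L0 addr0.
have C1 : 0 < `|C| + 1 by rewrite ltr_wpDl.
have [d d0 H] := uU t _ t0 (divr_gt0 e0 C1).
exists d => // a s b a0 as_ sb bt bd; rewrite -LZ -!LB.
have := H a s b a0 as_ sb bt bd; have := LC (U b - U a - (b - a)%:C *: u s).
have := ler_norm C; have := ipnorm_ge0 ip (U b - U a - (b - a)%:C *: u s).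
move: (N _) (N _) => p q p0 C2 qp; rewrite mulrAC ler_pdivlMr//; nra.
Qed.

Lemma primitiveB u U u' U' : primitive u U -> primitive u' U' ->
  primitive (fun s => u s - u' s) (fun s => U s - U' s).
Proof.
move=> uU uU' t e t0 e0; have e2 : 0 < e / 2 by rewrite divr_gt0.
have [d1 d10 H1] := uU t _ t0 e2; have [d2 d20 H2] := uU' t _ t0 e2.
exists (Num.min d1 d2) => [|a s b a0 as_ sb bt]; first by rewrite lt_min d10.
rewrite lt_min => /andP[/(H1 a s b a0 as_ sb bt) {}H1 /(H2 a s b a0 as_ sb bt) {}H2].
have -> : U b - U' b - (U a - U' a) - (b - a)%:C *: (u s - u' s) =
   (U b - U a - (b - a)%:C *: u s) - (U' b - U' a - (b - a)%:C *: u' s).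
  by rewrite scalerBr [RHS]subrACA (subrACA (U b)).
by have := ipnormB hip (U b - U a - (b - a)%:C *: u s) (U' b - U' a - (b - a)%:C *: u' s); lra.
Qed.

End Primitives.

(** * Existence of primitives, and derivatives as uniform primitives *)

Section PrimitiveExistence.
Context {R : realType} {E : lmodType R[i]} {ip : E -> E -> R[i]}.
Hypothesis hip : hilbert_ip ip.
Local Notation N := (ipnorm ip).
Implicit Types (u U : R -> E) (a b s t e d h : R).

(* The length of [0, s] inside the [i]-th cell [i h, (i + 1) h]. *)
Definition cell h (i : nat) s : R := Num.max 0 (Num.min (s - i%:R * h) h).

Lemma cell_le h i s s' : s <= s' -> cell h i s <= cell h i s'.
Proof.
move=> ss; rewrite /cell ge_max le_max lexx /= le_max.
apply/orP; right; rewrite le_min !ge_min lerD2r ss /= lexx orbT //.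
Qed.

Lemma sum_cell h n s : 0 < h -> 0 <= s -> \sum_(i < n) cell h i s = Num.min s (n%:R * h).
Proof.
move=> h0 s0; elim: n => [|n IH]; first by rewrite big_ord0 mul0r min_r.
rewrite big_ord_recr /= IH /cell mulrS mulrDl mul1r.
have nh : 0 <= n%:R * h by rewrite mulr_ge0// ltW.
move: (n%:R * h) nh => c c0; rewrite /Num.max /Num.min.
by repeat case: ifP => /=; rewrite ?ltNge => *; lra_let.
Qed.

(** Only cells that meet the interval between s and s' contribute to an increment, and their left
    endpoints are within h + (s' - s) of each of its points. *)
Lemma cell_neq h i s s' : 0 < h -> s <= s' -> cell h i s != cell h i s' ->
  i%:R * h < s' /\ s < i%:R * h + h.
Proof.
move=> h0 ss; rewrite /cell; move: (i%:R * h) => c; rewrite /Num.max /Num.min => H.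
split; rewrite ltNge; apply/negP => H'; move/eqP: H; apply.
  by repeat case: ifP => /=; rewrite ?ltNge => *; lra_let.
by repeat case: ifP => /=; rewrite ?ltNge => *; lra_let.
Qed.

(* The integral over [0, s] of the left-endpoint step function of mesh 1 / (k + 1);
   its (k + 1)^2 cells cover [0, k + 1]. *)
Definition left_primitive u k s : E :=
  \sum_(i < k.+1 ^ 2) (cell k.+1%:R^-1 i s)%:C *: u (i%:R * k.+1%:R^-1).

(** d is half the modulus of continuity and does not depend on k, so the estimate survives the limit
    in k; the other half is left for the mesh. *)
Lemma left_primitive_incr u t e : ucontinuous_ge0 (ip := ip) u -> 0 <= t -> 0 < e ->
  exists2 d, 0 < d & exists k0, forall k a s b, (k0 <= k)%N ->
    0 <= a -> a <= s -> s <= b -> b <= t -> b - a < d ->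
    N (left_primitive u k b - left_primitive u k a - (b - a)%:C *: u s) <= e * (b - a).
Proof.
move=> uc t0 e0; have [d d0 H] := uc t e t0 e0.
have d2 : 0 < d / 2 by rewrite divr_gt0.
have [k1 H1] := invS_le d2.
have [k2 H2] : exists k2, forall k, (k2 <= k)%N -> t <= k.+1%:R.
  exists (Num.truncn t) => k kt; have /andP[_ /ltW/le_trans] := truncn_itv t0.
  by apply; rewrite ler_nat.
exists (d / 2) => //; exists (maxn k1 k2) => k a s b.
rewrite geq_max => /andP[/H1 {}H1 /H2 {}H2] a0 as_ sb bt bad.
rewrite /left_primitive; set h : R := k.+1%:R^-1.
have h0 : 0 < h by rewrite invr_gt0.
have hd : h <= d / 2 := H1.
have ab : a <= b by lra.
have nh : (k.+1 ^ 2)%:R * h = k.+1%:R.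
  by rewrite natrX expr2 -mulrA mulfV ?mulr1// pnatr_eq0.
have sumE x : 0 <= x -> x <= t -> \sum_(i < k.+1 ^ 2) cell h i x = x.
  by move=> x0 xt; rewrite sum_cell// nh min_l// (le_trans xt).
(* Splitting b - a over the cells turns the defect into a sum of u (i h) - u s with nonnegative
   weights of total b - a. *)
have baE : b - a = \sum_(i < k.+1 ^ 2) (cell h i b - cell h i a).
  by rewrite sumrB !sumE//; lra.
rewrite [in (b - a)%:C]baE rmorph_sum scaler_suml /= -!sumrB.
rewrite (le_trans (ipnorm_sum hip _ _ _))// baE mulr_sumr.
apply: ler_sum => i _; rewrite -scalerBl -rmorphB /= -scalerBr ipnormZ// normc_real.
have ci : 0 <= cell h i b - cell h i a by rewrite subr_ge0 cell_le.
rewrite ger0_norm// mulrC.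
have [->|/cell_neq] := eqVneq (cell h i a) (cell h i b); first by rewrite subrr !mulr0.
move=> /(_ h0 ab)[ib ia]; rewrite ler_wpM2r//; apply: H.
- by apply/andP; split; [rewrite mulr_ge0 ?(ltW h0)|exact: le_trans (ltW ib) bt].
- by apply/andP; split; [exact: le_trans a0 as_|exact: le_trans sb bt].
- by rewrite ltr_norml; apply/andP; split; lra_let.
Qed.

Lemma left_primitive0 u k : left_primitive u k 0 = 0.
Proof.
rewrite /left_primitive big1// => i _; by rewrite /cell sub0r max_l ?scale0r// ge_min oppr_le0 mulr_ge0.
Qed.

Lemma primitive_exists u : ucontinuous_ge0 (ip := ip) u ->
  exists2 U, U 0 = 0 & primitive (ip := ip) u U.
Proof.
move=> uc; pose U s := iplim ip (fun k => left_primitive u k s).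
have Ucvg s : 0 <= s -> ipcvg ip (fun k => left_primitive u k s) (U s).
  move=> s0; apply: (iplimP hip) => e e0.
  have c0 : 0 < 2 * (s + 1) by rewrite mulr_gt0// ltr_wpDl.
  have [d d0 [k0 H]] := left_primitive_incr uc s0 (divr_gt0 e0 c0).
  exists k0 => k l kk kl.
  (* Both functions vanish at 0 and have nearly equal increments on short intervals, uniformly in k
     and l. *)
  have := @small_increments _ _ _ hip (fun r => left_primitive u k r - left_primitive u l r) s
    (2 * (e / (2 * (s + 1)))) s0.
  rewrite !left_primitive0 subrr subr0 => HH; apply: (le_trans (HH _)) => {HH}.
    exists d => // a b a0 ab bt bad.
    have H1 := H k a a b kk a0 (lexx _) ab bt bad.
    have H2 := H l a a b kl a0 (lexx _) ab bt bad.
    rewrite subrACA; move: H1 H2; set p := _ - left_primitive u k a.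
    set q := _ - left_primitive u l a; set c := _ *: _ => H1 H2.
    rewrite -(subrKA c) -(opprB q c).
    have := ipnormB hip (p - c) (q - c); move: (e / _) H1 H2 => *; lra_let.
  have t1 : s + 1 != 0 by rewrite gt_eqF// ltr_wpDl.
  have -> : 2 * (e / (2 * (s + 1))) * s = e * (s / (s + 1)) by field.
  by rewrite ler_piMr ?(ltW e0)// ler_pdivrMr ?mul1r ?lerDl// ltr_wpDl.
exists U.
  apply: (ipcvg_unique hip (Ucvg 0 (lexx _))) => e e0; exists 0%N => k _.
  by rewrite left_primitive0 subrr ipnorm0// ltW.
move=> t e t0 e0; have [d d0 [k0 H]] := left_primitive_incr uc t0 e0.
exists d => // a s b a0 as_ sb bt bad.
have b0 : 0 <= b by lra.
have cv := ipcvgD hip (ipcvgD hip (Ucvg b b0) (ipcvgZ hip (-1) (Ucvg a a0)))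
  (ipcvg_cst hip (- ((b - a)%:C *: u s))).
rewrite -[- U a]scaleN1r; apply: (ipcvg_le0 hip cv).
by exists k0 => k kk; rewrite scaleN1r; exact: H.
Qed.

(** Pointwise derivatives give no uniform modulus. So du is integrated to U, the difference U - u
    has zero derivative and is constant, and u inherits the uniform estimate of U. *)
Lemma deriv_within_primitive u du : ucontinuous_ge0 (ip := ip) du ->
  (forall t, 0 <= t -> deriv_within (ip := ip) u t (du t)) -> primitive (ip := ip) du u.
Proof.
move=> duc udu; have [U U0 PU] := primitive_exists duc.
suff H t : 0 <= t -> U t - U 0 = u t - u 0 by exact: primitive_eq H PU.
move=> t0; apply/subr0_eq/(ipnorm_le0 hip).
(* Composing with the 1-Lipschitz map m extends G to the whole line with zero derivative everywhere,
   including at 0, where G has only a one-sided derivative. *)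
pose G s := U s - u s; pose m s : R := Num.max 0 s.
have m0 s : 0 <= m s by rewrite le_max lexx.
set v := (X in N X).
have vE : v = G t - G 0 by rewrite /v subrACA.
(* Testing against v = G t - G 0 itself gives f t - f 0 = |v|^2. *)
pose f s : R := Re (ip (G (m s)) v).
have Gd s e : 0 <= s -> 0 < e -> exists2 d, 0 < d & forall h, 0 <= s + h -> `|h| < d ->
    N (G (s + h) - G s) <= e * `|h|.
  move=> s0 e0; have e2 : 0 < e / 2 by rewrite divr_gt0.
  have [d1 d10 H1] := udu s s0 _ e2.
  have [d2 d20 H2] := PU (s + 1) _ (ltac:(lra)) e2.
  exists (Num.min (Num.min d1 d2) 1) => [|h sh]; first by rewrite !lt_min d10 d20 ltr01.
  rewrite !lt_min => /andP[/andP[hd1 hd2] h1].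
  have [->|h0] := eqVneq h 0; first by rewrite addr0 subrr ipnorm0// normr0 mulr0.
  have K1 := H1 h h0 sh hd1.
  have K2 : N (U (s + h) - U s - h%:C *: du s) <= e / 2 * `|h|.
    have [hp|hn] := lerP 0 h.
      move: hd2 h1; rewrite ger0_norm// => hd2 h1.
      have := H2 s s (s + h) s0 (lexx _).
      by rewrite (addrC s h) addrK; apply; lra.
    move: hd2 h1; rewrite ltr0_norm// => hd2 h1.
    have := H2 (s + h) s s sh (ltac:(lra)) (lexx _) (ltac:(lra)).
    have -> : s - (s + h) = - h by ring.
    move=> /(_ hd2); rewrite rmorphN scaleNr opprK -ipnormN// opprD opprB.
    by [].
  have -> : G (s + h) - G s = (U (s + h) - U s - h%:C *: du s) - (u (s + h) - u s - h%:C *: du s).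
    by rewrite /G subrACA (opprB (u (s + h) - u s)) subrKA.
  have := ipnormB hip (U (s + h) - U s - h%:C *: du s) (u (s + h) - u s - h%:C *: du s).
  by move: K1 K2; move: (N _) (N _) (N _) => *; lra.
have fd (x : R) : is_derive x (1 : R) f 0.
  suff fx : (h^-1 *: (f (h + x) - f x)) @[h --> (0 : R)^'] --> (0 : R).
    have Hs : (fun h : R => h^-1 *: ((f \o shift x) (h *: (1 : R)) - f x)) =
              (fun h : R => h^-1 *: (f (h + x) - f x)).
      by apply/funext => h /=; rewrite /GRing.scale /= mulr1.
    apply: DeriveDef; first by rewrite /derivable Hs; apply/cvg_ex; exists 0.
    by rewrite /derive Hs; apply: cvg_lim.
  apply/cvgrPdist_le => e e0; have v1 : 0 < N v + 1 by rewrite ltr_wpDl ?ipnorm_ge0.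
  have [d d0 Hd] := Gd (m x) _ (m0 x) (divr_gt0 e0 v1).
  rewrite near_withinE near_simpl; exists d => //= h; rewrite /ball_ /= !sub0r !normrN => hd h0.
  rewrite normrM normfV ler_pdivrMl ?normr_gt0// /f -ReB -ipBl//.
  rewrite (le_trans (abs_Re_normc _))// (le_trans (ip_le hip _ _))//.
  pose h' := m (h + x) - m x.
  have mE : m (h + x) = m x + h' by rewrite /h' subrKC.
  have h'h : `|h'| <= `|h|.
    rewrite /h' /m /Num.max; case: ltP => H1; case: ltP => H2.
    - by rewrite addrK.
    - rewrite subr0 !ger0_norm; lra.
    - rewrite sub0r normrN gtr0_norm// ler0_norm; lra.
    - by rewrite subrr normr0.
  have := Hd h' (ltac:(by rewrite -mE)) (le_lt_trans h'h hd); rewrite -mE => K.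
  have c0 : 0 <= e / (N v + 1) by rewrite divr_ge0// ltW.
  rewrite (le_trans (ler_wpM2r (ipnorm_ge0 _ _) K))//.
  rewrite (le_trans (ler_wpM2r (ipnorm_ge0 _ _) (ler_wpM2l c0 h'h)))//.
  rewrite mulrAC mulrC ler_wpM2l// mulrAC ler_pdivrMr// ler_wpM2l ?ltW//.
  by rewrite ltrDl.
have := is_derive_0_is_cst t 0 fd; rewrite /f /m maxxx max_r//.
move=> /eqP; rewrite -subr_eq0 -ReB -ipBl// -vE -ipnorm_sqr// sqrf_eq0 => /eqP ->.
exact: lexx.
Qed.

End PrimitiveExistence.

(** * The abstract Cauchy problem *)

Section CauchyProblem.
Context {R : realType} {E : lmodType R[i]} {ip : E -> E -> R[i]}.
Context {K : R} {n1 : nat} {A : E -> E -> Prop}.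
Hypotheses (hip : hilbert_ip ip) (hA : parabolic ip K n1 A).
Local Notation N := (ipnorm ip).
Local Notation nu n := (@rate R n1 n).
Local Notation om := (@sector_shift R K).
Local Notation Mc := (@stab_const R K).
Local Notation J := (resolvent hA).
Local Notation Y := (yosida hA).
Local Notation T := (orbit hA).
Local Notation primitive := (primitive (ip := ip)).
Local Notation ucontinuous_ge0 := (ucontinuous_ge0 (ip := ip)).
Implicit Types (x y w : E) (u U W : R -> E) (a b d e s t rho : R).

Lemma orbitD_real s t x : 0 <= s -> 0 <= t -> T (s + t)%:C x = T s%:C (T t%:C x).
Proof.
rewrite le_eqVlt => /predU1P[<- _|s0]; first by rewrite add0r orbit0.
rewrite le_eqVlt => /predU1P[<-|t0]; first by rewrite addr0 orbit0.
by rewrite rmorphD; apply: orbitD.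
Qed.

Lemma orbit_le_real s rho x : 0 <= s -> s <= rho -> N (T s%:C x) <= Mc 1 rho * N x.
Proof.
move=> s0 sr; apply: (orbit_le hip hA) => //.
by split; rewrite normc_real ger0_norm// mul1r.
Qed.

Lemma orbit_ucontinuous x : ucontinuous_ge0 (fun s => T s%:C x).
Proof.
move=> t e t0 e0; have M0 := @stab_const_gt0 R K 1 t.
have [d d0 H] := orbit_small hip hA x ltr01 (divr_gt0 e0 M0); exists d => //.
have key a s : 0 <= a -> a <= s -> s <= t -> `|a - s| < d -> N (T a%:C x - T s%:C x) <= e.
  move=> a0 as_ st asd; have -> : s = a + (s - a) by rewrite subrKC.
  have sa : 0 <= s - a by rewrite subr_ge0.
  rewrite orbitD_real//.
  have -> : T a%:C x - T a%:C (T (s - a)%:C x) = T a%:C (x - T (s - a)%:C x).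
    by rewrite linearB.
  rewrite (le_trans (orbit_le_real _ a0 (le_trans as_ st)))// mulrC -ler_pdivlMr//.
  rewrite ipnormC//; apply: H; rewrite normc_real ger0_norm ?mul1r//.
  by move: asd; rewrite distrC ger0_norm// => /ltW.
move=> a s /andP[a0 at_] /andP[s0 st] asd.
have [as_|/ltW sa] := leP a s; first exact: key.
by rewrite ipnormC//; apply: key => //; rewrite distrC.
Qed.

(** Only the right derivative at 0 is known; the semigroup law transports it to a, and boundedness
    of T on [0, t] makes it uniform. *)
Lemma orbit_primitive x w : A x w ->
  primitive (fun s => T s%:C w) (fun s => - T s%:C x).
Proof.
move=> Ax t e t0 e0; have M0 := @stab_const_gt0 R K 1 t; have e2 : 0 < e / 2 by rewrite divr_gt0.
have [d1 d10 H1] := orbit_deriv0 hip hA Ax (divr_gt0 e2 M0).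
have [d2 d20 H2] := orbit_ucontinuous w t0 e2.
exists (Num.min d1 d2) => [|a s b a0 as_ sb bt]; first by rewrite lt_min d10.
rewrite lt_min => /andP[bd1 bd2].
have : a <= b by exact: le_trans sb.
rewrite le_eqVlt => /predU1P[<-|ab].
  by rewrite !subrr scale0r subr0 ipnorm0// mulr0.
have ba0 : 0 < b - a by rewrite subr_gt0.
have bE : b = a + (b - a) by rewrite subrKC.
have -> : - T b%:C x - - T a%:C x - (b - a)%:C *: T s%:C w =
   - T a%:C (T (b - a)%:C x - x + (b - a)%:C *: w)
   + (b - a)%:C *: (T a%:C w - T s%:C w).
  rewrite (linearD (T a%:C)) (linearB (T a%:C)) /= (linearZ_LR (T a%:C)) /= scalerBr.
  by rewrite -orbitD_real ?(ltW ba0)// -bE [in RHS]opprD [RHS]addrA subrK [in RHS]opprD.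
rewrite (le_trans (ipnormD hip _ _))// ipnormN// ipnormZ// normc_real gtr0_norm//.
have L1 := orbit_le_real (T (b - a)%:C x - x + (b - a)%:C *: w) a0 (le_trans (ltW ab) bt).
have {}H1 := H1 _ ba0 (ltW bd1).
have {}H2 : N (T a%:C w - T s%:C w) <= e / 2.
  apply: H2; rewrite ?a0 ?(le_trans as_) ?(le_trans sb) ?(le_trans a0)//.
  rewrite distrC ger0_norm ?subr_ge0//; lra.
have {}L1 : N (T a%:C (T (b - a)%:C x - x + (b - a)%:C *: w)) <= (b - a) * (e / 2).
  by rewrite (le_trans L1)// mulrC -ler_pdivlMr// (le_trans H1)// !mulrA.
move: H2; rewrite -(ler_pM2l ba0); move: L1; move: (N _) (N _) => *; lra_let.
Qed.

(** As x need not be in the domain, J 0 is applied first: Y 0 U and - T (J 0 x) are both primitives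
    of T (Y 0 x), so Y 0 (U t) = J 0 (x - T t x), and [parabolic_resolventP] turns this back into
    the graph. *)
Lemma orbit_integral x U : U 0 = 0 -> primitive (fun s => T s%:C x) U ->
  forall t, 0 <= t -> A (U t) (x - T t%:C x).
Proof.
move=> U0 PU t t0; apply/(parabolic_resolventP hip hA 0).
have YL : forall (c : R[i]) y y', Y 0 (c *: y + y') = c *: Y 0 y + Y 0 y'.
  by move=> c y y'; rewrite linearP.
have P1 := primitive_lin YL (yosida_le hip hA 0) PU.
have P2 := orbit_primitive (yosidaP hA 0 x).
have YT s : Y 0 (T s%:C x) = T s%:C (Y 0 x).
  by rewrite /yosida linearZ_LR /= (linearB (T s%:C)) /= orbit_resolvent.
have {}P1 : primitive (fun s => T s%:C (Y 0 x)) (fun s => Y 0 (U s)).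
  by move=> r e r0 e0; have [d d0 H] := P1 r e r0 e0; exists d => // a s b *; rewrite -YT; exact: H.
have Y00 : Y 0 0 = 0 by exact: linear0.
have YU : Y 0 (U t) = J 0 (x - T t%:C x).
  have := primitive_unique hip P1 P2 t0; rewrite U0 Y00 subr0 orbit0 opprK (orbit_resolvent hip) => ->.
  by rewrite (linearB (J 0)) addrC.
rewrite (linearD (J 0)) (linearZ_LR (J 0)) /= -YU /yosida scalerA -rmorphM /=.
by rewrite mulVf ?gt_eqF ?(rate_gt0 hA)// scale1r subrKC.
Qed.

(* The primitive property makes each step from [a] to [b] an implicit Euler step
   up to o(b - a), and implicit Euler steps are stable because A + om is
   accretive. *)
Lemma evolution_zero W (w : R -> E) : primitive w W -> W 0 = 0 ->
  (forall t, 0 <= t -> A (W t) (- w t)) -> forall t, 0 <= t -> W t = 0.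
Proof.
move=> PW W0 AW t t0; apply: (ipnorm_le0 hip); apply/ler_addgt0Pr => e0' e0'0.
have o0 : 0 <= om 1 by exact: sector_shift_ge0.
(* Defects e eta per step, amplified by at most exp (2 om t), add up to e exp (2 om t) t <= e c. *)
pose c : R := expR (2 * om 1 * t) * t + 1.
have c0 : 0 < c by rewrite ltr_wpDl// mulr_ge0// expR_ge0.
pose e := e0' / c; have e0 : 0 < e by rewrite divr_gt0.
have [d d0 H] := PW t e t0 e0.
have o1 : 0 < 2 * (om 1 + 1) by rewrite mulr_gt0// ltr_wpDl.
have m0 : 0 < Num.min d (1 / (2 * (om 1 + 1))) by rewrite lt_min d0 divr_gt0.
have [n] := mesh_exists t0 m0.
set eta := t / n.+1%:R; rewrite lt_min => /andP[etad eta1].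
have eta0 : 0 <= eta by rewrite divr_ge0.
have {}eta1 : om 1 * eta <= 1 / 2.
  by move: eta1; rewrite ltr_pdivlMr//; move: (om 1) o0 => o o0; nra.
(* q bounds the implicit Euler factor 1 / (1 - om eta), because om eta <= 1 / 2. *)
pose q : R := 1 + 2 * om 1 * eta; have q1 : 1 <= q by rewrite lerDl; apply: mulr_ge0 => //; exact: mulr_ge0.
have step a b : 0 <= a -> b <= t -> b - a = eta -> N (W b) <= q * (N (W a) + e * eta).
  move=> a0 bt bE; have ab : a <= b by rewrite -subr_ge0 bE.
  have := H a b b a0 ab (lexx _) bt; rewrite bE => /(_ etad) Hr.
  have b0 : 0 <= b by exact: le_trans ab.
  have := parabolic_Re hA (AW b b0); rewrite ipNl// ReN => Hacc.
  set r := W b - W a - eta%:C *: w b in Hr.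
  have Wb : Re (ip (W b) (W b)) = Re (ip (W a + r) (W b)) + eta * Re (ip (w b) (W b)).
    by rewrite -ReZ -(ipZl hip) -ReD -ipDl// /r addrA subrKC subrK.
  have H1 := Reip_le hip (W a + r) (W b); have H2 := ipnormD hip (W a) r.
  have H3 : N (W b) * ((1 - om 1 * eta) * N (W b)) <= N (W b) * (N (W a) + e * eta).
    move: Wb; rewrite -ipnorm_sqr// => Wb.
    have H4 : eta * Re (ip (w b) (W b)) <= eta * (om 1 * N (W b) ^+ 2).
      by rewrite ler_wpM2l// -lerN2.
    have H5 : N (W a + r) * N (W b) <= (N (W a) + e * eta) * N (W b).
      by rewrite ler_wpM2r ?ipnorm_ge0//; lra_let.
    move: Wb H1 H4 H5; move: (Re _) (Re _) (N (W b)) (N (W a)) (N (W a + r)) => *.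
    lra_let.
  have H6 : (1 - om 1 * eta) * N (W b) <= N (W a) + e * eta.
    have [->|Wb0] := eqVneq (N (W b)) 0.
      by rewrite mulr0 addr_ge0 ?ipnorm_ge0// mulr_ge0// ltW.
    by move: H3; rewrite ler_pM2l// lt_neqAle eq_sym Wb0 ipnorm_ge0.
  rewrite (@le_trans _ _ (q * ((1 - om 1 * eta) * N (W b))))//; last first.
    by rewrite ler_wpM2l// (le_trans ler01).
  rewrite mulrA -[leLHS]mul1r ler_wpM2r ?ipnorm_ge0// /q.
  have : 0 <= om 1 * eta by rewrite mulr_ge0.
  rewrite -(mulrA 2); move: (om 1 * eta) eta1 => p p1 p0; nra.
have iter_le i : (i <= n.+1)%N -> N (W (gridpt t n i)) <= q ^+ i * (i%:R * (e * eta)).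
  elim: i => [|i IH] ni; first by rewrite gridpt0 W0 ipnorm0// mul0r mulr0.
  have := step _ _ (gridpt_ge0 n i t0) (gridpt_le t0 ni) (gridptS t n i).
  move=> /le_trans; apply; rewrite exprS -mulrA ler_wpM2l ?(le_trans ler01)//.
  have qi : 1 <= q ^+ i by rewrite exprn_ege1.
  have ee : 0 <= e * eta by rewrite mulr_ge0// ltW.
  rewrite mulrS mulrDl mul1r mulrDr addrC lerD ?IH ?(ltnW ni)//.
  by rewrite ler_peMl.
have := iter_le n.+1 (leqnn _); rewrite gridpt_end => /le_trans; apply.
have -> : n.+1%:R * (e * eta) = e * t.
  by rewrite mulrCA /eta [_ * (t / _)]mulrC divfK// pnatr_eq0.
have qe : q ^+ n.+1 <= expR (2 * om 1 * t).
  have -> : 2 * om 1 * t = n.+1%:R * (2 * om 1 * eta).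
    have tE : t = eta * n.+1%:R by rewrite /eta divfK// pnatr_eq0.
    by rewrite [in LHS]tE mulrA mulrC.
  rewrite expRM_natl; apply: lerXn2r; rewrite ?nnegrE ?expR_ge0 ?(le_trans ler01)//.
  exact: expR_ge1Dx.
have et : 0 <= e * t by rewrite mulr_ge0// ltW.
rewrite add0r (le_trans (ler_wpM2r et qe))// /e mulrCA mulrAC ler_pdivrMr//.
by rewrite ler_wpM2l ?(ltW e0'0)// lerDl.
Qed.

End CauchyProblem.

(** The constants fit the maximum norm of a product against its Euclidean norm, with the square root
    of 2 rounded up to 2. *)
Record norm_comparable (R : realType) (E : normedModType R[i]) (ip : E -> E -> R[i]) :
    Prop := NormComparable {
  norm_le_ip : forall x : E, `|x| <= (ipnorm ip x)%:C;
  ip_le_norm : forall x : E, (ipnorm ip x)%:C <= 2 * `|x| }.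

(** * Translation between the norm of the form and the library topology *)

Section Topology.
Context {R : realType} {E : normedModType R[i]} {ip : E -> E -> R[i]}.
Hypotheses (hip : hilbert_ip ip) (hn : norm_comparable ip).
Local Notation N := (ipnorm ip).
Implicit Types (x y w : E) (u U : R -> E) (a b d e s t : R).

(** Radii and tolerances of the library live in R[i]; this recovers a real one. *)
Lemma gt0_complexE (z : R[i]) : 0 < z -> z = (Re z)%:C /\ 0 < Re z.
Proof. by case: z => p q; rewrite ltcE /= => /andP[/eqP ->]. Qed.

Lemma norm_lt_ip x e : N x < e -> `|x| < e%:C.
Proof. by move=> xe; rewrite (le_lt_trans (norm_le_ip hn x))// ltcR. Qed.

Lemma ip_le_norm_real x e : `|x| <= e%:C -> N x <= 2 * e.
Proof.
move=> xe; rewrite -lecR (le_trans (ip_le_norm hn x))// rmorphM /=.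
by rewrite (_ : 2%:C = 2 :> R[i]) ?rmorph_nat// ler_wpM2l.
Qed.

Lemma bounded_op_ip (f : E -> E) (M : R) : 0 <= M ->
  (forall x, N (f x) <= M * N x) -> bounded_op f.
Proof.
move=> M0 fM; exists (M%:C * 2) => x; rewrite (le_trans (norm_le_ip hn _))//.
rewrite -mulrA (le_trans _ (ler_wpM2l _ (ip_le_norm hn x))) ?lecR//.
by rewrite -rmorphM lecR.
Qed.

Lemma cvg_ip {I : Type} (F : set_system I) {FF : Filter F} (f : I -> E) (l : E) :
  f @ F --> l <-> forall e, 0 < e -> \forall i \near F, N (f i - l) <= e.
Proof.
rewrite cvgrPdist_le; split=> [H e e0|H z /gt0_complexE[-> z0]].
  have := H (e / 2)%:C; rewrite ltcR divr_gt0// => /(_ isT).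
  apply: filterS => i /ip_le_norm_real; rewrite ipnormC//.
  by rewrite mulrC divfK// pnatr_eq0.
apply: filterS (H _ z0) => i; rewrite ipnormC// => Hi.
by rewrite (le_trans (norm_le_ip hn _))// lecR.
Qed.

Lemma near_right0 (P : R -> Prop) :
  (\forall t \near (0 : R)^'+, P t) <->
  exists2 tau : R, 0 < tau & forall t, 0 < t -> t < tau -> P t.
Proof.
split=> [[d /= d0 H]|[tau tau0 H]].
  exists d => // t t0 td; apply: H => //=.
  by rewrite sub0r normrN gtr0_norm.
exists tau => //= t; rewrite /ball_ /= sub0r normrN => tt t0; apply: H => //.
by rewrite -(gtr0_norm t0).
Qed.

Lemma continuous_RplusP u : continuous_Rplus u <-> continuous_ge0 (ip := ip) u.
Proof.
rewrite /continuous_Rplus subspace_continuousP; split=> [H t e t0 e0|H t].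
  have := H t; rewrite /= in_itv /= andbT => /(_ t0) /cvg_ip /(_ e e0)[d /= d0 {}H].
  exists d => // s s0 st; apply: H => /=; first by rewrite distrC.
  by rewrite in_itv /= s0.
rewrite /= in_itv /= andbT => t0; apply/cvg_ip => e e0; have [d d0 {}H] := H t e t0 e0.
exists d => //= s st; rewrite in_itv /= andbT => s0; apply: H => //.
by rewrite distrC.
Qed.

Lemma is_derive_RplusP u t w : is_derive_Rplus u t w <-> deriv_within (ip := ip) u t w.
Proof.
have E1 h : h != 0 -> N ((h^-1)%:C *: (u (t + h) - u t) - w) =
    `|h|^-1 * N (u (t + h) - u t - h%:C *: w).
  move=> h0; have -> : (h^-1)%:C *: (u (t + h) - u t) - w =
      (h^-1)%:C *: (u (t + h) - u t - h%:C *: w).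
    by rewrite [RHS]scalerBr scalerA -rmorphM /= mulVf// scale1r.
  by rewrite ipnormZ// normc_real normfV.
have E2 h e : h != 0 -> (`|h|^-1 * N (u (t + h) - u t - h%:C *: w) <= e) =
    (N (u (t + h) - u t - h%:C *: w) <= e * `|h|).
  by move=> h0; rewrite ler_pdivrMl ?normr_gt0// mulrC.
rewrite /is_derive_Rplus; split=> [/cvg_ip H e e0|H].
  have [d /= d0 {}H] := H e e0; exists d => // h h0 th hd; rewrite -E2// -E1//.
  by apply: H => //=; rewrite sub0r normrN.
apply/cvg_ip => e e0; have [d d0 {}H] := H e e0.
exists d => //= h; rewrite /ball_ /= sub0r normrN => hd h0 th; rewrite E1// E2//.
exact: H.
Qed.

Lemma primitive_deriv u U : primitive (ip := ip) u U ->
  forall t, 0 <= t -> deriv_within (ip := ip) U t (u t).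
Proof.
move=> PU t t0 e e0; have t1 : 0 <= t + 1 by rewrite addr_ge0.
have [d d0 H] := PU (t + 1) e t1 e0.
exists (Num.min d 1) => [|h h0 th]; first by rewrite lt_min d0 ltr01.
rewrite lt_min => /andP[hd h1].
have [hp|hn'] := lerP 0 h.
  move: hd h1; rewrite ger0_norm// => hd h1.
  have := H t t (t + h) t0 (lexx _); rewrite lerDl (addrC t h) addrK addrC.
  by apply=> //; lra.
move: hd h1; rewrite ltr0_norm// => hd h1.
have := H (t + h) t t th; rewrite lexx gerDl ltW// lerDl ler01.
have -> : t - (t + h) = - h by ring.
move=> /(_ isT isT isT hd); rewrite rmorphN scaleNr opprK.
by rewrite -ipnormN// opprD opprB.
Qed.

(** The intermediate point in [primitive] is exactly the tag of a Riemann sum, so every tagged cell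
    contributes an error proportional to its length. *)
Lemma primitive_Riemann u U t : 0 <= t -> primitive (ip := ip) u U ->
  Riemann_integral u 0 t (U t - U 0).
Proof.
move=> t0 PU e e0; have t1 : 0 < t + 1 by rewrite ltr_wpDl.
have [d d0 H] := PU t _ t0 (divr_gt0 e0 t1); exists d => // n x s x0 xn P.
have xmono i : (i < n)%N -> x i <= x i.+1.
  by move=> /P[/andP[p q] _]; exact: le_trans q.
have xge0 i : (i <= n)%N -> 0 <= x i.
  elim: i => [|i IH] ni; first by rewrite x0.
  by rewrite (le_trans (IH (ltnW ni)))// xmono.
have xle k : (k <= n)%N -> x (n - k)%N <= t.
  elim: k => [|k IH] nk; first by rewrite subn0 xn.
  rewrite (le_trans _ (IH (ltnW nk)))// -(subnSK nk) xmono//.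
  by rewrite ltn_subrL (leq_trans _ nk).
have xlet i : (i <= n)%N -> x i <= t.
  by move=> ni; have := xle (n - i)%N (leq_subr _ _); rewrite subKn.
have UE : U t - U 0 = \sum_(i < n) (U (x i.+1) - U (x i)).
  rewrite -(big_mkord xpredT (fun i => U (x i.+1) - U (x i))).
  by rewrite (telescope_sumr (fun i => U (x i)))// xn x0.
apply: norm_lt_ip; rewrite ipnormC// UE -sumrB.
have tE : t = \sum_(i < n) (x i.+1 - x i).
  rewrite -(big_mkord xpredT (fun i => x i.+1 - x i)).
  by rewrite (telescope_sumr x)// xn x0 subr0.
apply: (@le_lt_trans _ _ (e / (t + 1) * t)).
  rewrite (le_trans (ipnorm_sum hip _ _ _))// [X in _ <= _ * X]tE mulr_sumr.
  apply: ler_sum => i _; have [/andP[p q] r] := P _ (ltn_ord i).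
  by apply: H => //; [exact: xge0 (ltnW (ltn_ord i))|exact: xlet].
rewrite mulrAC ltr_pdivrMr// ltr_pM2l// ltrDl//.
Qed.

Lemma Riemann_unique u t w w' : 0 <= t ->
  Riemann_integral u 0 t w -> Riemann_integral u 0 t w' -> w = w'.
Proof.
move=> t0 uw uw'; apply/subr0_eq/normr0_eq0/eqP; rewrite eq_le normr_ge0 andbT.
apply/ler_addgt0Pr => z /gt0_complexE[-> z0]; rewrite add0r.
have z2 : 0 < Re z / 2 by rewrite divr_gt0.
have [d1 d10 H1] := uw _ z2; have [d2 d20 H2] := uw' _ z2.
have d0 : 0 < Num.min d1 d2 by rewrite lt_min d10.
have [n] := mesh_exists t0 d0; rewrite lt_min => /andP[n1 n2].
pose x := gridpt t n.
have step d : t / n.+1%:R < d -> forall i, (i < n.+1)%N ->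
    x i <= x i <= x i.+1 /\ x i.+1 - x i < d.
  by move=> nd i _; rewrite gridptS lexx -subr_ge0 gridptS divr_ge0.
have {}H1 := H1 n.+1 x x (gridpt0 t n) (gridpt_end t n) (step _ n1).
have {}H2 := H2 n.+1 x x (gridpt0 t n) (gridpt_end t n) (step _ n2).
move: H1 H2; set S := \sum_(i < _) _ => H1 H2.
rewrite -(subrKA S) (le_trans (ler_normD _ _))// distrC.
rewrite -[Re z](@mulfVK _ 2)// -[_ * 2]/(_ * (1 + 1)) mulrDr mulr1 rmorphD /=.
by rewrite lerD// ltW.
Qed.

End Topology.

Section Sectors.
Context {R : realType}.
Implicit Types (z : R[i]).

(** Cosine decreases on [0, pi], so an angle theta below pi / 2 has the positive aperture d = cos
    theta. *)
Lemma sector_region (theta : R) z : 0 < theta < pi / 2 -> sector theta z ->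
  cos theta * normc z <= Re z.
Proof.
move=> /andP[th0 th1] [r [phi [r0 phit ->]]] /=.
have -> : Num.sqrt ((r * cos phi) ^+ 2 + (r * sin phi) ^+ 2) = r.
  by rewrite !exprMn -mulrDr cos2Dsin2 mulr1 sqrtr_sqr gtr0_norm.
rewrite mulrC ler_wpM2l ?(ltW r0)//.
have -> : cos phi = cos `|phi|.
  by case: (ger0P phi) => _; rewrite ?cosN.
have thpi : theta < pi.
  by rewrite (lt_trans th1)// ltr_pdivrMr// ltr_pMr ?pi_gt0// ltr1n.
by apply: ltW; rewrite ltr_cos// in_itv /= ?(ltW th0) ?(ltW thpi)// normr_ge0 ltW// (lt_trans phit).
Qed.

Lemma sector_halfplane z : sector (pi / 2) z -> 0 < Re z.
Proof.
move=> [r [phi [r0 + ->]]] /=; rewrite ltr_norml => H.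
by rewrite mulr_gt0// cos_gt0_pihalf.
Qed.

Lemma near0_complex (P : R[i] -> Prop) (tau : R) : 0 < tau ->
  (forall z, normc z < tau -> P z) -> \forall z \near (0 : R[i]^o), P z.
Proof.
move=> tau0 H; apply/nbhs_ballP; exists tau%:C => /=; first by rewrite ltcR.
by move=> z; rewrite /ball /= sub0r normrN normcE ltcR => /H.
Qed.

End Sectors.

(** * Generation and well-posedness for parabolic operators *)

Section ParabolicOperators.
Context {R : realType} {E : normedModType R[i]} {ip : E -> E -> R[i]}.
Context {K : R} {n1 : nat} {A : E -> E -> Prop}.
Hypotheses (hip : hilbert_ip ip) (hn : norm_comparable ip) (hA : parabolic ip K n1 A).
Local Notation N := (ipnorm ip).
Local Notation Mc := (@stab_const R K).
Local Notation J := (resolvent hA).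
Local Notation T := (orbit hA).
Local Notation primitive := (primitive (ip := ip)).
Implicit Types (x y w : E) (z : R[i]) (u U : R -> E) (a b d e s t : R).

Lemma semigroup_op_analytic : analytic_semigroup (pi / 2) (semigroup_op hip hA).
Proof.
split=> [z /sector_halfplane z0|x|z z' x /sector_halfplane z0 /sector_halfplane z0'
  |z /sector_halfplane z0|theta x th].
- have [d0 zd] := in_sector_self z0.
  apply: (bounded_op_ip hn (ltW (stab_const_gt0 (K := K) _ _))) => x.
  exact: orbit_le d0 zd.
- exact: orbit0.
- exact: orbitD.
- have [T' [C [C' [r [r0 C0 T'C H]]]]] := orbit_differentiable hip hA z0.
  exists T'.
    apply: (bounded_op_ip hn (normr_ge0 C')) => x; rewrite (le_trans (T'C x))//.
    by rewrite ler_wpM2r ?ipnorm_ge0// ler_norm.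
  move=> e e0; have c0 : 0 < 2 * C + 1 by rewrite ltr_wpDl// mulr_ge0.
  have m0 : 0 < Num.min r (e / (2 * C + 1)) by rewrite lt_min r0 divr_gt0.
  rewrite near_withinE; apply: (near0_complex m0) => h.
  rewrite lt_min => /andP[/ltW hr he] h0 x.
  have [_ /(_ x) Hx] := H h h0 hr; rewrite (le_trans (norm_le_ip hn _))//.
  rewrite (@le_trans _ _ (C * normc h * N x)%:C) ?lecR// rmorphM /=.
  have Ch : 0 <= C * normc h by rewrite mulr_ge0 ?normc_ge0.
  rewrite (le_trans (ler_wpM2l _ (ip_le_norm hn x))) ?ler0c//.
  rewrite mulrA ler_wpM2r// natrC -rmorphM lecR.
  move: he; rewrite ltr_pdivlMr//; have := normc_ge0 h; lra.
- apply/(cvg_ip hip hn) => e e0; have /andP[th0 th1] := th.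
  have c0 : 0 < cos theta.
    by rewrite cos_gt0_pihalf// th1 andbT (lt_trans _ th0)// oppr_lt0 divr_gt0// pi_gt0.
  have [tau tau0 H] := orbit_small hip hA x c0 e0.
  rewrite near_withinE; apply: (near0_complex tau0) => z zt zs.
  by apply: H; [exact: sector_region|exact: ltW].
Qed.

Lemma semigroup_op_generator : is_generator (semigroup_op hip hA) (neg_op A).
Proof.
move=> x z; rewrite /neg_op; split=> [Az|/(cvg_ip hip hn) H].
  apply/(cvg_ip hip hn) => e e0; apply/near_right0.
  have [tau tau0 H] := orbit_deriv0 hip hA Az e0; exists tau => // t t0 /ltW tt.
  have := H t t0 tt; rewrite scalerN.
  have -> : (t^-1)%:C *: (semigroup_op hip hA t%:C x - x) - z =
     (t^-1)%:C *: (T t%:C x - x - t%:C *: z).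
    by rewrite [RHS]scalerBr scalerA -rmorphM /= mulVf ?gt_eqF// scale1r.
  by rewrite ipnormZ// normc_real gtr0_norm ?invr_gt0// ler_pdivrMl.
apply: (@orbit_deriv0_domain _ _ _ _ _ _ hip hA x z) => e e0; have /near_right0[tau tau0 {}H] := H e e0.
exists (tau / 2) => [|t t0 tt]; first by rewrite divr_gt0.
by apply: H => //; lra.
Qed.

Theorem parabolic_generates : generates_analytic_semigroup (pi / 2) (neg_op A).
Proof.
exists (semigroup_op hip hA); [exact: semigroup_op_analytic|exact: semigroup_op_generator].
Qed.

Lemma ucontinuous_continuous u : ucontinuous_ge0 (ip := ip) u -> continuous_Rplus u.
Proof.
move=> uc; apply/(continuous_RplusP hip hn) => t e t0 e0.
have t1 : 0 <= t + 1 by rewrite addr_ge0.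
have [d d0 H] := uc (t + 1) e t1 e0.
exists (Num.min d 1) => [|s s0]; first by rewrite lt_min d0 ltr01.
rewrite lt_min => /andP[sd s1]; apply: H => //; apply/andP; split=> //.
  by move: s1; rewrite ltr_norml => /andP[]; lra.
by rewrite lerDl.
Qed.

Lemma continuous_ucontinuous u : continuous_Rplus u -> ucontinuous_ge0 (ip := ip) u.
Proof. by move=> /(continuous_RplusP hip hn); exact: heine. Qed.

Theorem parabolic_mild x : exists_unique_solution (mild_solution A) x.
Proof.
have orbitc := ucontinuous_continuous (orbit_ucontinuous hip hA x).
exists (fun s => T s%:C x) => [|u [u0 uc uI] t t0].
  split=> [|//|t t0]; first exact: orbit0.
  have [U U0 PU] := primitive_exists hip (orbit_ucontinuous hip hA x).
  exists (U t), (x - T t%:C x); split.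
  - by have := primitive_Riemann hip hn t0 PU; rewrite U0 subr0.
  - by have := orbit_integral hip U0 PU t0.
  - by rewrite orbit0 opprB subrKC.
have [U U0 PU] := primitive_exists hip (orbit_ucontinuous hip hA x).
have [U' U'0 PU'] := primitive_exists hip (continuous_ucontinuous uc).
have AU' s : 0 <= s -> A (U' s) (x - u s).
  move=> s0; have [I [AI [RI AIP ->]]] := uI s s0.
  rewrite u0 opprB subrKC.
  have := primitive_Riemann hip hn s0 PU'; rewrite U'0 subr0 => RU.
  by rewrite -(Riemann_unique s0 RI RU).
(* A mild solution need not take values in the domain but its primitive does, so [evolution_zero] is
   applied to the difference of primitives. *)
have PW := primitiveB hip PU' PU.
have AW s : 0 <= s -> A (U' s - U s) (- (u s - T s%:C x)).
  move=> s0; have := parabolic_sub hA (AU' s s0) (orbit_integral hip U0 PU s0).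
  by rewrite (opprB x) [x - u s + _]addrC subrKA opprB.
have W00 : U' 0 - U 0 = 0 by rewrite U0 U'0 subrr.
have W0 := evolution_zero hip hA PW W00 AW t0.
(* The difference of the primitives is zero at t, and A sends it to the opposite of the difference
   of the solutions, which thus vanishes. *)
have := AW t t0; rewrite W0 => /(par_fun hA)/eqP.
by rewrite oppr_eq0 subr_eq0 => /eqP.
Qed.

(** An orbit that starts in the domain stays there by [orbit_graph]. For uniqueness the difference
    of two solutions itself serves as [W] in [evolution_zero], since [deriv_within_primitive] makes
    its derivative uniform. *)
Theorem parabolic_classical x w : A x w ->
  exists_unique_solution (classical_solution A) x.
Proof.
move=> Ax; exists (fun s => T s%:C x).
  split; first exact: orbit0.
  exists (fun s => - T s%:C w), (fun s => T s%:C w).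
  have wc := orbit_ucontinuous hip hA w.
  have P := orbit_primitive hip hA Ax.
  have P' : primitive (fun s => - T s%:C w) (fun s => T s%:C x).
    move=> t e t0 e0; have [d d0 H] := P t e t0 e0; exists d => // a s b a0 as_ sb bt bd.
    have := H a s b a0 as_ sb bt bd; rewrite -ipnormN// scalerN.
    by rewrite !opprD !opprK.
  split=> [|||t t0].
  - exact/ucontinuous_continuous/orbit_ucontinuous.
  - apply: ucontinuous_continuous => t e t0 e0; have [d d0 H] := wc t e t0 e0.
    by exists d => // a s at_ st asd; rewrite -opprD ipnormN//; exact: H.
  - exact: ucontinuous_continuous.
  - split; last by rewrite addNr.
      by apply/(is_derive_RplusP hip hn); exact: (primitive_deriv hip P').
    exact: orbit_graph.
move=> u [u0 [du [Au [uc duc Auc H]]]] t t0.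
have Pu : primitive du u.
  apply: (deriv_within_primitive hip (continuous_ucontinuous duc)) => s s0.
  by apply/(is_derive_RplusP hip hn); have [] := H s s0.
have P := orbit_primitive hip hA Ax.
have PW : primitive (fun s => du s + T s%:C w) (fun s => u s - T s%:C x).
  have L : forall (c : R[i]) y y', - (c *: y + y') = c *: - y + - y' :> E.
    by move=> c y y'; rewrite opprD scalerN.
  have LN : forall y, N (- y) <= 1 * N y by move=> y; rewrite ipnormN// mul1r.
  have := primitiveB hip Pu (primitive_lin L LN P).
  by under eq_fun do rewrite opprK; under [X in primitive _ X]eq_fun do rewrite opprK.
have AW s : 0 <= s -> A (u s - T s%:C x) (- (du s + T s%:C w)).
  move=> s0; have [_ Aus duA] := H s s0.
  have := parabolic_sub hA Aus (orbit_graph hip hA s%:C Ax).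
  have -> : Au s = - du s by apply/eqP; rewrite -addr_eq0 addrC duA.
  by rewrite opprD.
have W00 : u 0 - T 0%:C x = 0 by rewrite u0 orbit0 subrr.
have W0 := evolution_zero hip hA PW W00 AW t0.
exact: subr0_eq.
Qed.

End ParabolicOperators.

(** * The damped wave equation *)

Section Spaces.
Context {R : realType} {H : hilbertType R}.

Lemma norm_RRe (U : normedModType R[i]) (x : U) : `|x| = (Re `|x|)%:C.
Proof. by rewrite RRe_real ?normr_real. Qed.

Lemma ipnorm_normE (U : normedModType R[i]) (ip : U -> U -> R[i]) (x : U) :
  ip x x = `|x| ^+ 2 -> `|x| = (ipnorm ip x)%:C.
Proof.
move=> xx; rewrite /ipnorm xx norm_RRe -rmorphXn /= sqrtr_sqr ger0_norm//.
by rewrite -ler0c -norm_RRe.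
Qed.

Lemma norm_inner (x : H) : `|x| = (ipnorm inner x)%:C.
Proof. exact/ipnorm_normE/inner_normE. Qed.

Lemma complete_cauchy_seq (U : completeNormedModType R[i]) (u : nat -> U) :
  (forall e : R, 0 < e -> exists n0, forall n m, (n0 <= n)%N -> (n0 <= m)%N ->
     `|u n - u m| <= e%:C) ->
  exists l, forall e : R, 0 < e -> exists n0, forall n, (n0 <= n)%N -> `|u n - l| <= e%:C.
Proof.
move=> uc; have /cauchy_cvgP ul : cauchy (u @ \oo).
  apply/cauchy_exP => z /gt0_complexE[-> z0].
  have [n0 H0] := uc (Re z / 2) (divr_gt0 z0 (ltr0Sn _ 1)).
  exists (u n0); exists n0 => // n nn; rewrite -ball_normE /=.
  rewrite (le_lt_trans (H0 _ _ (leqnn _) nn))// ltcR; lra.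
exists (lim (u @ \oo)) => e e0.
have /cvgrPdist_le/(_ e%:C) := ul; rewrite ltcR => /(_ e0)[n0 _ H0].
by exists n0 => n /H0; rewrite distrC.
Qed.

Lemma hilbert_inner : hilbert_ip (@inner R H).
Proof.
split=> [a u v w|u v|u u0|u uc].
- exact: inner_linearl.
- exact: innerC.
- exact: inner_gt0.
have [|l ul] := @complete_cauchy_seq H u.
  move=> e e0; have [n0 H0] := uc e e0; exists n0 => n m nn nm.
  by rewrite norm_inner lecR H0.
by exists l => e e0; have [n0 H0] := ul e e0; exists n0 => n /H0; rewrite norm_inner lecR.
Qed.

Local Notation N := (ipnorm (@inner R H)).
Local Notation hH := hilbert_inner.

Lemma self_adjoint_sym (S : unbounded_op H) u v : self_adjoint S -> dom S u -> dom S v ->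
  inner (S v) u = inner v (S u).
Proof. by move=> [_ /(_ u (S u))[+ _]] Su; apply. Qed.

(** The graph of S is that of its adjoint, which is defined by equations between inner products and
    these pass to the limit. *)
Lemma self_adjoint_closed (S : unbounded_op H) (u : nat -> H) l m : self_adjoint S ->
  (forall n, dom S (u n)) -> ipcvg inner u l -> ipcvg inner (fun n => S (u n)) m ->
  dom S l /\ S l = m.
Proof.
move=> Ssa uS ul Sum; have [_ /(_ l m)[_ adj]] := Ssa; apply: adj => v Sv.
apply/subr0_eq/eqP; rewrite -normc_eq0 eq_le normc_ge0 andbT.
apply/ler_addgt0Pr => e e0; rewrite add0r.
have c0 : 0 < N (S v) + N v + 1 by rewrite ltr_wpDl// addr_ge0 ?ipnorm_ge0.
have [n1 H1] := ul _ (divr_gt0 e0 c0); have [n2 H2] := Sum _ (divr_gt0 e0 c0).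
have {H1} := H1 _ (leq_maxl n1 n2); have {H2} := H2 _ (leq_maxr n1 n2).
set n := maxn n1 n2; rewrite !ler_pdivlMr// => H2 H1.
have -> : inner (S v) l - inner v m = inner v (S (u n) - m) - inner (S v) (u n - l).
  by rewrite !(ipBr hH) (self_adjoint_sym Ssa (uS n) Sv) opprB [RHS]addrC subrKA.
rewrite (le_trans (le_normcD _ _))// normcN.
have := ip_le hH v (S (u n) - m); have := ip_le hH (S v) (u n - l).
move: H1 H2; move: (ipnorm_ge0 inner (u n - l)) (ipnorm_ge0 inner (S (u n) - m)).
move: (ipnorm_ge0 inner v) (ipnorm_ge0 inner (S v)).
move: (N _) (N _) (N _) (N _) (normc _) (normc _) => p q r s f g p0 q0 r0 s0.
nra.
Qed.

(** * The energy space and its product with H *)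

Section Energy.
Context {B0 S : unbounded_op H}.
Hypotheses (B0_sa : self_adjoint B0) (B0_pos : strictly_positive B0) (B0S : is_sqrt B0 S).
Local Notation V := (energy_space B0_pos B0S).

Lemma B0_coercive : exists2 c : R, 0 < c & forall u, dom B0 u -> c * N u <= N (B0 u).
Proof.
have [c c0 Hc] := B0_pos; exists c => // u Bu.
have := Hc u Bu; rewrite norm_inner -rmorphXn -rmorphM /= lecE => /andP[_ /= H1].
have H2 := le_trans H1 (Reip_le hH (B0 u) u).
have [->|u0] := eqVneq (N u) 0; first by rewrite mulr0 ipnorm_ge0.
have Nu : 0 < N u by rewrite lt_neqAle eq_sym u0 ipnorm_ge0.
by rewrite -(ler_pM2r Nu) -mulrA -expr2.
Qed.

Lemma unbounded_opB (B : unbounded_op H) u v : dom B u -> dom B v ->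
  dom B (u - v) /\ B (u - v) = B u - B v.
Proof.
move=> Bu Bv; have -> : u - v = -1 *: v + u by rewrite scaleN1r addrC.
by split; [exact: domP|rewrite op_linear// scaleN1r addrC].
Qed.

(** Coercivity and closedness of the graph make the range closed; a vector orthogonal to it lies in
    the kernel of the adjoint, which is B0, and coercivity makes that kernel trivial. *)
Lemma B0_surjective f : exists2 u, dom B0 u & B0 u = f.
Proof.
have [c c0 Hc] := B0_coercive.
pose M := [set f | exists2 u, dom B0 u & B0 u = f].
suff : M f by [].
apply: (closed_submod_full hH) => [|g gM].
  split=> [|a x y [u Bu <-] [v Bv <-]|x l xM xl].
  - by exists 0; [exact: dom0|exact: op_at0].
  - by exists (a *: u + v); [exact: domP|rewrite op_linear].
  have /choice[u uP] : forall n, exists u, dom B0 u /\ B0 u = x n.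
    by move=> n; have [u ? ?] := xM n; exists u.
  have ucau : ipcauchy inner u.
    move=> e e0; have [n0 H0] := ipcvg_cauchy hH xl (mulr_gt0 c0 e0).
    exists n0 => n m nn nm; rewrite -(ler_pM2l c0).
    have [Bd BE] := unbounded_opB (uP n).1 (uP m).1.
    by rewrite (le_trans (Hc _ Bd))// BE (uP n).2 (uP m).2 H0.
  have [l' ul'] := hip_complete hH ucau.
  have [||Bl <-] := self_adjoint_closed B0_sa _ ul' (m := l).
  - by move=> n; exact: (uP n).1.
  - by move=> e e0; have [n0 H0] := xl e e0; exists n0 => n /H0; rewrite (uP n).2.
  by exists l'.
have [Bg B0g] : dom B0 g /\ B0 g = 0.
  apply/(B0_sa.2 g 0) => v Bv; rewrite (ip0r hH) (hip_conj hH) gM ?rmorph0//.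
  by exists v.
apply: (ipnorm_le0 hH); have := Hc g Bg.
by rewrite B0g (ipnorm0 hH) pmulr_rle0.
Qed.

Lemma energy_elem x : dom S x -> exists u : V, u = x :> H.
Proof.
move=> Sx; have xS : x \in dom_pred S by rewrite inE.
by exists (EnergySpace B0_pos B0S xS).
Qed.

(** If B0 u = x, then S u is a preimage, since B0 = S S. Hence S is an isometry of V onto H, through
    which V inherits completeness. *)
Lemma energy_op_surjective x : exists u : V, S u = x.
Proof.
have [_ _ domB BE] := B0S; have [u Bu uE] := B0_surjective x.
have [Su SSu] := (domB u).1 Bu; have [v vE] := energy_elem SSu.
by exists v; rewrite vE -BE.
Qed.

Lemma to_H_inj (u v : V) : u = v :> H -> u = v.
Proof. exact: val_inj. Qed.

Lemma energy_opB (u v : V) : S (u - v : V) = S u - S v.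
Proof.
have [_ SE] := unbounded_opB (energy_dom u) (energy_dom v).
by rewrite -SE to_HD -[- v]scaleN1r to_HZ scaleN1r.
Qed.

Lemma energy_opP (a : R[i]) (u v : V) : S (a *: u + v : V) = a *: S u + S v.
Proof. by rewrite to_HD to_HZ op_linear//; exact: energy_dom. Qed.

Lemma energy_op_inj (u v : V) : S u = S v -> u = v.
Proof.
move=> Suv; apply/subr0_eq/normr0_eq0.
by rewrite -[LHS]/(`|S (u - v : V)|) energy_opB Suv subrr normr0.
Qed.

Lemma ipnorm_V (u : V) : ipnorm (inner_V (B0_pos:=B0_pos) (B0S:=B0S)) u = N (S u).
Proof. by []. Qed.

Lemma norm_V (u : V) : `|u| = (N (S u))%:C.
Proof. by rewrite -ipnorm_V; apply/ipnorm_normE/inner_V_normE. Qed.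

(** If B0 g = S u then u = S g, so |u|^2 = (B0 g | g) = (S u | g) <= |S u|^2 / c. The constant c^-1
    + 1 avoids a square root, its square being at least c^-1. *)
Lemma embedding : exists2 C : R, 0 <= C & forall u : V, N (u : H) <= C * N (S u).
Proof.
have [c c0 Hc] := B0_coercive; exists (c^-1 + 1) => [|u].
  by rewrite addr_ge0// invr_ge0 ltW.
have [_ _ domB BE] := B0S; have [Ssa _ _ _] := B0S.
have [g Bg gE] := B0_surjective (S u).
have [Sg SSg] := (domB g).1 Bg; have [v vE] := energy_elem SSg.
have uv : v = u by apply: energy_op_inj; rewrite vE -BE.
have H1 : N (u : H) ^+ 2 <= N (S u) * N g.
  have uE : (u : H) = S g by rewrite -vE uv.
  rewrite (ipnorm_sqr hH) uE (self_adjoint_sym Ssa SSg Sg) -BE// mulrC.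
  exact: (Reip_le hH).
have H2 : N g <= c^-1 * N (S u) by rewrite -gE ler_pdivlMl// Hc.
rewrite -(@ler_pXn2r _ 2%N) ?nnegrE ?ipnorm_ge0//; last first.
  by rewrite mulr_ge0 ?ipnorm_ge0// addr_ge0// invr_ge0 ltW.
rewrite (le_trans H1)// (le_trans (ler_wpM2l (ipnorm_ge0 _ _) H2))//.
rewrite exprMn mulrCA -expr2 ler_wpM2r ?sqr_ge0//.
have : 0 < c^-1 by rewrite invr_gt0.
move: (c^-1) => d d0; nra.
Qed.

Local Notation ipV := (inner_V (B0_pos:=B0_pos) (B0S:=B0S)).

Lemma hilbert_inner_V : hilbert_ip ipV.
Proof.
split=> [a u v w|u v|u u0|u uc].
- by rewrite /inner_V energy_opP (ipDl hH) (ipZl hH).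
- exact: innerC.
- apply: inner_gt0; apply: contra u0 => /eqP Su0.
  by apply/eqP/normr0_eq0; rewrite -[LHS]/(`|S u|) Su0 normr0.
have [|l ul] := @hip_complete _ _ _ hH (fun n => S (u n)).
  by move=> e e0; have [n0 H0] := uc e e0; exists n0 => n m nn nm; rewrite -energy_opB; exact: H0.
have [v vE] := energy_op_surjective l; exists v => e e0.
by have [n0 H0] := ul e e0; exists n0 => n /H0; rewrite -vE -energy_opB.
Qed.

Local Notation ipVH := (inner_VH (B0_pos:=B0_pos) (B0S:=B0S)).

Lemma ipnorm_VH (x : V * H) : ipnorm ipVH x ^+ 2 = N (S x.1) ^+ 2 + N x.2 ^+ 2.
Proof.
rewrite sqr_sqrtr /inner_VH ReD; last first.
  by rewrite addr_ge0 ?(Reip_ge0 hilbert_inner_V) ?(Reip_ge0 hH).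
by rewrite -(ipnorm_sqr hilbert_inner_V) ipnorm_V (ipnorm_sqr hH x.2).
Qed.

Lemma ipnorm_VH1 (x : V * H) : N (S x.1) <= ipnorm ipVH x.
Proof.
rewrite -(@ler_pXn2r _ 2%N) ?nnegrE ?ipnorm_ge0// ipnorm_VH.
by rewrite lerDl sqr_ge0.
Qed.

Lemma ipnorm_VH2 (x : V * H) : N x.2 <= ipnorm ipVH x.
Proof.
rewrite -(@ler_pXn2r _ 2%N) ?nnegrE ?ipnorm_ge0// ipnorm_VH.
by rewrite lerDr sqr_ge0.
Qed.

Lemma ipnorm_VH_le (x : V * H) : ipnorm ipVH x <= N (S x.1) + N x.2.
Proof.
rewrite -(@ler_pXn2r _ 2%N) ?nnegrE ?addr_ge0 ?ipnorm_ge0// ipnorm_VH.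
have := mulr_ge0 (ipnorm_ge0 inner (S x.1)) (ipnorm_ge0 inner x.2); nra.
Qed.

Lemma hilbert_inner_VH : hilbert_ip ipVH.
Proof.
have hV := hilbert_inner_V.
split=> [a u v w|u v|u u0|u uc].
- rewrite /inner_VH /= (hip_linear hV) (hip_linear hH) mulrDr addrACA.
  by [].
- by rewrite /inner_VH (hip_conj hV) (hip_conj hH) rmorphD.
- rewrite /inner_VH; have [u10|u1] := eqVneq u.1 0; last first.
    by rewrite ltr_wpDr ?(hip_pos hV)// (ipE hH) ler0c sqr_ge0.
  rewrite u10 (ip0l hV) add0r (hip_pos hH)//; apply: contra u0 => /eqP u20.
  by apply/eqP; move: u10 u20; case: (u) => /= ? ? -> ->.
have c1 : ipcauchy ipV (fun n => (u n).1).
  move=> e e0; have [n0 H0] := uc e e0; exists n0 => n m nn nm.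
  by rewrite (le_trans (ipnorm_VH1 (u n - u m)))// H0.
have c2 : ipcauchy inner (fun n => (u n).2).
  move=> e e0; have [n0 H0] := uc e e0; exists n0 => n m nn nm.
  by rewrite (le_trans (ipnorm_VH2 (u n - u m)))// H0.
have [l1 H1] := hip_complete hV c1; have [l2 H2] := hip_complete hH c2.
exists (l1, l2) => e e0; have e2 : 0 < e / 2 by rewrite divr_gt0.
have [n1 {}H1] := H1 _ e2; have [n2 {}H2] := H2 _ e2.
exists (maxn n1 n2) => n; rewrite geq_max => /andP[/H1 {}H1 /H2 {}H2].
rewrite (le_trans (ipnorm_VH_le _))// (le_trans (lerD H1 H2))//; lra.
Qed.

Lemma norm_comparable_VH : norm_comparable ipVH.
Proof.
have normE (x : V * H) : `|x| = Num.max `|x.1| `|x.2| by [].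
split=> x; rewrite normE norm_V norm_inner.
  by rewrite /Order.max; case: ifP => _; rewrite lecR ?ipnorm_VH1 ?ipnorm_VH2.
rewrite /Order.max ltcR natrC.
case: ltP => H1; rewrite -rmorphM lecR (le_trans (ipnorm_VH_le _))//; lra.
Qed.

End Energy.
End Spaces.

(** * The operator associated with the damped wave form *)

Section WaveOperator.
Context {R : realType} {H : hilbertType R} {B0 S : unbounded_op H}.
Hypothesis B0_sa : self_adjoint B0.
Context {B0_pos : strictly_positive B0} {B0S : is_sqrt B0 S}.
Local Notation V := (energy_space B0_pos B0S).
Context (A : {linear V -> antidual V}) (B1 : {linear V -> H}).
Hypotheses (A_bnd : bounded_op A) (B1_bnd : bounded_op B1).
Local Notation N := (ipnorm (@inner R H)).
Local Notation hH := (@hilbert_inner R H).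
Local Notation ipV := (inner_V (B0_pos:=B0_pos) (B0S:=B0S)).
Local Notation hV := (hilbert_inner_V B0_sa B0_pos B0S).
Local Notation ipVH := (inner_VH (B0_pos:=B0_pos) (B0S:=B0S)).

(** The constant in [bounded_op] lies in R[i] and may fail to be real, for instance on a zero space;
    its modulus is as good. *)
Lemma bounded_op_real (U W : normedModType R[i]) (f : U -> W) : bounded_op f ->
  exists2 M : R, 0 <= M & forall u, `|f u| <= M%:C * `|u|.
Proof.
move=> [M fM]; exists (normc M); first exact: normc_ge0.
move=> u; have Mu : 0 <= M * `|u| by rewrite (le_trans _ (fM u)).
by rewrite (le_trans (fM u))// -normcE -[leLHS]ger0_norm// normrM normr_id.
Qed.

Lemma antidual_bound (f : V -> antidual V) : bounded_op f ->
  exists2 M : R, 0 <= M & forall u v : V, normc (f u v) <= M * N (S u) * N (S v).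
Proof.
move=> /bounded_op_real[M M0 fM]; exists M => // u v; rewrite -lecR -normcE.
rewrite (le_trans (antidual_normP (f u) v))// rmorphM /= -norm_V// ler_wpM2r//.
by rewrite rmorphM /= -norm_V; exact: fM.
Qed.

Lemma B1_bound : exists2 M : R, 0 <= M & forall u : V, N (B1 u) <= M * N (S u).
Proof.
have [M M0 H1] := bounded_op_real B1_bnd; exists M => // u.
by rewrite -lecR -norm_inner (le_trans (H1 u))// rmorphM /= -norm_V.
Qed.

Lemma antidual_op_linear (f : {linear V -> antidual V}) (a : R[i]) (u v w : V) :
  f (a *: u + v) w = a * f u w + f v w.
Proof. by rewrite linearP. Qed.

Lemma form_b_linear (a : R[i]) (u v w : V) :
  form_b B1 (a *: u + v) w = a * form_b B1 u w + form_b B1 v w.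
Proof.
rewrite /form_b linearP (energy_opP (B0_pos := B0_pos) (B0S := B0S)).
by rewrite !(hip_linear hH) mulrDr addrACA.
Qed.

Lemma form_b_antilinear (u : V) : antilinear (form_b B1 u).
Proof.
move=> a v w; rewrite /form_b (energy_opP (B0_pos := B0_pos) (B0S := B0S)) to_HD to_HZ.
by rewrite !(ipDr hH) !(ipZr hH) mulrDr addrACA.
Qed.

Lemma wave_op_linear (a : R[i]) x z x' z' :
  wave_op A B1 x z -> wave_op A B1 x' z' ->
  wave_op A B1 (a *: x + x') (a *: z + z').
Proof.
move=> [u -> Hu] [u' -> Hu']; exists (a *: u + u').
  case: u u' {Hu Hu'} => [p q] [p' q'].
  have E2 : to_H (a *: q + q') = a *: to_H q + to_H q' by rewrite to_HD to_HZ.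
  by rewrite -[LHS]/(a *: p + p', a *: to_H q + to_H q') -E2.
move=> v; rewrite (hip_linear (hilbert_inner_VH B0_sa B0_pos B0S)) -Hu -Hu'.
rewrite /wave_form /= (hip_linear hV) form_b_linear /form_a antidual_op_linear.
by ring.
Qed.

(** Testing with (z.1, 0) kills the first component. For the second, write z.2 = S w: then (w | S v)
    = (S w | v) = 0 for all v in V, and S v is arbitrary in H. *)
Lemma wave_op_fun z : wave_op A B1 0 z -> z = 0.
Proof.
move=> [[u1 u2] uE Hu].
have u10 : u1 = 0 by case: uE.
have u20 : u2 = 0 by apply: to_H_inj; rewrite to_H0; case: uE.
have Z (v : V * V) : ipVH z (Defs.incl v) = 0.
  rewrite -Hu u10 u20 /wave_form /= (ip0l hV) oppr0 add0r /form_a.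
  have := antidual_op_linear A (-1) 0 0 v.2; rewrite scaler0 addr0 mulN1r addNr => ->.
  have := form_b_linear (-1) 0 0 v.2; rewrite scaler0 addr0 mulN1r addNr => ->.
  exact: addr0.
have [Ssa _ _ _] := B0S.
have z1 : z.1 = 0.
  have := Z (z.1, 0); rewrite /inner_VH /= (ip0r hH) addr0.
  by rewrite (ipE hV) => -[/eqP]; rewrite sqrf_eq0 => /eqP/(ipnorm_eq0 hV).
have z2 : z.2 = 0.
  have [w wE] := energy_op_surjective B0_sa B0_pos B0S z.2.
  have w0 x : inner (w : H) x = 0.
    have [v vE] := energy_op_surjective B0_sa B0_pos B0S x.
    have := Z (0, v); rewrite /inner_VH /= (ip0r hV) add0r -wE.
    by rewrite (self_adjoint_sym Ssa (energy_dom v) (energy_dom w)) vE.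
  rewrite -wE.
  have -> : (w : H) = 0.
    by apply: (ipnorm_eq0 hH); apply/eqP; rewrite -sqrf_eq0 (ipnorm_sqr hH) w0.
  exact: op_at0.
by case: z z1 z2 {Hu Z} => /= ? ? -> ->.
Qed.

(** Besides |S x_2|^2, every term of the form contains one factor |x_2|_V and one bounded by |x|:
    the coupling with constant 1, A with MA, and B1 with MB, whence K. *)
Lemma wave_op_parabolic : exists (K : R) (n1 : nat), parabolic ipVH K n1 (wave_op A B1).
Proof.
have [MA MA0 HA] := antidual_bound A_bnd.
have [MB MB0 HB] := B1_bound.
have [Ce Ce0 He] := embedding B0_sa B0_pos B0S.
pose K := 1 + MA + MB; have K0 : 0 <= K by rewrite !addr_ge0.
(* K^2 is for [par_nK]; 4 MA makes MA / nu <= 1 / 4 and MB^2 <= nu absorbs the B1 term in the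
   coercivity below. *)
pose n1 := (Num.truncn (K ^+ 2 + 4 * MA + MB ^+ 2)).+1.
have n1P : K ^+ 2 + 4 * MA + MB ^+ 2 <= n1%:R.
  have p0 : 0 <= K ^+ 2 + 4 * MA + MB ^+ 2 by rewrite !addr_ge0 ?sqr_ge0// mulr_ge0.
  by have /andP[_ /ltW] := truncn_itv p0.
have sK := sqr_ge0 K; have sM := sqr_ge0 MB.
exists K, n1; split=> //; first lra.
- exact: wave_op_linear.
- exact: wave_op_fun.
- move=> x z [u -> Hu]; rewrite -Hu; exists (N (S u.2)); first exact: ipnorm_ge0.
  rewrite /wave_form /form_a /form_b -(ipE hH).
  set q := inner (S u.2) (S u.2); rewrite addrA addrAC addrK.
  rewrite (le_trans (le_normcD _ _))//.
  have H1 := le_normcD (- ipV u.2 u.1) (A u.1 u.2).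
  rewrite normcN in H1.
  have H2 : normc (ipV u.2 u.1) <= N (S u.2) * N (S u.1) by exact: (ip_le hH).
  have H3 := HA u.1 u.2; have H4 := ip_le hH (B1 u.2) (u.2 : H); have H5 := HB u.2.
  have H6 := ipnorm_VH1 B0_sa (Defs.incl u); have H7 := ipnorm_VH2 B0_sa (Defs.incl u).
  move: H1 H2 H3 H4 H5 H6 H7; rewrite /= /K.
  move: (ipnorm_ge0 inner (S u.1)) (ipnorm_ge0 inner (S u.2)) (ipnorm_ge0 inner (u.2 : H)) (ipnorm_ge0 inner (B1 u.2)).
  move: (N (S u.1)) (N (S u.2)) (N (to_H u.2)) (N (B1 u.2)) (ipnorm ipVH (Defs.incl u)).
  move: (normc _) (normc _) (normc _) (normc _) => r1 r2 r3 r4 s1 s2 s3 s4 n.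
  move=> s10 s20 s30 s40 H1 H2 H3 H4 H5 H6 H7.
  have : s2 * s1 <= s2 * n by rewrite ler_wpM2l.
  have : MA * s2 * s1 <= MA * s2 * n by rewrite ler_wpM2l// mulr_ge0.
  have : s4 * s3 <= MB * s2 * n by rewrite ler_pM.
  clear -H1 H2 H3 H4 H5; lra.
- move=> n [f1 f2]; set nu : R := (n + n1)%:R.
  have nuP : n1%:R <= nu by rewrite ler_nat leq_addl.
  have nu0 : 0 < nu by rewrite ltr0n addn_gt0 orbT.
  (* The first component of the resolvent equation reads - x = nu (f1 - x1), that is x1 = f1 + x /
     nu. Substituting it into the second leaves the problem l x = phi on V alone. *)
  pose l (x v : V) := nu%:C * inner (x : H) (v : H) + nu^-1%:C * A x v + form_b B1 x v.
  pose phi (v : V) := nu%:C * inner f2 (v : H) - A f1 v.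
  have [|||||||x xP] := @lax_milgram _ _ ipV hV l
    (nu * Ce ^+ 2 + nu^-1 * MA + 1 + MB * Ce) (1 / 2) phi (nu * N f2 * Ce + MA * N (S f1)).
  + move=> a u v w; rewrite /l to_HD to_HZ (hip_linear hH) form_b_linear antidual_op_linear; ring.
  + move=> u a v w; rewrite /l to_HD to_HZ (ipDr hH) (ipZr hH) form_b_antilinear.
    by rewrite antidual_linear; ring.
  + move=> u v; rewrite /l /form_b.
    set t1 := nu%:C * _; set t2 := _%:C * A u v; set t3 := inner (S u) (S v).
    set t4 := inner (B1 u) _.
    have G1 := le_normcD (t1 + t2) (t3 + t4); have G2 := le_normcD t1 t2.
    have G3 := le_normcD t3 t4.
    have E1 : normc t1 <= nu * (Ce * N (S u) * (Ce * N (S v))).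
      rewrite /t1 normc_rscale ?(ltW nu0)// ler_wpM2l ?(ltW nu0)//.
      by rewrite (le_trans (ip_le hH _ _))// ler_pM ?ipnorm_ge0.
    have E2 : normc t2 <= nu^-1 * (MA * N (S u) * N (S v)).
      by rewrite /t2 normc_rscale ?invr_ge0 ?(ltW nu0)// ler_wpM2l ?invr_ge0 ?(ltW nu0).
    have E3 : normc t3 <= N (S u) * N (S v) by exact: (ip_le hH).
    have E4 : normc t4 <= MB * N (S u) * (Ce * N (S v)).
      by rewrite (le_trans (ip_le hH _ _))// ler_pM ?ipnorm_ge0.
    rewrite !ipnorm_V; move: G1 G2 G3 E1 E2 E3 E4.
    move: (N (S u)) (N (S v)) (normc t1) (normc t2) (normc t3) (normc t4) => *.
    lra_let.
  + by rewrite divr_gt0.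
  + move=> u; rewrite /l /form_b !ReD !ReZ -(ipnorm_sqr hH (u : H)) -(ipnorm_sqr hH (S u)).
    rewrite ipnorm_V.
    have E1 : - (MA * N (S u) * N (S u)) <= Re (A u u).
      by rewrite lerNl -ReN (le_trans (Re_normc _))// normcN.
    have E2 : - (MB * N (S u) * N (u : H)) <= Re (inner (B1 u) (u : H)).
      rewrite lerNl -ReN (le_trans (Re_normc _))// normcN (le_trans (ip_le hH _ _))//.
      by rewrite ler_wpM2r ?ipnorm_ge0.
    have E3 : nu^-1 * MA <= 1 / 4 by rewrite mulrC ler_pdivrMr//; lra_let.
    have E4 : nu^-1 * - (MA * N (S u) * N (S u)) <= nu^-1 * Re (A u u).
      by rewrite ler_wpM2l// invr_ge0 ltW.
    have E5 : MB ^+ 2 * N (u : H) ^+ 2 <= nu * N (u : H) ^+ 2.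
      by rewrite ler_wpM2r ?sqr_ge0//; lra_let.
    have E6 : nu^-1 * MA * N (S u) ^+ 2 <= 1 / 4 * N (S u) ^+ 2.
      by rewrite ler_wpM2r ?sqr_ge0.
    (* This square gives MB |S u| |u| <= |S u|^2 / 4 + MB^2 |u|^2. Another quarter of |S u|^2 is
       spent on A, which leaves the coercivity constant 1 / 2. *)
    have := sqr_ge0 (N (S u) / 2 - MB * N (u : H)).
    move: E2 E4 E5 E6; move: (Re _) (Re _) (nu^-1) (N (S u)) (N _) => *; lra_let.
  + by move=> a u v; rewrite /phi to_HD to_HZ (ipDr hH) (ipZr hH) antidual_linear; ring.
  + move=> v; rewrite /phi (le_trans (le_normcD _ _))// normcN normc_rscale ?(ltW nu0)//.
    have E1 := HA f1 v; have E2 := ip_le hH f2 (v : H).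
    have E3 : nu * normc (inner f2 (v : H)) <= nu * (N f2 * (Ce * N (S v))).
      rewrite ler_wpM2l ?(ltW nu0)// (le_trans E2)// ler_wpM2l ?ipnorm_ge0//.
    by rewrite ipnorm_V; move: E1 E3; move: (normc _) (normc _) => *; lra_let.
  pose x1 : V := f1 + nu^-1%:C *: x.
  exists (x1, x : H); exists (x1, x) => // v.
  set z := (X in ipVH X _).
  have z1E : z.1 = - x.
    rewrite -[LHS]/(nu%:C *: (f1 - x1)) /x1 opprD addrA subrr sub0r scalerN.
    by rewrite scalerA -rmorphM /= mulfV ?scale1r// gt_eqF.
  have z2E : z.2 = nu%:C *: (f2 - (x : H)) by [].
  have AE : A x1 v.2 = nu^-1%:C * A x v.2 + A f1 v.2.
    by rewrite /x1 addrC antidual_op_linear.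
  have xv : l x v.2 - phi v.2 = 0 by rewrite xP subrr.
  rewrite /wave_form /inner_VH z1E z2E /form_a /= AE (ipNl hV) (ipZl hH) (ipBl hH).
  apply/subr0_eq; rewrite -[RHS]xv /l /phi.
  by ring.
Qed.

(* D(B0) is dense in V: if (g | w)_V = (g | B0 w)_H = 0 for all w in D(B0), then
   g = 0 because B0 is onto. *)
Lemma bounded_extension_form_b (Bx : {linear V -> antidual V}) :
  bounded_extension B1 Bx -> forall u v : V, Bx u v = form_b B1 u v.
Proof.
move=> [Bx_bnd BxE] u v.
have [MX MX0 HX] := antidual_bound Bx_bnd; have [MB MB0 HB] := B1_bound.
pose M := [set u : V | Bx u v = form_b B1 u v].
suff : M u by [].
have [[_ Ssa] _ domB BE] := B0S; have [Ssa' _ _ _] := B0S.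
apply: (closed_submod_full hV) => [|g gM].
  split=> [|a x y Mx My|x l xM xl].
  - rewrite /M /= linear0 /form_b linear0 to_H0 op_at0 !(ip0l hH) addr0.
    by [].
  - rewrite /M /= antidual_op_linear form_b_linear; congr (_ * _ + _); [exact: Mx|exact: My].
  apply/subr0_eq/eqP; rewrite -normc_eq0 eq_le normc_ge0 andbT.
  apply/ler_addgt0Pr => e e0; rewrite add0r.
  pose C := MX * N (S v) + N (S v) + MB * N (v : H).
  have C0 : 0 <= C by rewrite !addr_ge0 ?mulr_ge0 ?ipnorm_ge0.
  have C1 : 0 < C + 1 by rewrite ltr_wpDl.
  have [n0 /(_ n0 (leqnn _))] := xl _ (divr_gt0 e0 C1).
  set y := l - x n0.
  rewrite (ipnormC hV) -/y => yn0.
  have yn : N (S y) * (C + 1) <= e by rewrite -ler_pdivlMr.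
  have lE : l = 1 *: y + x n0 by rewrite scale1r subrK.
  have -> : Bx l v - form_b B1 l v = Bx y v - form_b B1 y v.
    have xn : Bx (x n0) v = form_b B1 (x n0) v := xM n0.
    rewrite lE antidual_op_linear form_b_linear xn !mul1r.
    by rewrite opprD addrACA subrr addr0.
  rewrite (le_trans (le_normcD _ _))// normcN /form_b.
  have G1 := HX y v; have G2 := le_normcD (inner (S y) (S v)) (inner (B1 y) (v : H)).
  have G3 := ip_le hH (S y) (S v); have G4 := ip_le hH (B1 y) (v : H).
  have G5 : N (B1 y) * N (v : H) <= MB * N (S y) * N (v : H) by rewrite ler_wpM2r ?ipnorm_ge0.
  have y0 := ipnorm_ge0 inner (S y).
  have CE : C * N (S y) = MX * N (S y) * N (S v) + N (S y) * N (S v) + MB * N (S y) * N (v : H).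
    by rewrite /C; ring.
  move: yn; rewrite mulrDr mulr1 [_ * C]mulrC CE; lra_let.
have [w Bw wE] := B0_surjective B0_sa B0_pos g.
have [Sw SSw] := (domB w).1 Bw; have [w' w'E] := energy_elem B0_pos B0S Sw.
have Mw : M w'.
  have Bw' : dom (damping (B0_pos := B0_pos) (B0S := B0S) B1) (w' : H) by rewrite w'E.
  by rewrite /M /= BxE// form_bE.
have gx : inner (g : H) (B0 w) = 0.
  rewrite BE// -(self_adjoint_sym Ssa' SSw (energy_dom g)).
  by have := gM w' Mw; rewrite /inner_V w'E.
apply: to_H_inj; rewrite to_H0; apply: (ipnorm_eq0 hH); apply/eqP.
by rewrite -sqrf_eq0 (ipnorm_sqr hH) -[X in inner _ X]wE gx.
Qed.

End WaveOperator.

(** When A = rho B, a (u1, v) + b (u2, v) = b (rho u1 + u2, v). So only the combination rho u1 + u2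
    has to lie in D(B) for (u1, u2) to be in the domain of the wave operator. *)
Lemma wave_op_initial (R : realType) (H : hilbertType R) (B0 S : unbounded_op H)
  (B0_sa : self_adjoint B0) (B0_pos : strictly_positive B0) (B0S : is_sqrt B0 S)
  (A Bx : {linear energy_space B0_pos B0S -> antidual (energy_space B0_pos B0S)})
  (B1 : {linear energy_space B0_pos B0S -> H}) (rho : R[i]) :
  bounded_op B1 -> bounded_extension B1 Bx -> (forall u, A u = rho *: Bx u) ->
  forall u1 u2 : energy_space B0_pos B0S, dom (damping B1) (rho *: u1 + u2) ->
  wave_op A B1 (u1, u2 : H) (- u2, damping B1 (rho *: u1 + u2)).
Proof.
move=> B1_bnd Bext AE u1 u2 Bu; exists (u1, u2) => // v.
have hV := hilbert_inner_V B0_sa B0_pos B0S.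
rewrite /wave_form /inner_VH /form_a /= (ipNl hV) -addrA; congr (_ + _).
apply: (etrans _ (form_bE v.2 Bu)).
rewrite AE antidualZ -!(bounded_extension_form_b B0_sa B1_bnd Bext).
by rewrite antidual_op_linear.
Qed.

Theorem corollary3p2 (R : realType) (H : hilbertType R)
  (H_sep : separable H)
  (B0 : unbounded_op H) (B0_sa : self_adjoint B0)
  (B0_pos : strictly_positive B0)
  (S : unbounded_op H) (B0S : is_sqrt B0 S)
  (A : {linear energy_space B0_pos B0S -> antidual (energy_space B0_pos B0S)})
  (A_bnd : bounded_op A)
  (B1 : {linear energy_space B0_pos B0S -> H}) (B1_bnd : bounded_op B1) :
  [/\ generates_analytic_semigroup (pi / 2) (neg_op (wave_op A B1)),
      (forall (u10 : energy_space B0_pos B0S) (u20 : H),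
         exists_unique_solution (mild_solution (wave_op A B1)) (u10, u20)) &
      (forall (rho : R[i])
         (Bx : {linear energy_space B0_pos B0S ->
                       antidual (energy_space B0_pos B0S)}),
         bounded_extension B1 Bx ->
         (forall u, A u = rho *: Bx u) ->
         forall u10 u20 : energy_space B0_pos B0S,
           dom (damping B1) (rho *: u10 + u20 : energy_space B0_pos B0S) ->
           exists_unique_solution (classical_solution (wave_op A B1))
             (u10, u20 : H))].
Proof.
have hip := hilbert_inner_VH B0_sa B0_pos B0S.
have hn := norm_comparable_VH B0_sa B0_pos B0S.
have [K [n1 hA]] := wave_op_parabolic B0_sa A_bnd B1_bnd.
split=> [|u10 u20|rho Bx Bext AE u10 u20 Bu].
- exact: parabolic_generates hip hn hA.
- exact: parabolic_mild hip hn hA _.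
- have W := wave_op_initial B0_sa B1_bnd Bext AE Bu.
  exact: (parabolic_classical hip hn hA W).
Qed.
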